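(* Let $n\ge1$ be an integer and let $\alpha,t,q$ be real numbers with $n<\alpha$ and $\frac n\alpha<t<1<q$. Let $t'$ be defined by $\frac1t+\frac1{t'}=1$ and set $$\gamma:=\frac{n-q\alpha-\frac{n}{t'}q}{n(1-q)},$$ which satisfies $\gamma>1$. Then there is a positive constant $\mathscr C(n,\alpha,q,t)$ such that $$\|E_\alpha f\|_{L^{t'}(\mathbb R^n)}\,\|f\|_{L^q(\mathbb R^n)}^{\gamma-1}\ \ge\ \mathscr C(n,\alpha,q,t)\,\|f\|_{L^1(\mathbb R^n)}^{\gamma}$$ for every nonnegative $f\in L^1(\mathbb R^n)\cap L^q(\mathbb R^n)$ with $f\not\equiv0$. Moreover, the sharp (largest possible) constant $\mathscr C(n,\alpha,q,t)$ is achieved: there exists a nonnegative, not identically zero, radially symmetric, non-increasing, bounded function with compact support for which equality holds with the sharp constant.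
   Context: For a nonnegative measurable $f$ on $\mathbb R^n$, $E_\alpha f(x):=\int_{\mathbb R^n}|x-y|^{\alpha-n}f(y)\,dy\in[0,\infty]$, $x\in\mathbb R^n$. For real $p\ne 0$, $f\in L^p(\mathbb R^n)$ means $\int_{\mathbb R^n}|f|^p\,dx<\infty$, and $\|f\|_{L^p(\mathbb R^n)}:=\left(\int_{\mathbb R^n}|f|^p\,dx\right)^{1/p}$. Note that $0<t<1$ gives $t'<0$; for negative exponents the usual conventions $0^{t'}=\infty$, $\infty^{t'}=0$, $0^{1/t'}=\infty$, $\infty^{1/t'}=0$ are used, so $\|E_\alpha f\|_{L^{t'}}\in[0,\infty]$. ''Radially symmetric, non-increasing'' means $f(x)=\varphi(|x|)$ with $\varphi$ non-increasing. *)

(* Defs.v *)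
From HB Require Import structures.
From mathcomp Require Import all_boot all_order all_algebra.
From mathcomp Require Import all_classical all_reals all_analysis.
From mathcomp Require Import measurable_realfun simple_functions.
Set Implicit Arguments.
Unset Strict Implicit.
Unset Printing Implicit Defensive.
Import Order.TTheory GRing.Theory Num.Theory.
Import HBNNSimple.
Import numFieldTopology.Exports numFieldNormedType.Exports.
Local Open Scope classical_set_scope.
Local Open Scope ring_scope.

(* The sigma-algebra of R^n is the one generated by the coordinates, i.e. the
   Borel sigma-algebra. *)
Definition measure_rV_display : measure_display -> measure_display.
Proof. exact. Qed.

Section measurable_rV.
Context {d} {T : measurableType d}.
Variable n : nat.

Let coords (i : 'I_n) (x : 'rV[T]_n) : T := x ord0 i.

Let rV_set0 : g_sigma_preimage coords set0.
Proof. exact: sigma_algebra0. Qed.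

Let rV_setC A : g_sigma_preimage coords A -> g_sigma_preimage coords (~` A).
Proof. exact: sigma_algebraC. Qed.

Let rV_bigcup (F : _^nat) : (forall i, g_sigma_preimage coords (F i)) ->
  g_sigma_preimage coords (\bigcup_i (F i)).
Proof. exact: sigma_algebra_bigcup. Qed.

HB.instance Definition _ := @isMeasurable.Build (measure_rV_display d)
  'rV[T]_n (g_sigma_preimage coords) rV_set0 rV_setC rV_bigcup.

End measurable_rV.

Lemma measurable_coord d (T : measurableType d) n (i : 'I_n) :
  measurable_fun [set: 'rV[T]_n] (fun x : 'rV[T]_n => x ord0 i).
Proof.
move=> _ Y mY; rewrite setTI; apply: sub_sigma_algebra => /=.
rewrite -bigcup_seq/=; exists i => /=; first by rewrite mem_index_enum.
by exists Y => //; rewrite setTI.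
Qed.

Lemma measurable_fun_rVP d1 d2 (T1 : measurableType d1)
    (T2 : measurableType d2) n (f : T1 -> 'rV[T2]_n) :
  (forall i, measurable_fun [set: T1] (fun x => f x ord0 i)) ->
  measurable_fun [set: T1] f.
Proof.
move=> mf.
suff : g_sigma_preimage (fun i => (fun x : 'rV[T2]_n => x ord0 i) \o f)
    `<=` measurable.
  rewrite g_sigma_preimage_comp => prefS.
  by move=> _ A mA; apply: prefS; exists A.
apply: smallest_sub; first exact: sigma_algebra_measurable.
rewrite -bigcup_seq => A [i /= _ [B mB <-]]; exact: mf.
Qed.

Definition rV_cons (R : realType) n (p : R * 'rV[R]_n) : 'rV[R]_n.+1 :=
  row_mx (const_mx p.1 : 'rV_1) p.2.

Lemma rV_cons0 (R : realType) n (p : R * 'rV[R]_n) :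
  rV_cons p ord0 ord0 = p.1.
Proof.
by rewrite /rV_cons [LHS](@mxE); case: splitP => // j _; rewrite mxE.
Qed.

Lemma rV_consS (R : realType) n (p : R * 'rV[R]_n) (i : 'I_n) :
  rV_cons p ord0 (lift ord0 i) = p.2 ord0 i.
Proof.
by rewrite -rshift1 /rV_cons (@row_mxEr _ 1 1 n).
Qed.

Lemma measurable_rV_cons (R : realType) n :
  measurable_fun [set: R * 'rV[R]_n] (@rV_cons R n).
Proof.
apply: measurable_fun_rVP => i; case: (unliftP ord0 i) => [j|] ->.
  under eq_fun do rewrite rV_consS.
  exact: (measurableT_comp (measurable_coord j)).
rewrite (_ : (fun _ => _) = fst); first exact: measurable_fst.
by apply/funext => p; rewrite rV_cons0.
Qed.

Section lebesgue_rV_succ.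
Local Open Scope ereal_scope.
Context {R : realType} (n : nat).
Variable mu : {sigma_finite_measure set 'rV[R]_n -> \bar R}.

Definition lebesgue_rV_succ : set 'rV[R]_n.+1 -> \bar R :=
  pushforward (@lebesgue_measure R \x mu) (@rV_cons R n).

Let pre A : measurable A -> measurable (@rV_cons R n @^-1` A).
Proof.
by move=> mA; rewrite -[X in measurable X]setTI; exact: measurable_rV_cons.
Qed.

Let succ0 : lebesgue_rV_succ set0 = 0.
Proof. by rewrite /lebesgue_rV_succ /pushforward preimage_set0 measure0. Qed.

Let succ_ge0 A : 0 <= lebesgue_rV_succ A.
Proof. by rewrite /lebesgue_rV_succ /pushforward measure_ge0. Qed.

Let succ_sigma_additive : semi_sigma_additive lebesgue_rV_succ.
Proof.
move=> F mF tF mUF; rewrite /lebesgue_rV_succ /pushforward preimage_bigcup.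
apply: measure_semi_sigma_additive.
- by move=> i; exact: pre.
- apply/trivIsetP => /= i j _ _ ij; rewrite -preimage_setI.
  by move/trivIsetP : tF => /(_ _ _ _ _ ij) ->//; rewrite preimage_set0.
- by rewrite -preimage_bigcup; exact: pre.
Qed.

HB.instance Definition _ := isMeasure.Build _ _ _ lebesgue_rV_succ
  succ0 succ_ge0 succ_sigma_additive.

Let succ_sigma_finite : sigma_finite setT lebesgue_rV_succ.
Proof.
have [F UF mF] : sigma_finite setT (@lebesgue_measure R \x mu).
  have /sigma_finiteP[F [TF ndF Foo]] := sigma_finiteT (@lebesgue_measure R).
  have /sigma_finiteP[G [TG ndG Goo]] := sigma_finiteT mu.
  exists (fun i => F i `*` G i).
    rewrite -setXTT TF TG predeqE => -[x y]; split.
      move=> [/= [i _ Fnx] [k _ Gky]]; exists (maxn i k) => //; split.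
      - by move: x Fnx; exact/subsetPset/ndF/leq_maxl.
      - by move: y Gky; exact/subsetPset/ndG/leq_maxr.
    by move=> [i _ []/= ? ?]; split; exists i.
  move=> k; have [? ?] := Foo k; have [? ?] := Goo k.
  split; first exact: measurableX.
  by rewrite product_measure1E// lte_mul_pinfty// ge0_fin_numE.
pose g (x : 'rV[R]_n.+1) := (x ord0 ord0, \row_i x ord0 (lift ord0 i)).
have Kg : cancel (@rV_cons R n) g.
  case=> a x; rewrite /g rV_cons0; congr pair.
  by apply/rowP => i; rewrite mxE rV_consS.
have mg : measurable_fun [set: 'rV[R]_n.+1] g.
  apply/measurable_fun_pairP; split; first exact: measurable_coord.
  apply: measurable_fun_rVP => i /=.
  under eq_fun do rewrite mxE.
  exact: measurable_coord.
exists (fun i => g @^-1` F i).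
  by rewrite -preimage_bigcup -UF preimage_setT.
move=> i; have [mFi Fioo] := mF i; split.
  by rewrite -[X in measurable X]setTI; exact: mg.
rewrite /lebesgue_rV_succ /pushforward -comp_preimage.
by rewrite (_ : g \o _ = id)//; apply/funext => x /=; rewrite Kg.
Qed.

HB.instance Definition _ := Measure_isSigmaFinite.Build _ _ _ lebesgue_rV_succ
  succ_sigma_finite.

End lebesgue_rV_succ.

(* Lebesgue measure on R^n, as an iterated product of one-dimensional ones;
   [lebesgue_rV_box] below checks its normalization. *)
Fixpoint lebesgue_rV (R : realType) (n : nat) :
    {sigma_finite_measure set 'rV[R]_n -> \bar R} :=
  match n with
  | 0 => \d_(0 : 'rV[R]_0)
  | m.+1 => lebesgue_rV_succ (lebesgue_rV R m)
  end.

Lemma lebesgue_rV_box (R : realType) (n : nat) (a b : 'rV[R]_n) :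
  (forall i, a ord0 i <= b ord0 i) ->
  lebesgue_rV R n [set x | forall i, x ord0 i \in `[a ord0 i, b ord0 i]] =
  (\prod_(i < n) (b ord0 i - a ord0 i))%:E.
Proof.
elim: n a b => [|n IH] a b ab.
  rewrite big_ord0 /= diracE (_ : (_ \in _) = true)//.
  by apply/mem_set => -[].
pose a' : 'rV[R]_n := \row_i a ord0 (lift ord0 i).
pose b' : 'rV[R]_n := \row_i b ord0 (lift ord0 i).
pose B := [set x : 'rV[R]_n | forall i, x ord0 i \in `[a' ord0 i, b' ord0 i]].
have mB : measurable B.
  rewrite (_ : B = \bigcap_(i in [set: 'I_n])
      ((fun x : 'rV[R]_n => x ord0 i) @^-1` `[a' ord0 i, b' ord0 i])); last first.
    by apply/seteqP; split=> [x Bx i _|x Bx i]; [exact: Bx|exact: Bx].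
  apply: fin_bigcap_measurable => // i _.
  rewrite -[X in measurable X]setTI; exact: measurable_coord.
rewrite /= /lebesgue_rV_succ /pushforward.
rewrite (_ : _ @^-1` _ = `[a ord0 ord0, b ord0 ord0]%classic `*` B); last first.
  apply/seteqP; split=> [[u x] /= H|[u x] /= [Hu HB] i].
    split; first by have := H ord0; rewrite rV_cons0.
    by move=> i; have := H (lift ord0 i); rewrite rV_consS !mxE.
  case: (unliftP ord0 i) => [j|] ->; last by rewrite rV_cons0.
  by have := HB j; rewrite rV_consS !mxE.
rewrite product_measure1E//= IH; last by move=> i; rewrite !mxE.
rewrite lebesgue_measure_itv/= big_ord_recl lte_fin.
rewrite (eq_bigr (fun i => b ord0 (lift ord0 i) - a ord0 (lift ord0 i))); last first.
  by move=> i _; rewrite !mxE.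
rewrite EFinM; have [//|ba] := ltP (a ord0 ord0) (b ord0 ord0).
by rewrite (_ : b ord0 ord0 = a ord0 ord0) ?subrr//; apply/le_anti; rewrite ba ab.
Qed.

(* Lebesgue measurability on R^n, that is, measurability with respect to the
   completion of the Borel sigma-algebra. *)
Definition lebesgue_measurable_fun (R : realType) (n : nat)
    (f : 'rV[R]_n -> R) : Prop :=
  exists2 g : 'rV[R]_n -> R,
    measurable_fun [set: 'rV[R]_n] g & {ae lebesgue_rV R n, forall x, f x = g x}.

(* The integral of a nonnegative function being a supremum over the simple
   functions below it, it is insensitive to null sets even when the function is
   not Borel: no completed measure is needed to integrate Lebesgue measurable
   functions. *)
Lemma ae_eq_integral_nonneg d (T : measurableType d) (R : realType)
    (mu : {measure set T -> \bar R}) (f g : T -> \bar R) :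
  (forall x, 0 <= f x)%E -> (forall x, 0 <= g x)%E ->
  measurable_fun [set: T] g -> {ae mu, forall x, f x = g x} ->
  (\int[mu]_x f x = \int[mu]_x g x)%E.
Proof.
move=> f0 g0 mg [N [mN N0 fgN]].
have fg x : ~ N x -> f x = g x.
  by move=> Nx; apply: contrapT => ?; exact/Nx/fgN.
have mNC : measurable (~` N) by exact: measurableC.
have mgN : measurable_fun (~` N) g by exact: measurable_funS mg.
have gN : (\int[mu]_x g x = \int[mu]_(x in ~` N) g x)%E.
  by rewrite (ge0_negligible_integral mN)// setTD.
apply/eqP; rewrite eq_le; apply/andP; split.
  rewrite ge0_integralTE//; apply: ge_ereal_sup => _ [h hf <-].
  rewrite -integralT_nnsfun (ge0_negligible_integral mN)//; last 2 first.
  - exact/measurable_EFinP/measurable_funP.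
  - by move=> x _; rewrite lee_fin; exact: fun_ge0.
  rewrite setTD gN; apply: ge0_le_integral => //.
  - by move=> x _; rewrite lee_fin; exact: fun_ge0.
  - by apply: measurable_funTS; exact/measurable_EFinP/measurable_funP.
  - by move=> x Nx; rewrite -fg.
rewrite gN integral_mkcond !ge0_integralTE//; last exact: erestrict_ge0.
apply: le_ereal_sup => _ [h hg <-]; exists h => // x.
apply: (le_trans (hg x)); rewrite patchE; case: ifPn => [|_]; last exact: f0.
by rewrite inE => /fg ->.
Qed.

(* Powers of x in [0, +oo] for any real exponent, with 0 ^ r = +oo and
   +oo ^ r = 0 for r < 0; the library's [`^] has 0 ^ r = 0 and +oo ^ r = +oo. *)
Definition epow (R : realType) (x : \bar R) (r : R) : \bar R :=
  if r < 0 then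
    match x with
    | s%:E => if s == 0 then +oo%E else (s `^ r)%:E
    | _ => 0%E
    end
  else (x `^ r)%E.

Definition lp_norm (R : realType) (n : nat) (p : R) (f : 'rV[R]_n -> \bar R) :
    \bar R :=
  epow (\int[lebesgue_rV R n]_x epow `|f x|%E p)%E p^-1.

Lemma lp_norm_Lnorm (R : realType) (n : nat) (p : R) (f : 'rV[R]_n -> \bar R) :
  0 < p -> lp_norm p f = ('N[lebesgue_rV R n]_(p%:E)[f])%E.
Proof.
move=> p0; rewrite /lp_norm unlock /epow invr_lt0 (lt_gtF p0).
by [].
Qed.

Definition in_Lp (R : realType) (n : nat) (p : R) (f : 'rV[R]_n -> R) : Prop :=
  lebesgue_measurable_fun f /\
  (\int[lebesgue_rV R n]_x epow `|f x|%:E p < +oo)%E.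

(* The library's norm on ['rV[R]_n] is the sup norm. *)
Definition euclidean_norm (R : realType) (n : nat) (x : 'rV[R]_n) : R :=
  Num.sqrt (\sum_(i < n) x ord0 i ^+ 2).

Definition E_alpha (R : realType) (n : nat) (alpha : R) (f : 'rV[R]_n -> R)
    (x : 'rV[R]_n) : \bar R :=
  (\int[lebesgue_rV R n]_y
    (euclidean_norm (x - y) `^ (alpha - n%:R) * f y)%:E)%E.

(* [f] stands for its almost-everywhere class, so that "not identically zero"
   means not almost everywhere zero. *)
Definition admissible (R : realType) (n : nat) (q : R) (f : 'rV[R]_n -> R) :
    Prop :=
  [/\ forall x, 0 <= f x, in_Lp 1 f, in_Lp q f
    & ~ {ae lebesgue_rV R n, forall x, f x = 0}].

Definition reverse_HLS_lhs (R : realType) (n : nat) (alpha q t' gamma : R)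
    (f : 'rV[R]_n -> R) : \bar R :=
  (lp_norm t' (E_alpha alpha f) * lp_norm q (EFin \o f) `^ (gamma - 1))%E.

Definition reverse_HLS_rhs (R : realType) (n : nat) (gamma C : R)
    (f : 'rV[R]_n -> R) : \bar R :=
  (C%:E * lp_norm 1 (EFin \o f) `^ gamma)%E.

Definition reverse_HLS_holds (R : realType) (n : nat)
    (alpha q t' gamma C : R) : Prop :=
  forall f : 'rV[R]_n -> R, admissible q f ->
    (reverse_HLS_rhs gamma C f <= reverse_HLS_lhs alpha q t' gamma f)%E.

Definition radially_nonincreasing (R : realType) (n : nat)
    (f : 'rV[R]_n -> R) : Prop :=
  exists2 phi : R -> R,
    {in `[0, +oo[ &, nonincreasing_fun phi}
    & forall x, f x = phi (euclidean_norm x).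

Definition compactly_supported (R : realType) (n : nat)
    (f : 'rV[R]_n -> R) : Prop :=
  compact (closure [set x | f x != 0]).

(* Main.v *)
Require Import Defs.
From HB Require Import structures.
From mathcomp Require Import all_boot all_order all_algebra.
From mathcomp Require Import all_classical all_reals all_analysis.
From mathcomp Require Import measurable_realfun ring lra.

(** Put [beta = alpha - n], [s = - t'] and [b = (gamma - 1) / q].  The quotient
    is invariant under translations, dilations and multiplication by constants,
    so the sharp constant [C] is the infimum of [||E f||_t'] over [f] with
    [\int f = \int f ^ q = 1].  Since [|x - z| ^ beta] is at most
    [2 ^ beta (|x - y| ^ beta + |y - z| ^ beta)], an [f] of mass 1 satisfies
    [E f x >= max m (c |x - z| ^ beta)] for any near-minimum [z] of [E f]; this
    gives [C > 0] and makes centred minimising sequences tight.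

    By the arithmetic-geometric inequality, optimisers are obtained by minimising
    [b \int f ^ q + ||E f||_t' / C - gamma \int f].  With
    [g = (E f) ^ (- s - 1)], suitably normalised, reverse Hoelder bounds
    [||E f'||_t'] by [\int g E f' = \int f' E g], with equality at [f' = f], so
    that replacing [f] by [((gamma - E g)_+ / (b q)) ^ (1 / (q - 1))] does not
    increase the functional.  Along a centred minimising sequence the functions
    [E g] are equicontinuous and grow at infinity: the replacements converge
    pointwise, inside a fixed box, to a minimiser which is its own replacement.

    Polarising [f] and [g] across a hyperplane decreases [\int g E f], strictly
    unless [f] is ordered by the reflection.  Minimality thus orders [f] across
    every hyperplane; integrating [r - x.e] against [f] shows that the larger
    values lie on the side of the barycentre and that [f] is symmetric about
    the hyperplanes through it, so [f] is radially nonincreasing about it. *)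

Set Implicit Arguments.
Unset Strict Implicit.
Unset Printing Implicit Defensive.
Import Order.TTheory GRing.Theory Num.Theory.
Import numFieldTopology.Exports numFieldNormedType.Exports.
Local Open Scope classical_set_scope.
Local Open Scope ring_scope.

(** * Translation invariance and Euclidean geometry of R^n *)

(** No limit of the minimising sequence itself is taken, so weak compactness never enters. Each
    member is replaced by an explicit function of its dual potential [E g]; as all the [g] lie below
    one integrable weight, pointwise limits and dominated convergence suffice. The hypothesis
    [n / alpha < t] amounts to [n < s beta], which makes the power [- s] of that weight integrable.

    The additive functional is preferred to the quotient because, once the norm of exponent [t'] is
    majorised linearly, it can be minimised point by point. Its infimum [1 + b - gamma] is negative,
    since [gamma - 1 = q b] and [1 < q]; this is what prevents the mass from vanishing in the limit.

    Polarization compares two points at a time, so that its equality case needs only Tonelli and a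
    pointwise inequality. What it yields holds almost everywhere, with an exceptional set depending
    on the hyperplane. The fixed point equation expresses [f] through integrals and upgrades each
    ordering to one valid at every point, so that any two points can be compared across their own
    bisector. *)

Section lebesgue_rV_invariance.
Context {R : realType}.

Lemma lebesgue_measureD (a : R) (A : set R) : measurable A ->
  lebesgue_measure ((fun x : R => x + a) @^-1` A) = lebesgue_measure A.
Proof.
move=> mA.
have mS : measurable_fun setT ((fun x : R => x + a) : measurableTypeR R -> measurableTypeR R).
  exact: measurable_funD.
apply/esym.
apply: (lebesgue_measure_unique (mu := pushforward lebesgue_measure
  ((fun x : R => x + a) : measurableTypeR R -> measurableTypeR R))) => //.
move=> _ [[b c]] _ <-; rewrite /= /pushforward.
have -> : (fun x : R => x + a) @^-1` `]b, c] = `](b - a), (c - a)]%classic.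
  by apply/seteqP; split => x /=; rewrite !in_itv /= ltrBlDr lerBrDr.
rewrite !lebesgue_measure_itv /= !lte_fin ltrD2r.
by case: ifP => // _; rewrite -!EFinD; congr (_%:E); ring.
Qed.

Section dim.
Variable n : nat.
Local Notation V := 'rV[R]_n.

Lemma measurable_rVD (v : V) : measurable_fun setT (fun x : V => x + v).
Proof.
apply: measurable_fun_rVP => i; under eq_fun do rewrite mxE.
by apply: measurable_funD => //; exact: measurable_coord.
Qed.

Lemma measurable_preimage d d' (T : measurableType d) (U : measurableType d')
  (f : T -> U) (A : set U) :
  measurable_fun setT f -> measurable A -> measurable (f @^-1` A).
Proof. by move=> mf mA; rewrite -[X in measurable X]setTI; exact: mf. Qed.
End dim.

(** Through [rV_cons] a translation becomes a product of translations, and a product measure is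
    determined by its values on rectangles. *)
Lemma lebesgue_rVD (n : nat) (v : 'rV[R]_n) (A : set 'rV[R]_n) : measurable A ->
  lebesgue_rV R n ((fun x => x + v) @^-1` A) = lebesgue_rV R n A.
Proof.
elim: n v A => [|n IH] v A mA /=.
  by congr (_ _); apply/seteqP; split => x /=; rewrite (thinmx0 v) addr0.
rewrite /lebesgue_rV_succ /pushforward.
pose v' : 'rV[R]_n := \row_i v ord0 (lift ord0 i).
pose S (p : measurableTypeR R * 'rV[R]_n) : measurableTypeR R * 'rV[R]_n :=
    ((p.1 : R) + v ord0 ord0, p.2 + v').
have mS : measurable_fun setT S.
  apply/measurable_fun_pairP; split => /=.
    by apply: measurable_funD => //; exact: measurable_fst.
  by apply: (measurableT_comp (measurable_rVD v')); exact: measurable_snd.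
have -> : @rV_cons R n @^-1` ((fun x => x + v) @^-1` A) =
    S @^-1` (@rV_cons R n @^-1` A).
  apply/seteqP; split => p /=; rewrite (_ : rV_cons p + v = rV_cons (S p)) //;
  apply/rowP => i; rewrite mxE; case: (unliftP ord0 i) => [j|] ->;
  by rewrite ?rV_consS ?rV_cons0 /= ?mxE.
have mA' : measurable (@rV_cons R n @^-1` A).
  by apply: measurable_preimage mA; exact: measurable_rV_cons.
apply/esym; have := @product_measure_unique _ _ (measurableTypeR R) 'rV[R]_n R (@lebesgue_measure R)
  (lebesgue_rV R n) (pushforward
  (@lebesgue_measure R \x lebesgue_rV R n)%E S).
move=> /(_ _ _ _ mA'); apply => //.
move=> B C mB mC.
transitivity ((@lebesgue_measure R \x lebesgue_rV R n)%E
  (((fun x : measurableTypeR R => (x : R) + v ord0 ord0) @^-1` B) `*`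
   ((fun x => x + v') @^-1` C))); first by [].
rewrite product_measure1E//=.
- by rewrite IH// lebesgue_measureD.
- apply: measurable_preimage mB.
  by apply: measurable_funD.
- by apply: measurable_preimage mC; exact: measurable_rVD.
Qed.

End lebesgue_rV_invariance.

Section euclidean.
Context {R : realType} {n : nat}.
Local Notation V := 'rV[R]_n.
Local Notation enorm := (@euclidean_norm R n).
Implicit Types x y z : V.

Definition dot x y : R := \sum_(i < n) x ord0 i * y ord0 i.

Lemma dotDl x y z : dot (x + y) z = dot x z + dot y z.
Proof. by rewrite -big_split; apply: eq_bigr => i _; rewrite mxE mulrDl. Qed.
Lemma dotC x y : dot x y = dot y x.
Proof. by apply: eq_bigr => i _; rewrite mulrC. Qed.
Lemma dotZl a x y : dot (a *: x) y = a * dot x y.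
Proof. by rewrite mulr_sumr; apply: eq_bigr => i _; rewrite mxE mulrA. Qed.
Lemma dotNl x y : dot (- x) y = - dot x y.
Proof. by rewrite -scaleN1r dotZl mulN1r. Qed.
Lemma dotDr x y z : dot z (x + y) = dot z x + dot z y.
Proof. by rewrite !(dotC z) dotDl. Qed.
Lemma dotZr a x y : dot y (a *: x) = a * dot y x.
Proof. by rewrite !(dotC y) dotZl. Qed.
Lemma dotNr x y : dot y (- x) = - dot y x.
Proof. by rewrite !(dotC y) dotNl. Qed.
Definition dotE := (dotDl, dotDr, dotNl, dotNr, dotZl, dotZr).

Lemma dotxx_ge0 x : 0 <= dot x x.
Proof. by apply: sumr_ge0 => i _; rewrite -expr2 sqr_ge0. Qed.

Lemma enormE x : enorm x = Num.sqrt (dot x x).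
Proof. by congr Num.sqrt; apply: eq_bigr => i _; rewrite expr2. Qed.

Lemma enorm_sqr x : enorm x ^+ 2 = dot x x.
Proof. by rewrite enormE sqr_sqrtr// dotxx_ge0. Qed.

Lemma enorm_ge0 x : 0 <= enorm x. Proof. exact: sqrtr_ge0. Qed.

Lemma ler_enorm x y : (enorm x <= enorm y) = (dot x x <= dot y y).
Proof. by rewrite !enormE ler_sqrt// dotxx_ge0. Qed.

Lemma ltr_enorm x y : dot x x < dot y y -> enorm x < enorm y.
Proof. by move=> xy; rewrite !enormE ltr_sqrt// (le_lt_trans _ xy)// dotxx_ge0. Qed.

Lemma eq_enorm x y : dot x x = dot y y -> enorm x = enorm y.
Proof. by rewrite !enormE => ->. Qed.

Lemma enormN x : enorm (- x) = enorm x.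
Proof. by apply: eq_enorm; rewrite !dotE opprK. Qed.

Lemma enormBC x y : enorm (x - y) = enorm (y - x).
Proof. by rewrite -enormN opprB. Qed.

Lemma enormZ (a : R) x : enorm (a *: x) = `|a| * enorm x.
Proof.
by rewrite !enormE !dotE mulrA -expr2 sqrtrM ?sqr_ge0// sqrtr_sqr.
Qed.

Lemma enorm0 : enorm 0 = 0.
Proof. by rewrite -(scale0r (0 : V)) enormZ normr0 mul0r. Qed.

Lemma coord_le_enorm x i : `|x ord0 i| <= enorm x.
Proof.
rewrite -sqrtr_sqr enormE ler_sqrt ?dotxx_ge0// /dot (bigD1 i)//= -expr2.
by rewrite lerDl sumr_ge0// => j _; rewrite -expr2 sqr_ge0.
Qed.

Lemma enorm_eq0 x : enorm x = 0 -> x = 0.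
Proof.
move=> x0; apply/rowP => i; rewrite mxE; apply/eqP.
by rewrite -normr_le0 -x0 coord_le_enorm.
Qed.

Lemma dotxx_gt0 x : x != 0 -> 0 < dot x x.
Proof.
move=> x0; rewrite lt_neqAle dotxx_ge0 andbT eq_sym; apply: contra x0 => /eqP x0.
by apply/eqP/enorm_eq0; rewrite enormE x0 sqrtr0.
Qed.

Lemma dot_le_enorm x y : dot x y <= enorm x * enorm y.
Proof.
have [->|x0] := eqVneq x 0.
  by rewrite enorm0 mul0r -(scale0r (0 : V)) dotZl mul0r.
have [->|y0] := eqVneq y 0.
  by rewrite enorm0 mulr0 -(scale0r (0 : V)) dotZr mul0r.
have P z : z != 0 -> 0 < enorm z.
  by move=> z0; rewrite enormE sqrtr_gt0 dotxx_gt0.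
have := dotxx_ge0 (enorm y *: x - enorm x *: y).
rewrite !dotE (dotC y x) -!enorm_sqr.
have := P _ x0; have := P _ y0.
move: (enorm x) (enorm y) (dot x y) => a b c b0 a0.
rewrite (_ : _ + _ = 2 * (a * b) * (a * b - c)); last by ring.
by rewrite pmulr_rge0 ?subr_ge0// !mulr_gt0.
Qed.

Lemma enormD x y : enorm (x + y) <= enorm x + enorm y.
Proof.
rewrite -[leRHS]ger0_norm ?addr_ge0 ?enorm_ge0// -sqrtr_sqr.
rewrite [leLHS]enormE ler_sqrt ?sqr_ge0// !dotE (dotC y x) -!enorm_sqr.
have := dot_le_enorm x y; set a := enorm x; set b := enorm y; nra.
Qed.

Lemma enorm_le_sum x : enorm x <= \sum_(i < n) `|x ord0 i|.
Proof.
have S0 : 0 <= \sum_(i < n) `|x ord0 i| by rewrite sumr_ge0.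
rewrite -[leRHS]ger0_norm// -sqrtr_sqr enormE ler_sqrt ?sqr_ge0//.
rewrite expr2 mulr_suml; apply: ler_sum => i _.
rewrite -expr2 -real_normK ?num_real// expr2 ler_wpM2l//.
by rewrite (bigD1 i)//= lerDl sumr_ge0.
Qed.

Lemma measurable_enorm : measurable_fun setT enorm.
Proof.
apply: (@measurableT_comp _ _ _ _ _ _ (@Num.sqrt R)).
  by apply: continuous_measurable_fun; exact: sqrt_continuous.
apply: measurable_sum => i; apply: measurable_funX; exact: measurable_coord.
Qed.

Lemma measurable_dot x : measurable_fun setT (fun y => dot y x).
Proof.
apply: measurable_sum => i; apply: measurable_funM => //; exact: measurable_coord.
Qed.

Lemma measurable_rV_coordT d (T : measurableType d) (f : T -> V) (i : 'I_n) :
  measurable_fun setT f -> measurable_fun setT (fun t => f t ord0 i).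
Proof. move=> mf; exact: (measurableT_comp (measurable_coord i)). Qed.

Lemma measurable_rV_add d (T : measurableType d) (f g : T -> V) :
  measurable_fun setT f -> measurable_fun setT g ->
  measurable_fun setT (fun t => f t + g t).
Proof.
move=> mf mg; apply: measurable_fun_rVP => i; under eq_fun do rewrite mxE.
by apply: measurable_funD; exact: measurable_rV_coordT.
Qed.

Lemma measurable_rV_scale d (T : measurableType d) (a : T -> R) (g : T -> V) :
  measurable_fun setT a -> measurable_fun setT g ->
  measurable_fun setT (fun t => a t *: g t).
Proof.
move=> mf mg; apply: measurable_fun_rVP => i; under eq_fun do rewrite mxE.
by apply: measurable_funM => //; exact: measurable_rV_coordT.
Qed.

Lemma measurable_rV_opp d (T : measurableType d) (g : T -> V) :
  measurable_fun setT g -> measurable_fun setT (fun t => - g t).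
Proof.
move=> mg; under eq_fun do rewrite -scaleN1r.
exact: measurable_rV_scale.
Qed.

(** Cubes replace Euclidean balls: their measure is explicit, and the two are comparable up to a
    factor [n]. *)
Definition box (a : V) (r : R) : set V :=
  [set x | forall i, x ord0 i \in `[a ord0 i - r, a ord0 i + r]].

Lemma boxE a r x : box a r x <-> forall i, `|x ord0 i - a ord0 i| <= r.
Proof.
split=> bx i; have := bx i; rewrite in_itv/= ler_norml.
  by move=> /andP[? ?]; apply/andP; split; lra.
by move=> /andP[? ?]; apply/andP; split; lra.
Qed.

Lemma measurable_box a r : measurable (box a r).
Proof.
rewrite (_ : box a r = \bigcap_(i in [set: 'I_n])
    ((fun x : V => x ord0 i) @^-1` `[a ord0 i - r, a ord0 i + r])); last first.
  by apply/seteqP; split=> [x Bx i _|x Bx i]; [exact: Bx|exact: Bx].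
apply: fin_bigcap_measurable => // i _.
by apply: measurable_preimage => //; exact: measurable_coord.
Qed.

Lemma lebesgue_box a r : 0 <= r -> lebesgue_rV R n (box a r) = ((2 * r) ^+ n)%:E.
Proof.
move=> r0; pose u : V := \row_i (a ord0 i - r); pose v : V := \row_i (a ord0 i + r).
rewrite (_ : box a r = [set x | forall i, x ord0 i \in `[u ord0 i, v ord0 i]]); last first.
  by apply/seteqP; split=> x bx i; have := bx i; rewrite !mxE.
rewrite lebesgue_rV_box; last by move=> i; rewrite !mxE; lra.
rewrite (eq_bigr (fun=> 2 * r)); last by move=> i _; rewrite !mxE; ring.
by rewrite prodr_const card_ord.
Qed.

Lemma ball_sub_box a r x : enorm (x - a) <= r -> box a r x.
Proof.
move=> xa; apply/boxE => i; apply: le_trans xa; apply: le_trans (coord_le_enorm _ i).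
by rewrite !mxE.
Qed.

Lemma box_sub_ball a r x : box a r x -> enorm (x - a) <= n%:R * r.
Proof.
move=> /boxE bx; apply: (le_trans (enorm_le_sum _)).
rewrite mulr_natl -[X in _ <= _ *+ X]card_ord -sumr_const.
by apply: ler_sum => i _; rewrite !mxE.
Qed.

End euclidean.

(** * Integration of nonnegative functions on R^n *)

Section integ.
Context {R : realType} {n : nat}.
Local Notation V := 'rV[R]_n.
Local Notation mu := (lebesgue_rV R n).
Local Notation enorm := (@euclidean_norm R n).
Implicit Types f g : V -> R.

Definition integ f : \bar R := (\int[mu]_x (f x)%:E)%E.

Definition mnn f := measurable_fun setT f /\ forall x, 0 <= f x.

Lemma mnn_EFin f : mnn f -> measurable_fun setT (EFin \o f).
Proof. by move=> [mf _]; exact/measurable_EFinP. Qed.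

Lemma integ_ge0 f : mnn f -> (0 <= integ f)%E.
Proof. by move=> [_ f0]; apply: integral_ge0 => x _; rewrite lee_fin. Qed.

Lemma integ_eq f g : f =1 g -> integ f = integ g.
Proof. by move=> fg; congr integ; exact/funext. Qed.

Lemma mnnD f g : mnn f -> mnn g -> mnn (fun x => f x + g x).
Proof.
by move=> [mf f0] [mg g0]; split=> [|x]; [exact: measurable_funD|exact: addr_ge0].
Qed.

Lemma mnnM f g : mnn f -> mnn g -> mnn (fun x => f x * g x).
Proof.
by move=> [mf f0] [mg g0]; split=> [|x]; [exact: measurable_funM|exact: mulr_ge0].
Qed.

Lemma mnn_cst (k : R) : 0 <= k -> mnn (cst k).
Proof. by move=> k0; split. Qed.

Lemma mnnZ k f : 0 <= k -> mnn f -> mnn (fun x => k * f x).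
Proof. by move=> k0 mf; apply: mnnM => //; exact: mnn_cst. Qed.

Lemma mnn_powR f p : mnn f -> mnn (fun x => f x `^ p).
Proof.
move=> [mf _]; split=> [|x]; last exact: powR_ge0.
exact: (measurableT_comp (measurable_powR p)).
Qed.

Lemma mnn_comp f (T : V -> V) : measurable_fun setT T -> mnn f -> mnn (f \o T).
Proof. by move=> mT [mf f0]; split=> [|x]; [exact: measurableT_comp|exact: f0]. Qed.

Lemma integD f g : mnn f -> mnn g ->
  integ (fun x => f x + g x) = (integ f + integ g)%E.
Proof.
move=> mf mg; rewrite /integ; under eq_integral do rewrite EFinD.
rewrite ge0_integralD//.
- by move=> x _; rewrite lee_fin mf.2.
- exact: mnn_EFin.
- by move=> x _; rewrite lee_fin mg.2.
- exact: mnn_EFin.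
Qed.

Lemma integZ k f : 0 <= k -> mnn f -> integ (fun x => k * f x) = (k%:E * integ f)%E.
Proof.
move=> k0 mf; rewrite /integ; under eq_integral do rewrite EFinM.
rewrite ge0_integralZl_EFin//.
- by move=> x _; rewrite lee_fin mf.2.
- exact: mnn_EFin.
Qed.

Lemma integ_le f g : mnn f -> mnn g -> (forall x, f x <= g x) -> (integ f <= integ g)%E.
Proof.
move=> mf mg fg; apply: ge0_le_integral => //.
- by move=> x _; rewrite lee_fin mf.2.
- exact: mnn_EFin.
- exact: mnn_EFin.
- by move=> x _; rewrite lee_fin.
Qed.

Lemma integ_ae f g : mnn f -> mnn g -> {ae mu, forall x, f x = g x} -> integ f = integ g.
Proof.
move=> mf mg fg; apply: ge0_ae_eq_integral => //.
- exact: mnn_EFin.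
- exact: mnn_EFin.
- by move=> x _; rewrite lee_fin mf.2.
- by move=> x _; rewrite lee_fin mg.2.
by apply: filterS fg => x -> _.
Qed.

Lemma integ_le_ae f g : mnn f -> mnn g -> {ae mu, forall x, f x <= g x} ->
  (integ f <= integ g)%E.
Proof.
move=> mf mg fg; apply: ae_ge0_le_integral => //.
- by move=> x _; rewrite lee_fin mf.2.
- exact: mnn_EFin.
- by move=> x _; rewrite lee_fin mg.2.
- exact: mnn_EFin.
by apply: filterS fg => x ? _; rewrite lee_fin.
Qed.

Lemma integ0_ae f : mnn f -> integ f = 0%E -> {ae mu, forall x, f x = 0}.
Proof.
move=> mf f0; have [+ _] := ae_eq_integral_abs mu measurableT (mnn_EFin mf).
rewrite (_ : integral _ _ _ = integ f); last first.
  by apply: eq_integral => x _ /=; rewrite ger0_norm// mf.2.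
by move=> /(_ f0); apply: filterS => x /(_ I) /= [].
Qed.

(** The equality cases of the minimisation and of polarization are read off from this; finiteness of
    the common value allows the subtraction. *)
Lemma integ_eq_ae f g r : mnn f -> mnn g -> (forall x, f x <= g x) ->
  integ f = r%:E -> integ g = r%:E -> {ae mu, forall x, f x = g x}.
Proof.
move=> mf mg fg fr gr.
have mh : mnn (fun x => g x - f x).
  by split=> [|x]; [exact: measurable_funB mg.1 mf.1|rewrite subr_ge0].
have : integ (fun x => g x - f x) = 0%E.
  have := integD mf mh; rewrite (integ_eq (g := g)); last by move=> x; ring.
  rewrite gr fr => /esym/eqP; case: (integ _) => [h||]//=.
  by rewrite -EFinD eqe => /eqP h0; congr EFin; lra.
by move/(integ0_ae mh); apply: filterS => x /eqP; rewrite subr_eq0 => /eqP.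
Qed.

Definition preserving (T : V -> V) := measurable_fun setT T /\
  forall A, measurable A -> mu (T @^-1` A) = mu A.

Lemma preserving_ge0_integral (T : V -> V) (f : V -> \bar R) : preserving T ->
  measurable_fun setT f -> (forall x, 0 <= f x)%E ->
  (\int[mu]_x f (T x) = \int[mu]_x f x)%E.
Proof.
move=> [mT T_mu] mf f0.
have := ge0_integral_pushforward mT mu measurableT mf (fun x _ => f0 x).
rewrite preimage_setT => <-.
by apply: eq_measure_integral => A mA _; rewrite /= /pushforward T_mu.
Qed.

Lemma integ_preserving T f : preserving T -> mnn f -> integ (f \o T) = integ f.
Proof.
move=> pT mf; rewrite -[RHS](preserving_ge0_integral pT)//; first exact: mnn_EFin.
by move=> x; rewrite lee_fin mf.2.
Qed.

Lemma preserving_shift (v : V) : preserving (fun x => x + v).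
Proof. by split=> [|A mA]; [exact: measurable_rVD|exact: lebesgue_rVD]. Qed.

Lemma preserving_comp S T : preserving S -> preserving T -> preserving (S \o T).
Proof.
move=> [mS pS] [mT pT]; split; first exact: measurableT_comp.
move=> A mA; rewrite comp_preimage pT ?pS//.
exact: measurable_preimage.
Qed.

Definition mnn2 (k : V -> V -> R) :=
  measurable_fun setT (fun p : V * V => k p.1 p.2) /\ forall x y, 0 <= k x y.

Lemma mnn2_1 k x : mnn2 k -> mnn (k x).
Proof.
move=> [mk k0]; split=> [|y]; last exact: k0.
exact: (measurableT_comp mk (measurable_pair1 x)).
Qed.

Lemma measurable_integ k : mnn2 k -> measurable_fun setT (fun x => integ (k x)).
Proof.
move=> [mk k0].
by apply: (@measurable_fun_fubini_tonelli_F _ _ _ _ _ mu (fun p => (k p.1 p.2)%:E));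
  [exact/measurable_EFinP|move=> p; rewrite lee_fin].
Qed.

Lemma integ_swap k : mnn2 k ->
  (\int[mu]_x integ (k x) = \int[mu]_y integ (k ^~ y))%E.
Proof.
move=> [mk k0].
by apply: (@fubini_tonelli _ _ _ _ _ mu mu (fun p => (k p.1 p.2)%:E));
  [exact/measurable_EFinP|move=> p; rewrite lee_fin].
Qed.

Lemma mnn_integ k (u : V -> R) : mnn2 k -> (forall x, integ (k x) = (u x)%:E) -> mnn u.
Proof.
move=> mk ku; split.
  apply/measurable_EFinP; rewrite (_ : _ \o _ = (fun x => integ (k x))).
    exact: measurable_integ.
  by apply/funext => x; rewrite ku.
by move=> x; rewrite -lee_fin -ku integ_ge0//; exact: mnn2_1.
Qed.

Lemma integ_indic (A : set V) : measurable A -> integ \1_A = mu A.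
Proof. by move=> mA; rewrite /integ integral_indic// setIT. Qed.

Lemma mnn_indic (A : set V) : measurable A -> mnn \1_A.
Proof. by move=> mA; split. Qed.

(* The uniqueness of Haar measure by Fubini: both sides are the integral of
   [1_A (T x + y) 1_B y]. *)
Lemma equivariant_proportional (T : V -> V) (A B : set V) :
  measurable_fun setT T -> (forall v, exists w, forall x, T x + v = T (x + w)) ->
  measurable A -> measurable B -> (forall x, B x -> B (- x)) ->
  (mu (T @^-1` A) * mu B = mu A * mu (T @^-1` B))%E.
Proof.
move=> mT Tv mA mB BN.
have mTA := measurable_preimage mT mA; have mTB := measurable_preimage mT mB.
pose k x y : R := \1_A (T x + y) * \1_B y.
have mk : mnn2 k.
  split=> [|x y]; last by rewrite mulr_ge0.
  apply: measurable_funM.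
    apply: (measurableT_comp (measurable_indic mA)).
    apply: measurable_rV_add => //.
    exact: (measurableT_comp mT measurable_fst).
  exact: (measurableT_comp (measurable_indic mB) measurable_snd).
have E1 y : integ (k ^~ y) = (mu (T @^-1` A) * (\1_B y)%:E)%E.
  have [w Tw] := Tv y.
  rewrite (integ_eq (g := fun x => \1_B y * (\1_(T @^-1` A) \o (fun x => x + w)) x)); last first.
    by move=> x; rewrite /k Tw mulrC.
  rewrite integZ//; last first.
    by apply: mnn_comp; [exact: measurable_rVD|exact: mnn_indic].
  rewrite (integ_preserving (preserving_shift w)) ?integ_indic//.
  by rewrite muleC.
have E2 x : integ (k x) = integ (fun y => \1_A y * \1_B (y - T x)).
  rewrite -[RHS](integ_preserving (preserving_shift (T x))); last first.
    apply: mnnM; first exact: mnn_indic.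
    by apply: (mnn_comp (f := \1_B) (measurable_rVD (- T x))); exact: mnn_indic.
  by apply: integ_eq => y /=; rewrite /k addrK (addrC y).
have mk' : mnn2 (fun x y => \1_A y * \1_B (y - T x)).
  split=> [|x y]; last by rewrite mulr_ge0.
  apply: measurable_funM.
    exact: (measurableT_comp (measurable_indic mA) measurable_snd).
  apply: (measurableT_comp (measurable_indic mB)).
  apply: measurable_rV_add => //; apply: measurable_rV_opp.
  exact: (measurableT_comp mT measurable_fst).
have E3 y : integ (fun x => \1_A y * \1_B (y - T x)) = (mu (T @^-1` B) * (\1_A y)%:E)%E.
  have [w Tw] := Tv (- y).
  rewrite (integ_eq (g := fun x => \1_A y * (\1_(T @^-1` B) \o (fun x => x + w)) x)); last first.
    move=> x; congr (_ * _); rewrite /= !indicE; congr ((_ : bool)%:R).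
    apply/idP/idP; rewrite !inE /= -Tw => /BN; rewrite opprB//.
  rewrite integZ//; last first.
    by apply: mnn_comp; [exact: measurable_rVD|exact: mnn_indic].
  rewrite (integ_preserving (preserving_shift w)) ?integ_indic//.
  by rewrite muleC.
have : (\int[mu]_y integ (k ^~ y) =
        \int[mu]_y integ (fun x => (\1_A y * \1_B (y - T x))%R))%E.
  by rewrite -(integ_swap mk) -(integ_swap mk'); apply: eq_integral => x _.
under eq_integral do rewrite E1.
under [X in _ = X -> _]eq_integral do rewrite E3.
have L (C : set V) m : measurable C -> (0 <= m)%E ->
    (\int[mu]_y (m * (\1_C y)%:E) = m * mu C)%E.
  move=> mC m0; rewrite ge0_integralZl//.
  - by rewrite -integ_indic.
  - exact/measurable_EFinP.
by rewrite !L// => ->; rewrite muleC.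
Qed.

(** The unit ball is its own preimage, so the proportionality factor is 1 as soon as the ball has
    positive finite measure; an inscribed and a circumscribed cube show this. *)
Lemma preserving_isometry (T : V -> V) :
  measurable_fun setT T -> (forall v, exists w, forall x, T x + v = T (x + w)) ->
  (forall x, enorm (T x) = enorm x) -> preserving T.
Proof.
move=> mT Tv TN; split=> // A mA.
pose B := [set x | enorm x <= 1].
have mB : measurable B.
  rewrite (_ : B = enorm @^-1` `]-oo, 1%R]); last first.
    by apply/seteqP; split=> x /=; rewrite in_itv.
  by apply: measurable_preimage => //; exact: measurable_enorm.
have := equivariant_proportional mT Tv mA mB; rewrite (_ : T @^-1` B = B); last first.
  by apply/seteqP; split=> x; rewrite /B/= TN.
have BN : forall x, B x -> B (- x) by move=> x; rewrite /B/= enormN.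
move=> /(_ BN).
have B1 : (mu B <= mu (box 0 1))%E.
  apply: le_measure; rewrite ?inE//; first exact: measurable_box.
  by move=> x Bx; apply: ball_sub_box; rewrite subr0.
(* The half-side [1 / (n + 1)] gives [n / (n + 1) <= 1] and is meaningful for [n = 0] too. *)
have B2 : (mu (box 0 (n.+1%:R^-1)) <= mu B)%E.
  apply: le_measure; rewrite ?inE//; first exact: measurable_box.
  move=> x /box_sub_ball; rewrite subr0 /B /= => /le_trans; apply.
  by rewrite ler_pdivrMr// mul1r ler_nat.
rewrite !lebesgue_box// ?invr_ge0// in B1 B2.
have : mu B \is a fin_num by rewrite ge0_fin_numE// (le_lt_trans B1)// ltry.
move: B2; case: (mu B) => // b; rewrite lee_fin => b1 _.
have b0 : 0 < b by apply: lt_le_trans b1; rewrite exprn_gt0// mulr_gt0// invr_gt0.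
by move/(congr1 (fun x => x * b^-1%:E)%E); rewrite -!muleA -EFinM divff ?gt_eqF// !mule1.
Qed.

(** The proportionality factor is computed on a cube, whose preimage is again a cube. *)
Lemma lebesgue_rV_dilate (L : R) (A : set V) : 0 < L -> measurable A ->
  mu ((fun x : V => L *: x) @^-1` A) = ((L ^+ n)^-1%:E * mu A)%E.
Proof.
move=> L0 mA; have mT : measurable_fun setT (fun x : V => L *: x).
  exact: measurable_rV_scale.
have Tv v : exists w, forall x : V, L *: x + v = L *: (x + w).
  by exists (L^-1 *: v) => x; rewrite scalerDr scalerA divff ?gt_eqF// scale1r.
have := equivariant_proportional mT Tv mA (measurable_box 0 1).
have TE : (fun x : V => L *: x) @^-1` (box 0 1) = box 0 (L^-1).
  apply/seteqP; split=> x /= /boxE Bx; apply/boxE => i; have := Bx i;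
  rewrite !mxE !subr0 normrM (gtr0_norm L0) -[L^-1]mul1r ler_pdivlMr//;
  by rewrite mulrC.
rewrite TE !lebesgue_box// ?invr_ge0 ?ltW//.
have BN : forall x : V, box 0 1 x -> box 0 1 (- x).
  move=> x /boxE bx; apply/boxE => i; have := bx i.
  by rewrite !mxE !subr0 normrN.
move=> /(_ BN)/(congr1 (fun x => x * ((2 * 1) ^+ n)^-1%:E)%E).
rewrite -!muleA -!EFinM divff ?mule1; last by rewrite expf_neq0// mulr1.
move=> ->; rewrite muleC; congr (_%:E * _)%E.
by rewrite mulr1 exprMn exprVn; field; rewrite !expf_neq0//= gt_eqF.
Qed.

Lemma integ_dilate (L : R) f : 0 < L -> mnn f ->
  integ (fun x => f (L^-1 *: x)) = ((L ^+ n)%:E * integ f)%E.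
Proof.
move=> L0 mf; have Li0 : 0 < L^-1 by rewrite invr_gt0.
have mT : measurable_fun setT (fun x : V => L^-1 *: x).
  exact: measurable_rV_scale.
have Ln0 : 0 <= L ^+ n by rewrite exprn_ge0// ltW.
have := ge0_integral_pushforward mT mu measurableT (mnn_EFin mf).
rewrite preimage_setT /integ => <-; last by move=> x _; rewrite lee_fin mf.2.
rewrite -(ge0_integral_mscale mu measurableT (NngNum Ln0))//=.
- apply: eq_measure_integral => B mB _; rewrite /= /pushforward /mscale/=.
  by rewrite lebesgue_rV_dilate// exprVn invrK.
- exact: mnn_EFin.
- by move=> x _; rewrite lee_fin mf.2.
Qed.

End integ.

(** * Inequalities for powers *)

Section powR_inequalities.
Context {R : realType}.
Implicit Types a b c p q r s u v w x y : R.

(* [1 + z <= expR z] at [z = ln (x / y)]; every convexity inequality below is a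
   combination of instances with the same [y]. *)
Lemma entropy_tangent x y : 0 < x -> 0 < y -> y * (1 + ln x - ln y) <= x.
Proof.
move=> x0 y0; have xy0 : 0 < x / y by rewrite divr_gt0.
have := expR_ge1Dx (ln (x / y)); rewrite lnK ?posrE// ln_div ?posrE//.
by rewrite ler_pdivlMr// => h; rewrite mulrC -addrA.
Qed.

Lemma entropy_tangent_lt x y : 0 < x -> 0 < y -> x != y ->
  y * (1 + ln x - ln y) < x.
Proof.
move=> x0 y0 xy; have xy0 : 0 < x / y by rewrite divr_gt0.
have := @expR_gt1Dx _ (ln (x / y)); rewrite lnK ?posrE// ln_div ?posrE//.
rewrite ltr_pdivlMr// => h; rewrite mulrC -addrA; apply: h.
by rewrite subr_eq0; apply: contra xy => /eqP/ln_inj ->//.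
Qed.

(** Strict convexity of the power. For positive [v] and [w], divide by [w ^ (q - 1)] and add the
    entropy inequality for [v ^ q / w ^ (q - 1)] to [q - 1] times the one for [w], both at [v]: the
    logarithms cancel. *)
Lemma powR_tangent q v w : 1 < q -> 0 <= v -> 0 <= w ->
  w `^ q + q * w `^ (q - 1) * (v - w) <= v `^ q ?= iff (v == w).
Proof.
move=> q1; rewrite le_eqVlt => /orP[/eqP <-|v0].
  rewrite le_eqVlt => /orP[/eqP <-|w0].
    have [q0 q0'] : q != 0 /\ q - 1 != 0 by split; rewrite gt_eqF//; lra.
    rewrite !powR0// mulr0 mul0r addr0 eqxx.
    by apply/leifP.
  have wq : w `^ q = w * w `^ (q - 1).
    by rewrite mulr_powRB1 ?ltW//; lra.
  have ? : 0 < w `^ (q - 1) by rewrite powR_gt0.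
  rewrite [0 `^ q]powR0; last by rewrite gt_eqF//; lra.
  apply/leifP; rewrite lt_eqF// wq.
  have : 0 < w * w `^ (q - 1) * (q - 1) by rewrite !mulr_gt0// subr_gt0.
  lra.
rewrite le_eqVlt => /orP[/eqP <-|w0].
  have [q0 q0'] : q != 0 /\ q - 1 != 0 by split; rewrite gt_eqF//; lra.
  rewrite !powR0// mulr0 mul0r addr0.
  by apply/leifP; rewrite gt_eqF// powR_gt0.
have wq : w `^ q = w * w `^ (q - 1).
  by rewrite mulr_powRB1 ?ltW//; lra.
have c0 : 0 < w `^ (q - 1) by rewrite powR_gt0.
have vq0 : 0 < v `^ q / w `^ (q - 1) by rewrite divr_gt0 ?powR_gt0.
have E1 := entropy_tangent vq0 v0; have E2 := entropy_tangent w0 v0.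
have L : ln (v `^ q / w `^ (q - 1)) = q * ln v - (q - 1) * ln w.
  by rewrite ln_div ?posrE ?powR_gt0// !ln_powR.
rewrite L in E1.
have vq : v `^ q = (v `^ q / w `^ (q - 1)) * w `^ (q - 1).
  by rewrite mulfVK// gt_eqF.
apply/leifP; case: eqVneq => [->|vw]; first by rewrite subrr mulr0 addr0.
have E3 := entropy_tangent_lt w0 v0.
rewrite eq_sym vw in E3; have {}E3 := E3 isT.
rewrite wq {}vq; set c := _ `^ (q - 1) in c0 *; set y := _ / c in E1 *.
have -> : w * c + q * c * (v - w) = (w + q * (v - w)) * c by ring.
rewrite ltr_pM2r//.
have : (q - 1) * (v * (1 + ln w - ln v)) < (q - 1) * w.
  by rewrite ltr_pM2l//; lra.
lra.
Qed.

(** The tangent of [u ^ (- s)] at [th * v]; by homogeneity it reduces to [1 + s <= r ^ (- s) + s r].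
    The multiple [th] stays free, to be optimised after integration. *)
Lemma powRN_tangent s th u v : 0 < s -> 0 < th -> 0 < u -> 0 < v ->
  (1 + s) * (th `^ (- s) * v `^ (- s)) <=
  u `^ (- s) + s * (th `^ (- s - 1) * (v `^ (- s - 1) * u)).
Proof.
move=> s0 th0 u0 v0; have tv0 : 0 < th * v by rewrite mulr_gt0.
have r0 : 0 < u / (th * v) by rewrite divr_gt0.
set r := u / (th * v) in r0.
have uE : u = r * (th * v) by rewrite /r mulfVK// gt_eqF.
clearbody r.
have S x : 0 < x -> x `^ (- s - 1) = x `^ (- s) / x.
  by move=> x0; rewrite powRB ?powRr1 ?ltW// (gt_eqF x0) implybT.
have r0' := ltW r0; have tv0' := ltW tv0; have th0' := ltW th0; have v0' := ltW v0.
rewrite !S// uE !powRM//.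
have -> : r `^ (- s) * (th `^ (- s) * v `^ (- s)) +
   s * (th `^ (- s) / th * (v `^ (- s) / v * (r * (th * v)))) =
   (r `^ (- s) + s * r) * (th `^ (- s) * v `^ (- s)).
  by field; rewrite !gt_eqF.
rewrite ler_pM2r ?mulr_gt0 ?powR_gt0//.
have := entropy_tangent r0 ltr01.
have := entropy_tangent (powR_gt0 (- s) r0) ltr01.
rewrite ln_powR ln1; nra.
Qed.

(** Entropy inequalities at [M] for the product, for [P] and for 1, with weights 1, [b] and
    [g - 1 - b]; the last weight is nonnegative by [1 + b <= g]. *)
Lemma product_tangent g b M P : 0 < b -> 1 + b <= g -> 0 < M -> 0 < P ->
  1 + g * (M - 1) - b * (P - 1) <= M `^ g * P `^ (- b).
Proof.
move=> b0 bg M0 P0; set Z := M `^ g * _.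
have Z0 : 0 < Z by rewrite mulr_gt0 ?powR_gt0.
have E1 := entropy_tangent Z0 M0; have E2 := entropy_tangent P0 M0.
have E3 := entropy_tangent ltr01 M0.
have LZ : ln Z = g * ln M - b * ln P.
  by rewrite lnM ?posrE ?powR_gt0// !ln_powR mulNr.
rewrite LZ in E1; rewrite ln1 in E3.
have : b * (M * (1 + ln P - ln M)) <= b * P by rewrite ler_wpM2l// ltW.
have : (g - 1 - b) * (M * (1 + 0 - ln M)) <= (g - 1 - b) * 1.
  by rewrite ler_wpM2l//; lra.
lra.
Qed.

Lemma powR_quasi_subadd p a b c : 0 < p -> 0 <= a -> 0 <= b -> 0 <= c ->
  c <= a + b -> c `^ p <= 2 `^ p * (a `^ p + b `^ p).
Proof.
move=> p0; wlog ab : a b / a <= b => [H a0 b0 c0 cab|].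
  by have /orP[/H|/H] := le_total a b; last rewrite addrC [X in _ * X]addrC; apply => //; rewrite addrC.
move=> a0 b0 c0 cab.
have : c `^ p <= (2 * b) `^ p.
  by apply: ge0_ler_powR; rewrite ?nnegrE ?(ltW p0)//; lra.
move=> /le_trans; apply; rewrite powRM// ler_wpM2l ?powR_ge0//.
by rewrite lerDr powR_ge0.
Qed.

Lemma powRN_le a b p : 0 <= p -> 0 < a -> a <= b -> b `^ (- p) <= a `^ (- p).
Proof.
move=> p0 a0 ab; have b0 := lt_le_trans a0 ab.
rewrite !powRN lef_pV2 ?posrE ?powR_gt0//.
by apply: ge0_ler_powR; rewrite ?nnegrE//; exact: ltW.
Qed.

(** The power is differentiable at a positive limit; at 0, continuity is checked directly and
    requires a positive exponent. *)
Lemma cvg_powR (a : nat -> R) (l p : R) : (forall k, 0 <= a k) -> 0 <= l ->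
  (0 < p) || (0 < l) -> a @ \oo --> l -> (fun k => a k `^ p) @ \oo --> l `^ p.
Proof.
move=> a0; rewrite le_eqVlt => /orP[/eqP <-|l0 _ al].
  rewrite ltxx orbF => p0 al; rewrite powR0 ?gt_eqF//.
  apply/cvgrPdist_lt => e e0.
  move/cvgrPdist_lt : al => /(_ (e `^ p^-1)); rewrite powR_gt0// => /(_ isT).
  apply: filterS => k; rewrite !sub0r !normrN !ger0_norm ?powR_ge0// => ak.
  have -> : e = (e `^ p^-1) `^ p.
    by rewrite -powRrM mulVf ?gt_eqF// powRr1 ?ltW.
  by rewrite gt0_ltr_powR ?nnegrE ?powR_ge0.
have C : {for l, continuous (fun x : R => x `^ p)}.
  have : derivable (fun x : R => x `^ p) l 1.
    by apply: derivable_powR; rewrite in_itv/= andbT.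
  by move/derivable1_diffP/differentiable_continuous.
exact: (continuous_cvg _ C al).
Qed.

End powR_inequalities.

(** * Dominated convergence and integrable weights *)

Section convergence.
Context {R : realType} {n : nat}.
Local Notation V := 'rV[R]_n.
Local Notation mu := (lebesgue_rV R n).
Local Notation enorm := (@euclidean_norm R n).
Implicit Types f g : V -> R.

Lemma cvgn_ge (a : nat -> R) (l c : R) : (forall k, c <= a k) -> a @ \oo --> l -> c <= l.
Proof. by move=> ca /cvgr_to_ge; apply; exact: nearW. Qed.

Lemma cvgn_le (a : nat -> R) (l c : R) : (forall k, a k <= c) -> a @ \oo --> l -> l <= c.
Proof. by move=> ca /cvgr_to_le; apply; exact: nearW. Qed.

Lemma integ_fin f g r : mnn f -> mnn g -> (forall x, f x <= g x) ->
  integ g = r%:E -> exists r', [/\ integ f = r'%:E, 0 <= r' & r' <= r].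
Proof.
move=> mf mg fg gr; have := integ_le mf mg fg; have := integ_ge0 mf; rewrite gr.
by case: (integ f) => // r' r0 rr; exists r'.
Qed.

Lemma integ_dct (f_ : nat -> V -> R) f g r : (forall k, mnn (f_ k)) ->
  (forall x, f_ ^~ x @ \oo --> f x) -> mnn g -> integ g = r%:E ->
  (forall k x, f_ k x <= g x) ->
  exists (a : nat -> R) (l : R), [/\ mnn f, forall k, integ (f_ k) = (a k)%:E,
    integ f = l%:E & a @ \oo --> l].
Proof.
move=> mf_ f_f mg gr f_g.
have mf : mnn f.
  split; first by apply: (measurable_fun_cvg (fun k => (mf_ k).1)) => x _; exact: f_f.
  by move=> x; apply: (cvgn_ge _ (f_f x)) => k; exact: (mf_ k).2.
have fg x : f x <= g x by apply: (cvgn_le _ (f_f x)) => k; exact: f_g.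
have [l [fl _ _]] := integ_fin mf mg fg gr.
pose a k := fine (integ (f_ k)).
have aE k : integ (f_ k) = (a k)%:E.
  by have [b [fb _ _]] := integ_fin (mf_ k) mg (f_g k) gr; rewrite /a fb.
exists a, l; split => //.
have ig : mu.-integrable setT (EFin \o g).
  apply/integrableP; split; first exact: mnn_EFin.
  rewrite (_ : integral _ _ _ = integ g); first by rewrite gr ltry.
  by apply: eq_integral => x _; rewrite /= ger0_norm// mg.2.
have := @dominated_convergence _ _ _ mu setT measurableT (fun k => EFin \o f_ k)
  (EFin \o f) (EFin \o g) (fun k => mnn_EFin (mf_ k)) (mnn_EFin mf).
case=> //.
- by apply: aeW => x _ /=; apply/cvg_EFin; [exact: nearW|exact: f_f].
- by apply: aeW => x k _ /=; rewrite lee_fin ger0_norm// (mf_ k).2.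
move=> _ _; rewrite -/(integ f) fl.
rewrite (_ : (fun _ => _) = EFin \o a); last first.
  by apply/funext => k; rewrite /= -aE.
by move/fine_cvgP => [_]; apply: cvg_trans.
Qed.

(** The weight is dominated by a sum of multiples of indicators of the cubes of half-side [2 ^ j];
    their integrals form a geometric series of ratio [2 ^ (n - p beta) < 1]. *)
Lemma integ_weight (beta p m c : R) : 0 < beta -> 0 < p -> n%:R < p * beta ->
  0 < m -> 0 < c ->
  exists r, integ (fun x : V => Num.max m (c * enorm x `^ beta) `^ (- p)) = r%:E.
Proof.
move=> b0 p0 np m0 c0; pose w (x : V) : R := Num.max m (c * enorm x `^ beta) `^ (- p).
rewrite -/w.
have mK : mnn (fun x => enorm x `^ beta).
  by apply: mnn_powR; split; [exact: measurable_enorm|exact: enorm_ge0].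
have mw : mnn w.
  apply: (@mnn_powR _ _ (fun x => Num.max m (c * enorm x `^ beta))).
  split; last by move=> x; rewrite le_max ltW.
  apply: measurable_maxr => //; exact: (mnnZ (ltW c0) mK).1.
pose rho : R := 2 `^ (- (beta * p)).
have rho0 : 0 < rho by rewrite powR_gt0.
pose A : R := Num.max (m `^ (- p)) ((c * 2 `^ (- beta)) `^ (- p)).
have A0 : 0 < A by rewrite lt_max powR_gt0.
have P2 (j : nat) : 0 < (2 : R) ^+ j by rewrite exprn_gt0.
pose f (j : nat) (x : V) : R := A * rho ^+ j * \1_(box 0 (2 ^+ j)) x.
have mf j : mnn (f j).
  apply: mnnZ; first by rewrite mulr_ge0 ?exprn_ge0// ltW.
  by apply: mnn_indic; exact: measurable_box.
have rhoj (j : nat) : rho ^+ j = ((2 ^+ j) `^ beta) `^ (- p).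
  rewrite -[LHS]powR_mulrn; last exact: ltW.
  have E2 : (2 : R) ^+ j = 2 `^ j%:R by rewrite (powR_mulrn j (ler0n R 2)).
  rewrite E2 /rho -!powRrM.
  by congr (powR 2 _); ring.
have rj0 j : 0 <= rho ^+ j by rewrite exprn_ge0// ltW.
(* Take the least [j] with [|x| <= 2 ^ j]. If [j = 0], the bound [m] is used; otherwise minimality
   gives [|x| > 2 ^ j / 2], whence the factor [2 ^ (- beta)] in [A]. *)
have wf x : exists j, w x <= f j x.
  have exj : exists j, enorm x <= 2 ^+ j.
    by exists (Num.bound (enorm x)); apply/ltW/upper_nthrootP.
  case: (ex_minnP exj) => j xj jmin; exists j.
  have fx : f j x = A * rho ^+ j.
    rewrite /f indicE mem_set ?mulr1//; apply: ball_sub_box.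
    by rewrite subr0.
  rewrite fx; case: j xj jmin {fx} => [|i] xi imin.
    rewrite expr0 mulr1 /w; apply: (@le_trans _ _ (m `^ (- p))).
      by apply: powRN_le; rewrite ?le_max ?lexx// ltW.
    by rewrite le_max lexx.
  have xi' : 2 ^+ i < enorm x.
    by rewrite ltNge; apply/negP => /imin; rewrite ltnn.
  have x2 : 2 ^+ i.+1 / 2 <= enorm x.
    by rewrite exprSr mulfK// ltW.
  rewrite rhoj; apply: (@le_trans _ _ ((c * 2 `^ (- beta) * (2 ^+ i.+1) `^ beta) `^ (- p))).
    apply: powRN_le; rewrite ?(ltW p0)//.
      by rewrite !mulr_gt0 ?powR_gt0.
    rewrite le_max -mulrA ler_pM2l//; apply/orP; right.
    have y0 : 0 <= 2 ^+ i.+1 / 2 :> R by rewrite divr_ge0// ltW.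
    have : (2 ^+ i.+1 / 2) `^ beta <= enorm x `^ beta.
      by apply: ge0_ler_powR => //; rewrite ?nnegrE ?enorm_ge0// ltW.
    rewrite powRM ?invr_ge0 ?(ltW (P2 _))// -[2^-1]powR_inv1// -powRrM mulN1r.
    by rewrite mulrC.
  rewrite powRM ?powR_ge0//; last by rewrite mulr_ge0 ?powR_ge0// ltW.
  by rewrite ler_wpM2r ?powR_ge0// le_max lexx orbT.
pose z : R := rho * 2 ^+ n.
have z0 : 0 < z by rewrite mulr_gt0.
have z1 : z < 1.
  rewrite /z /rho -powR_mulrn// -powRD; last by rewrite pnatr_eq0 implybT.
  rewrite -[ltRHS](powRr0 2) /powR gt_eqF// ltr_expR ltr_pM2r ?ln_gt0 ?ltr1n//.
  by rewrite (mulrC beta); lra.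
pose B : R := A * 2 ^+ n.
have If j : integ (f j) = (B * z ^+ j)%:E.
  rewrite /f integZ ?mulr_ge0 ?(ltW A0)//; last first.
    by apply: mnn_indic; exact: measurable_box.
  rewrite integ_indic; last exact: measurable_box.
  rewrite lebesgue_box ?(ltW (P2 _))// -EFinM /B /z; congr EFin.
  by rewrite !exprMn -!exprM (mulnC j); ring.
have : (integ w <= \int[mu]_x (\sum_(j <oo) (f j x)%:E))%E.
  apply: ge0_le_integral => //.
  - by move=> x _; rewrite lee_fin mw.2.
  - exact: mnn_EFin.
  - apply: ge0_emeasurable_sum => [j x _ _|j _]; first by rewrite lee_fin (mf j).2.
    exact: mnn_EFin (mf j).
  move=> x _; have [j wj] := wf x.
  apply: (@le_trans _ _ (f j x)%:E); first by rewrite lee_fin.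
  have f0 (k : nat) : (0 <= (f k x)%:E)%E by rewrite lee_fin (mf k).2.
  apply: le_trans (nneseries_lim_ge (m := 0) j.+1 (fun k _ _ => f0 k)).
  by rewrite big_nat_recr//= leeDr// sume_ge0.
rewrite integral_nneseries//; last 2 first.
- by move=> j; exact: mnn_EFin (mf j).
- by move=> j x _; rewrite lee_fin (mf j).2.
have S0 j : true -> (0 <= integ (f j))%E by move=> _; exact: integ_ge0 (mf j).
have : (\sum_(j <oo) integ (f j) <= (B / (1 - z))%:E)%E.
  apply: lime_le; first by apply: is_cvg_nneseries => j _ _; exact: S0.
  apply: nearW => N; under eq_bigr do rewrite If.
  rewrite sumEFin lee_fin.
  have -> : \sum_(0 <= j < N) B * z ^+ j = B * (1 - z ^+ N) / (1 - z).
    have zn1 : z != 1 by rewrite lt_eqF.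
    by have := geometric_seriesE B zn1; move/(congr1 (fun u => u N)).
  rewrite ler_pM2r ?invr_gt0 ?subr_gt0// ger_pMr ?mulr_gt0//.
  by rewrite gerBl exprn_ge0// ltW.
move=> h1 /le_trans/(_ h1); have := integ_ge0 mw.
by case: (integ w) => // r _ _; exists r.
Qed.

End convergence.

(** * Potentials of the kernel *)

(* Locked, for otherwise unification keeps unfolding it down to matrices. *)
HB.lock Definition kern (R : realType) (n : nat) (beta : R) (x : 'rV[R]_n) : R :=
  euclidean_norm x `^ beta.

Lemma kernE (R : realType) (n : nat) (beta : R) (x : 'rV[R]_n) :
  kern beta x = euclidean_norm x `^ beta.
Proof. by rewrite unlock. Qed.

Section potential.
Context {R : realType} {n : nat} (beta : R).
Hypothesis beta0 : 0 < beta.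
Local Notation V := 'rV[R]_n.
Local Notation mu := (lebesgue_rV R n).
Local Notation enorm := (@euclidean_norm R n).
Implicit Types (f g u : V -> R) (x y z : V).

Local Notation kern := (@kern R n beta).

(* A relation, so that stating it asserts the finiteness of the potential. *)
Definition is_pot f u := forall x, integ (fun y => kern (x - y) * f y) = (u x)%:E.

Lemma kern_ge0 x : 0 <= kern x. Proof. by rewrite kernE powR_ge0. Qed.

Lemma kernBC x y : kern (x - y) = kern (y - x).
Proof. by rewrite !kernE enormBC. Qed.

Lemma kern_tri x y z : kern (x - z) <= 2 `^ beta * (kern (x - y) + kern (y - z)).
Proof.
rewrite !kernE; apply: powR_quasi_subadd; rewrite ?enorm_ge0//.
by rewrite -[x - z](subrKA y) enormD.
Qed.

Lemma mnn_kern : mnn kern.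
Proof.
rewrite (_ : kern = fun x => enorm x `^ beta); last first.
  by apply/funext => x; rewrite kernE.
by apply: mnn_powR; split; [exact: measurable_enorm|exact: enorm_ge0].
Qed.

Lemma mnn2_mul f g (k : V -> V -> R) : mnn f -> mnn g -> mnn2 k ->
  mnn2 (fun x y => g x * (k x y * f y)).
Proof.
move=> mf mg mk; split=> [|x y]; last by rewrite !mulr_ge0 ?mf.2 ?mg.2 ?mk.2.
apply: measurable_funM; first exact: (measurableT_comp mg.1 measurable_fst).
by apply: measurable_funM; [exact: mk.1|exact: (measurableT_comp mf.1 measurable_snd)].
Qed.

Lemma mnn2_kernB : mnn2 (fun x y => kern (x - y)).
Proof.
split=> [|x y]; last exact: kern_ge0.
apply: (measurableT_comp mnn_kern.1); apply: measurable_rV_add => //.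
exact: measurable_rV_opp.
Qed.

Lemma mnn2_kernf f : mnn f -> mnn2 (fun x y => kern (x - y) * f y).
Proof.
move=> mf; split=> [|x y]; last by rewrite mulr_ge0 ?kern_ge0 ?mf.2.
apply: measurable_funM; first exact: mnn2_kernB.1.
exact: (measurableT_comp mf.1 measurable_snd).
Qed.

Lemma mnn_kernf f x : mnn f -> mnn (fun y => kern (x - y) * f y).
Proof. by move=> mf; exact: (mnn2_1 x (mnn2_kernf mf)). Qed.

Lemma mnn_pot f u : mnn f -> is_pot f u -> mnn u.
Proof. by move=> mf fu; exact: (mnn_integ (mnn2_kernf mf) fu). Qed.

(** The quasi-triangle inequality carries finiteness from [x0] to every point at the cost of a
    multiple of the mass: the potential of an integrable function is finite everywhere or
    nowhere. *)
Lemma is_pot_exists f M x0 r : mnn f -> integ f = M%:E ->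
  integ (fun y => kern (x0 - y) * f y) = r%:E -> exists u, is_pot f u.
Proof.
move=> mf fM fr.
suff H x : exists r, integ (fun y => kern (x - y) * f y) = r%:E.
  by have [u uE] := choice H; exists u.
have mg : mnn (fun y => 2 `^ beta * kern (x - x0) * f y + 2 `^ beta * (kern (x0 - y) * f y)).
  apply: mnnD; apply: mnnZ => //; rewrite ?mulr_ge0 ?powR_ge0 ?kern_ge0//.
  exact: mnn_kernf.
have Ig : integ (fun y => 2 `^ beta * kern (x - x0) * f y + 2 `^ beta * (kern (x0 - y) * f y))
  = (2 `^ beta * kern (x - x0) * M + 2 `^ beta * r)%:E.
  rewrite integD ?integZ ?fM ?fr ?mulr_ge0 ?powR_ge0 ?kern_ge0//; first exact: mnn_kernf.
    by apply: mnnZ => //; rewrite mulr_ge0 ?powR_ge0 ?kern_ge0.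
  by apply: mnnZ; [exact: powR_ge0|exact: mnn_kernf].
have [] := integ_fin (mnn_kernf x mf) mg _ Ig; last by move=> r' [? _ _]; exists r'.
move=> y; rewrite [X in _ <= _ + X]mulrA -mulrDl -mulrDr ler_wpM2r ?mf.2//.
exact: kern_tri.
Qed.

Section bounds.
Variables (f u : V -> R) (M : R).
Hypotheses (mf : mnn f) (fu : is_pot f u) (fM : integ f = M%:E).

Lemma pot_ge0 x : 0 <= u x. Proof. exact: (mnn_pot mf fu).2. Qed.

Lemma mass_ge0 : 0 <= M. Proof. by rewrite -lee_fin -fM integ_ge0. Qed.

(** Integrating [kern_tri] against [f] forces the potential to grow like the kernel away from any
    point where it is controlled. *)
Lemma kern_le_pot x z : kern (x - z) * M <= 2 `^ beta * (u x + u z).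
Proof.
rewrite -lee_fin EFinM -fM -integZ ?kern_ge0// EFinM EFinD -!fu -integD; try exact: mnn_kernf.
rewrite -integZ ?powR_ge0//; last by apply: mnnD; exact: mnn_kernf.
apply: integ_le.
- by apply: mnnZ => //; exact: kern_ge0.
- by apply: mnnZ; [exact: powR_ge0|apply: mnnD; exact: mnn_kernf].
move=> y; rewrite -mulrDl mulrA ler_wpM2r ?mf.2//.
by rewrite (kernBC z y); exact: kern_tri.
Qed.

Lemma pot_le_kern x z : u x <= 2 `^ beta * (kern (x - z) * M + u z).
Proof.
rewrite -lee_fin EFinM EFinD EFinM -fM -!fu -integZ ?kern_ge0// -integD; last 2 first.
- by apply: mnnZ => //; exact: kern_ge0.
- exact: mnn_kernf.
rewrite -integZ ?powR_ge0//; last first.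
  by apply: mnnD; [apply: mnnZ => //; exact: kern_ge0|exact: mnn_kernf].
apply: integ_le.
- exact: mnn_kernf.
- apply: mnnZ; first exact: powR_ge0.
  by apply: mnnD; [apply: mnnZ => //; exact: kern_ge0|exact: mnn_kernf].
move=> y; rewrite -mulrDl mulrA ler_wpM2r ?mf.2//.
exact: kern_tri.
Qed.

Lemma pot_ae g : mnn g -> {ae mu, forall x, f x = g x} -> is_pot g u.
Proof.
move=> mg fg x; rewrite -fu; apply/esym/integ_ae; try exact: mnn_kernf.
by apply: filterS fg => y ->.
Qed.

Lemma pot_shift v : is_pot (fun x => f (x + v)) (fun x => u (x + v)).
Proof.
move=> x; rewrite -fu -[RHS](integ_preserving (preserving_shift v)); last exact: mnn_kernf.
by apply: integ_eq => y /=; rewrite opprD addrACA subrr addr0.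
Qed.

Lemma pot_dilate c L : 0 <= c -> 0 < L ->
  is_pot (fun x => c * f (L^-1 *: x)) (fun x => c * L ^+ n * L `^ beta * u (L^-1 *: x)).
Proof.
move=> c0 L0 x; have L0' := ltW L0.
rewrite EFinM -fu.
have -> : (c * L ^+ n * L `^ beta)%:E = ((c * L `^ beta)%:E * (L ^+ n)%:E)%E.
  by rewrite -EFinM; congr EFin; ring.
rewrite -muleA -integ_dilate//; last exact: mnn_kernf.
rewrite -integZ; last 2 first.
- by rewrite mulr_ge0 ?powR_ge0.
- apply: (mnn_comp (f := fun y => kern (L^-1 *: x - y) * f y) (T := *:%R L^-1)).
    exact: measurable_rV_scale.
  exact: mnn_kernf.
apply: integ_eq => y.
have -> : kern (x - y) = L `^ beta * kern (L^-1 *: x - L^-1 *: y).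
  rewrite -scalerBr !kernE enormZ ger0_norm ?invr_ge0// -powRM ?mulr_ge0 ?invr_ge0 ?enorm_ge0//.
  by rewrite mulrA divff ?mul1r// gt_eqF.
by ring.
Qed.

End bounds.

Lemma pot_duality f u g h : mnn f -> mnn g -> is_pot f u -> is_pot g h ->
  integ (fun x => g x * u x) = integ (fun x => f x * h x).
Proof.
move=> mf mg fu gh.
have mk := mnn2_mul mf mg mnn2_kernB.
transitivity (\int[mu]_x integ (fun y => (g x * (kern (x - y) * f y))%R))%E.
  apply: eq_integral => x _; rewrite integZ ?mg.2//; last exact: mnn_kernf.
  by rewrite fu.
rewrite (integ_swap mk); apply: eq_integral => y _.
rewrite (integ_eq (g := fun x => f y * (kern (y - x) * g x))); last first.
  by move=> x; rewrite kernBC; ring.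
by rewrite integZ ?mf.2 ?gh//; exact: mnn_kernf.
Qed.

(** Concentration at a point is excluded by the bound on the power [q]. The part of [f] above the
    height [A] and the part below it near [x] each carry at most a quarter of [Ms], so half of [Ms]
    lies farther than [r] from [x]. *)
Lemma pot_lower (q Ms Ps : R) : (0 < n)%N -> 1 < q -> 0 < Ms -> 0 < Ps ->
  exists2 m, 0 < m & forall f u M P, mnn f -> is_pot f u -> integ f = M%:E ->
    integ (fun x => f x `^ q) = P%:E -> Ms <= M -> P <= Ps -> forall x, m <= u x.
Proof.
move=> n0 q1 Ms0 Ps0; have q0 : 0 < q - 1 by rewrite subr_gt0.
pose A := (4 * Ps / Ms) `^ (q - 1)^-1.
have A0 : 0 < A by rewrite powR_gt0// !mulr_gt0// invr_gt0.
have Aq : A `^ (1 - q) = Ms / (4 * Ps).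
  rewrite -opprB powRN -powRrM mulVf ?gt_eqF// powRr1 ?invf_div//.
  by rewrite divr_ge0 ?ltW// mulr_gt0.
(* With [2 r <= 1] and [0 < n] the measure [(2 r) ^ n] is at most [2 r], and the second bound makes
   [A * (2 r)] at most [Ms / 4]. *)
pose r := Num.min 2^-1 (Ms / (8 * A)).
have r0 : 0 < r by rewrite lt_min invr_gt0 ltr0n/= divr_gt0// mulr_gt0.
have rA : A * (2 * r) ^+ n <= Ms / 4.
  apply: (@le_trans _ _ (A * (2 * r))).
    rewrite ler_pM2l// -(prednK n0) exprS ler_piMr//; first by rewrite mulr_ge0// ltW.
    apply: exprn_ile1; first by rewrite mulr_ge0// ltW.
    have : r <= 2^-1 by rewrite ge_min lexx.
    lra.
  have : r <= Ms / (8 * A) by rewrite ge_min lexx orbT.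
  rewrite ler_pdivlMr ?mulr_gt0//; lra.
clearbody A r.
exists (r `^ beta * (Ms / 2)); first by rewrite mulr_gt0 ?powR_gt0// divr_gt0.
move=> f u M P mf fu fM fP MM PP x.
pose g y := A * \1_(box x r) y + (A `^ (1 - q) * f y `^ q + r `^ (- beta) * (kern (x - y) * f y)).
have mb : mnn (fun y => A * \1_(box x r) y).
  by apply: mnnZ; [exact: ltW|apply: mnn_indic; exact: measurable_box].
have mq : mnn (fun y => A `^ (1 - q) * f y `^ q).
  by apply: mnnZ; [exact: powR_ge0|exact: mnn_powR].
have mk : mnn (fun y => r `^ (- beta) * (kern (x - y) * f y)).
  by apply: mnnZ; [exact: powR_ge0|exact: mnn_kernf].
have fg : (integ f <= integ g)%E.
  apply: integ_le => //; first by apply: mnnD => //; exact: mnnD.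
  move=> y; rewrite /g; have [fA|fA] := leP (f y) A; last first.
    apply: (@le_trans _ _ (A `^ (1 - q) * f y `^ q)).
      have f0 := lt_trans A0 fA.
      rewrite -(mulr_powRB1 (ltW f0)); last exact: lt_trans q1.
      rewrite mulrCA ler_pMr// -opprB powRN mulrC ler_pdivlMr ?powR_gt0// mul1r.
      by apply: ge0_ler_powR; rewrite ?nnegrE ?ltW.
    rewrite -[leLHS]add0r; apply: lerD; first exact: mb.2.
    by rewrite lerDl; exact: mk.2.
  have [xr|xr] := leP (enorm (y - x)) r.
    apply: (le_trans fA); rewrite indicE mem_set ?mulr1 ?lerDl; last exact: ball_sub_box.
    by rewrite addr_ge0 ?mq.2 ?mk.2.
  apply: (@le_trans _ _ (r `^ (- beta) * (kern (x - y) * f y))).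
    rewrite mulrA ler_peMl ?mf.2// powRN mulrC ler_pdivlMr ?powR_gt0// mul1r.
    by rewrite kernBC kernE; apply: ge0_ler_powR; rewrite ?nnegrE ?enorm_ge0// ltW.
  by rewrite addrA lerDr addr_ge0 ?mb.2 ?mq.2.
move: fg; rewrite fM /g integD//; last exact: mnnD.
rewrite integD// !integZ ?powR_ge0 ?(ltW A0)//; last 3 first.
- exact: mnn_kernf.
- exact: mnn_powR.
- by apply: mnn_indic; exact: measurable_box.
rewrite fu fP integ_indic; last exact: measurable_box.
rewrite lebesgue_box ?(ltW r0)// -!EFinM -!EFinD lee_fin Aq => fg.
have PM : Ms / (4 * Ps) * P <= Ms / 4.
  rewrite invfM mulrA -mulrA ger_pMr ?divr_gt0//.
  by rewrite mulrC ler_pdivrMr// mul1r.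
rewrite powRN in fg; rewrite mulrC -ler_pdivlMr ?powR_gt0//; lra.
Qed.

(** In [kern_le_pot] at [z = 0] the term [u 0] is absorbed into [B * u x]. *)
Lemma pot_growth f u M m B : mnn f -> is_pot f u -> integ f = M%:E ->
  0 <= B -> (forall x, m <= u x) -> (forall x, u 0 <= B * u x) ->
  forall x, Num.max m (M / (2 `^ beta * (1 + B)) * kern x) <= u x.
Proof.
move=> mf fu fM B0 mu_ uB x; rewrite ge_max mu_/=.
have := kern_le_pot mf fu fM x 0; rewrite subr0 => h.
have B1 : 0 < 1 + B by lra.
rewrite mulrAC ler_pdivrMr ?mulr_gt0 ?powR_gt0// mulrC.
apply: (le_trans h); rewrite mulrCA ler_pM2l ?powR_gt0// mulrDr mulr1 lerD2l.
by rewrite mulrC.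
Qed.

End potential.

(** * Compactness of potentials *)

Section subsequences.
Context {R : realType}.

Lemma increasing_seq_ge (f : nat -> nat) : increasing_seq f -> forall k, (k <= f k)%N.
Proof.
move=> fi; elim=> // k IH; apply: (leq_ltn_trans IH).
rewrite ltnNge; apply/negP => h; have := fi k.+1 k.
by rewrite ltnn leEnat h.
Qed.

(** Of an extraction only [k <= f k] is retained: this is stable under composition and enough for
    convergence. *)
Lemma cvgn_subseq (a : nat -> R) (l : R) (f : nat -> nat) :
  (forall k, (k <= f k)%N) -> a @ \oo --> l -> (a \o f) @ \oo --> l.
Proof.
move=> fk al; apply/cvgrPdist_lt => e e0.
move/cvgrPdist_lt : al => /(_ e e0)[N _ HN]; exists N => // k Nk.
by apply: HN; exact: leq_trans (fk k).
Qed.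

Lemma diagonal_subseq (w : nat -> nat -> R) (H : nat -> R) :
  (forall k j, `|w k j| <= H j) ->
  exists2 f : nat -> nat, forall k, (k <= f k)%N & forall j, cvgn (fun k => w (f k) j).
Proof.
move=> wH.
have ex (p : (nat -> nat) * nat) : exists f : nat -> nat,
    (forall k, (k <= f k)%N) /\ cvgn (fun k => w (p.1 (f k)) p.2).
  have b : bounded_fun (fun k => w (p.1 k) p.2).
    exists (H p.2); split; first exact: num_real.
    by move=> x Hx k _; apply: (le_trans (wH _ _)); exact: ltW.
  by have [f /increasing_seq_ge fi fc] := bolzano_weierstrass b; exists f.
have [F HF] := choice ex.
pose G := fix G j := if j is i.+1 then G i \o F (G i, i) else id.
have Gd j d : exists2 s : nat -> nat, forall k, (k <= s k)%N & G (j + d)%N = G j \o s.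
  elim: d => [|d [s si Gs]]; first by exists id => //; rewrite addn0.
  exists (s \o F (G (j + d)%N, (j + d)%N)); last by rewrite addnS /= Gs.
  move=> k; apply: leq_trans (si _); exact: (HF _).1.
(* Stage [j.+1] makes coordinate [j] converge; beyond index [j] the diagonal is [G j.+1] taken at
   some [s k >= k]. *)
exists (fun k => G k.+1 k).
  by move=> k; have [s si ->] := Gd 0%N k.+1; exact: si.
move=> j; have [_ /cvg_ex[l /cvgrPdist_lt wl]] := HF (G j, j).
apply/cvg_ex; exists l; apply/cvgrPdist_lt => e e0.
have [N _ HN] := wl e e0; exists (maxn N j.+1) => // k Njk.
have /andP[Nk jk] : (N <= k)%N && (j < k)%N by rewrite -geq_max.
have [s si Gs] := Gd j.+1 (k.+1 - j.+1)%N.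
rewrite subnKC// in Gs; last exact: ltnW.
have -> : G k.+1 k = G j.+1 (s k) by rewrite Gs.
by apply: HN => /=; exact: leq_trans (si k).
Qed.

End subsequences.

Section potential_compactness.
Context {R : realType} {n : nat} (beta : R).
Hypothesis beta0 : 0 < beta.
Local Notation V := 'rV[R]_n.
Local Notation enorm := (@euclidean_norm R n).
Local Notation kern := (@kern R n beta).
Local Notation is_pot := (@is_pot R n beta).

Definition rat_point (d : 'rV[rat]_n) : V := map_mx ratr d.

Lemma rat_point_dense (x : V) (j : nat) :
  exists d, forall i, `|x ord0 i - rat_point d ord0 i| <= j.+1%:R^-1.
Proof.
have H i : exists q : rat, `|x ord0 i - ratr q| <= j.+1%:R^-1.
  have : 0 < j.+1%:R^-1 :> R by rewrite invr_gt0.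
  move: (j.+1%:R^-1 : R) => t t0.
  have : x ord0 i - t < x ord0 i + t by lra.
  move=> /rat_in_itvoo[q]; rewrite in_itv/= => /andP[? ?].
  by exists q; rewrite ler_norml; apply/andP; split; lra.
have [q Hq] := choice H; exists (\row_i q i) => i.
by rewrite !mxE.
Qed.

Lemma ler_dist_enorm (x y : V) : `|enorm x - enorm y| <= enorm (x - y).
Proof.
rewrite ler_norml; apply/andP; split.
  by have := enormD (y - x) x; rewrite subrK enormBC; lra.
by have := enormD (x - y) y; rewrite subrK; lra.
Qed.

(** This integral bounds the variation between [x] and a rational point of the potential of every
    function below [w], hence of a whole sequence at once. *)
Lemma kern_equicontinuous (w H : V -> R) (r : R) (x : V) (e : R) : mnn w ->
  integ w = r%:E -> is_pot w H -> 0 < e ->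
  exists d a, integ (fun y => `|kern (x - y) - kern (rat_point d - y)| * w y) = a%:E
    /\ a < e.
Proof.
move=> mw wr wH e0.
have [d Hd] := choice (rat_point_dense x).
have Nd j : enorm (x - rat_point (d j)) <= n%:R * j.+1%:R^-1.
  by apply: box_sub_ball; apply/boxE => i; exact: Hd.
have Nd' j : enorm (x - rat_point (d j)) <= n%:R.
  apply: (le_trans (Nd j)); rewrite ler_piMr// invf_le1// ?ler1n//.
have Nd0 : (fun j => enorm (x - rat_point (d j))) @ \oo --> (0 : R).
  apply: (@squeeze_cvgr _ _ _ _ (fun=> 0) (fun j => n%:R * j.+1%:R^-1)).
  - by apply: nearW => j; rewrite enorm_ge0 Nd.
  - exact: cvg_cst.
  - rewrite -[X in _ --> X](mulr0 n%:R).
    by apply: cvgM; [exact: cvg_cst|exact: cvg_harmonic].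
pose f j (y : V) : R := `|kern (x - y) - kern (rat_point (d j) - y)| * w y.
pose kap := (n%:R : R) `^ beta.
(* A majorant independent of [j]: the rational points stay within distance [n] of [x], so [kern_tri]
   compares their kernels with the one at [x], and [kap] bounds the error. *)
pose g (y : V) : R := (1 + 2 `^ beta) * (kern (x - y) * w y) + 2 `^ beta * kap * w y.
have mkB z : measurable_fun setT (fun y : V => kern (z - y)).
  exact: (mnn2_1 z (mnn2_kernB beta)).1.
have mf j : mnn (f j).
  split=> [|y]; last by rewrite mulr_ge0 ?mw.2.
  apply: measurable_funM mw.1; apply: measurableT_comp => //.
  exact: measurable_funB.
have c0 : 0 <= 1 + 2 `^ beta :> R by rewrite addr_ge0 ?powR_ge0.
have mg1 : mnn (fun y : V => (1 + 2 `^ beta) * (kern (x - y) * w y)).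
  by apply: mnnZ => //; exact: mnn_kernf.
have mg2 : mnn (fun y : V => 2 `^ beta * kap * w y).
  by apply: mnnZ => //; rewrite mulr_ge0 ?powR_ge0.
have gr : integ g = ((1 + 2 `^ beta) * H x + 2 `^ beta * kap * r)%:E.
  rewrite integD// !integZ ?mulr_ge0 ?powR_ge0//; last exact: mnn_kernf.
  by rewrite wH wr.
have f0 y : f ^~ y @ \oo --> (0 : R).
  rewrite -[X in _ --> X](mul0r (w y)); apply: cvgM; last exact: cvg_cst.
  have E : `|kern (x - y) - kern (x - y)| = 0 by rewrite addrN normr0.
  rewrite -[X in _ --> X]E {E}.
  have : (fun j => kern (rat_point (d j) - y)) @ \oo --> kern (x - y).
    rewrite kernE; under eq_fun do rewrite kernE.
    apply: cvg_powR; rewrite ?beta0 ?enorm_ge0//; first by move=> ?; exact: enorm_ge0.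
    apply/cvgrPdist_le => h h0; move/cvgrPdist_le : Nd0 => /(_ h h0).
    apply: filterS => j; rewrite sub0r normrN (ger0_norm (enorm_ge0 _)).
    apply: le_trans; apply: (le_trans (ler_dist_enorm _ _)).
    by rewrite opprB addrA subrK.
  by move=> /(cvgB (cvg_cst (kern (x - y))))/cvg_norm.
have fg j y : f j y <= g y.
  have -> : g y = ((1 + 2 `^ beta) * kern (x - y) + 2 `^ beta * kap) * w y.
    by rewrite /g; ring.
  rewrite /f ler_wpM2r ?mw.2//.
  have k1 : 0 <= kern (x - y) by exact: kern_ge0.
  have k2 : 0 <= kern (rat_point (d j) - y) by exact: kern_ge0.
  apply: (@le_trans _ _ (kern (x - y) + kern (rat_point (d j) - y))).
    by apply: (le_trans (ler_normB _ _)); rewrite !ger0_norm.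
  rewrite mulrDl mul1r -addrA lerD2l -mulrDr.
  apply: (le_trans (kern_tri beta0 _ x _)); rewrite ler_wpM2l ?powR_ge0//.
  rewrite addrC lerD2l kernBC kernE; apply: ge0_ler_powR; rewrite ?nnegrE ?enorm_ge0//.
  exact: ltW.
have mg : mnn g by exact: mnnD.
have [a [l [_ fa fl al]]] := integ_dct mf f0 mg gr fg.
have l0 : l = 0.
  by move: fl; rewrite /integ integral0 => -[].
rewrite l0 in al; move/cvgrPdist_lt : al => /(_ e e0)[N _ HN].
exists (d N), (a N); split; first exact: fa.
have := HN N (leqnn N); rewrite sub0r normrN; apply: le_lt_trans.
exact: ler_norm.
Qed.

(** As in the Arzela-Ascoli theorem: a diagonal extraction settles the rational points, and
    equicontinuity makes the sequence Cauchy at every other point. *)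
Lemma pot_subseq (g h : nat -> V -> R) (w H : V -> R) (r : R) :
  (forall k, mnn (g k)) -> (forall k x, g k x <= w x) ->
  (forall k, is_pot (g k) (h k)) -> mnn w -> integ w = r%:E -> is_pot w H ->
  exists2 f : nat -> nat, forall k, (k <= f k)%N &
    exists h' : V -> R, forall x, (fun k => h (f k) x) @ \oo --> h' x.
Proof.
move=> mg gw gh mw wr wH.
have hH k x : 0 <= h k x <= H x.
  rewrite (pot_ge0 (mg k) (gh k))/= -lee_fin -gh -wH.
  apply: integ_le; try exact: mnn_kernf.
  by move=> y; rewrite ler_wpM2l ?kern_ge0.
(* Codes of no rational point are sent to 0, which only adds one more point of convergence. *)
pose pt (j : nat) : V := if unpickle j is Some d then rat_point d else 0.
have [|f fk fc] := @diagonal_subseq R (fun k j => h k (pt j)) (H \o pt).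
  by move=> k j; have /andP[? ?] := hH k (pt j); rewrite ger0_norm.
exists f => //.
suff C x : cvgn (fun k => h (f k) x).
  by exists (fun x => limn (fun k => h (f k) x)) => x; exact: C.
apply/cauchy_cvgP/cauchy_exP => e e0.
have e20 : 0 < e / 2 by rewrite divr_gt0.
have [d [a [da ae]]] := kern_equicontinuous x mw wr wH e20.
have D z z' : integ (fun y => `|kern (z - y) - kern (z' - y)| * w y) = a%:E ->
    forall k, h k z <= h k z' + a.
  move=> zz k; rewrite -lee_fin EFinD -!gh -zz.
  have mkB z1 : measurable_fun setT (fun y : V => kern (z1 - y)).
    exact: (mnn2_1 z1 (mnn2_kernB beta)).1.
  have m1 : mnn (fun y : V => `|kern (z - y) - kern (z' - y)| * w y).
    split=> [|y]; last by rewrite mulr_ge0 ?mw.2.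
    apply: measurable_funM mw.1; apply: measurableT_comp => //.
    exact: measurable_funB.
  rewrite -integD//; last exact: mnn_kernf.
  apply: integ_le; [exact: mnn_kernf|apply: mnnD => //; exact: mnn_kernf|].
  move=> y; apply: (@le_trans _ _ (kern (z' - y) * g k y +
      `|kern (z - y) - kern (z' - y)| * g k y)).
    rewrite -mulrDl ler_wpM2r ?(mg k).2//.
    have := ler_norm (kern (z - y) - kern (z' - y)).
    by rewrite lerBlDl.
  by rewrite lerD2l ler_wpM2l.
have D1 := D _ _ da.
have D2 : forall k, h k (rat_point d) <= h k x + a.
  apply: D; rewrite -da; apply: integ_eq => y.
  by rewrite (distrC (kern (rat_point d - y))).
have ptd : pt (pickle d) = rat_point d by rewrite /pt pickleK.
have [l] := proj1 (cvg_ex _) (fc (pickle d)); rewrite ptd => hl.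
exists l; move/cvgrPdist_lt : hl => /(_ _ e20) [N _ HN].
exists N => // k Nk; have := HN k Nk; rewrite /ball/= !ltr_norml => /andP[? ?].
have := D1 (f k); have := D2 (f k) => ? ?.
by apply/andP; split; lra.
Qed.

End potential_compactness.

(** * The sharp constant *)

Section profiles.
Context {R : realType} {n : nat} (beta s q : R).
Hypotheses (n0 : (0 < n)%N) (beta0 : 0 < beta) (s0 : 0 < s) (sbeta : n%:R < s * beta)
  (q1 : 1 < q).
Local Notation V := 'rV[R]_n.
Local Notation mu := (lebesgue_rV R n).
Local Notation kern := (@kern R n beta).
Local Notation is_pot := (@is_pot R n beta).
Implicit Types (f g u : V -> R) (x y z : V).

Lemma ae_ex (P : V -> Prop) : {ae mu, forall x, P x} -> exists x, P x.
Proof.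
move=> [N [mN N0 PN]]; apply: contrapT => /forallNP nP.
have NT : N = setT by apply/seteqP; split=> // x _; apply: PN; exact: nP.
have : (mu (box 0 1) <= mu N)%E.
  apply: le_measure; rewrite ?inE ?NT//; exact: measurable_box.
by rewrite N0 lebesgue_box// lee_fin leNgt exprn_gt0// mulr_gt0.
Qed.

(** The common lower barrier of potentials; its negative powers serve as dominating functions. *)
Definition weight (m c : R) x := Num.max m (c * kern x).

Lemma mnn_weight m c : 0 <= m -> 0 <= c -> mnn (weight m c).
Proof.
move=> m0 c0; split; last by move=> x; rewrite le_max m0.
apply: measurable_maxr => //; exact: (mnnZ c0 (mnn_kern beta)).1.
Qed.

Lemma weight_gt0 m c x : 0 < m -> 0 < weight m c x.
Proof. by move=> m0; rewrite lt_max m0. Qed.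

Lemma integ_weightN m c p : 0 < m -> 0 < c -> 0 < p -> n%:R < p * beta ->
  exists r, integ (fun x => weight m c x `^ (- p)) = r%:E.
Proof.
move=> m0 c0 p0 np; have [r E] := integ_weight beta0 p0 np m0 c0.
by exists r; rewrite -E; apply: integ_eq => x; rewrite /weight kernE.
Qed.

(** Since [c * kern <= weight], the kernel times the power [- s - 1] is at most [c^-1] times the
    power [- s], which is integrable by [n < s beta]. *)
Lemma pot_weightN m c : 0 < m -> 0 < c ->
  exists (H : V -> R) (r : R), integ (fun x => weight m c x `^ (- s - 1)) = r%:E /\
    is_pot (fun x => weight m c x `^ (- s - 1)) H.
Proof.
move=> m0 c0; have s10 : 0 < s + 1 by rewrite addr_gt0.
have mw := mnn_weight (ltW m0) (ltW c0).
have sb' : n%:R < (s + 1) * beta by apply: (lt_trans sbeta); rewrite ltr_pM2r// ltrDl.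
have [r] := integ_weightN m0 c0 s10 sb'.
rewrite opprD => wr.
have [r' wr'] := integ_weightN m0 c0 s0 sbeta.
have m1 : mnn (fun x => weight m c x `^ (- s - 1)) by exact: mnn_powR.
have [] := @integ_fin _ _ (fun y => kern (0 - y) * weight m c y `^ (- s - 1))
  (fun y => c^-1 * weight m c y `^ (- s)) (c^-1 * r').
- exact: mnn_kernf.
- by apply: mnnZ; [rewrite invr_ge0 ltW|exact: mnn_powR].
- move=> y; have w0 : 0 < weight m c y by exact: weight_gt0.
  have -> : weight m c y `^ (- s) = weight m c y * weight m c y `^ (- s - 1).
    rewrite -[X in X * _]powRr1 ?ltW// -powRD; first by congr (_ `^ _); ring.
    by rewrite (gt_eqF w0) implybT.
  rewrite mulrA ler_wpM2r ?powR_ge0// mulrC ler_pdivlMr//.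
  by rewrite kernBC subr0 mulrC le_max lexx orbT.
- by rewrite integZ ?wr' ?invr_ge0 ?(ltW c0)//; exact: mnn_powR.
move=> r'' [wr'' _ _]; have [H HH] := is_pot_exists beta0 m1 wr wr''.
by exists H, r.
Qed.

(* [u] is [E_alpha f] and [F `^ (- s^-1)] its norm of exponent [t' = - s]. *)
Record profile f (M P : R) u (F : R) : Prop := Profile {
  pf_mnn : mnn f;
  pf_mass : integ f = M%:E;
  pf_mass_gt0 : 0 < M;
  pf_pow : integ (fun x => f x `^ q) = P%:E;
  pf_pow_gt0 : 0 < P;
  pf_pot : is_pot f u;
  pf_pot_gt0 : forall x, 0 < u x;
  pf_neg : integ (fun x => u x `^ (- s)) = F%:E;
  pf_neg_gt0 : 0 < F }.

Lemma integ_gt0 f r : mnn f -> (forall x, 0 < f x) -> integ f = r%:E -> 0 < r.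
Proof.
move=> mf f0 fr; rewrite lt_neqAle -lee_fin -fr integ_ge0// andbT.
apply/eqP => r0; rewrite -r0 in fr.
by have [x fx] := ae_ex (integ0_ae mf fr); have := f0 x; rewrite fx ltxx.
Qed.

Lemma integ_powR_gt0 f M P : mnn f -> integ f = M%:E -> 0 < M ->
  integ (fun x => f x `^ q) = P%:E -> 0 < P.
Proof.
move=> mf fM M0 fP.
rewrite lt_neqAle -lee_fin -fP integ_ge0 ?andbT; last exact: mnn_powR.
apply/eqP => P0; rewrite -P0 in fP.
have f0 : {ae mu, forall x, f x = 0}.
  apply: filterS (integ0_ae (mnn_powR q mf) fP) => x; exact: powR_eq0_eq0.
have : integ f = integ (cst 0 : V -> R) by apply: integ_ae => //; exact: mnn_cst.
by rewrite fM /integ integral0 => -[M0']; rewrite M0' ltxx in M0.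
Qed.

(** A positive lower bound [m] of [u] gives [u 0 <= (u 0 / m) * u x], so [u] dominates a weight and
    its power [- s] is integrable. *)
Lemma profile_intro f M P u : mnn f -> integ f = M%:E -> 0 < M ->
  integ (fun x => f x `^ q) = P%:E -> is_pot f u -> exists F, profile f M P u F.
Proof.
move=> mf fM M0 fP fu.
have P0 := integ_powR_gt0 mf fM M0 fP.
have [m m0 mu_] := pot_lower beta0 n0 q1 M0 P0.
have {}mu_ := mu_ _ _ _ _ mf fu fM fP (lexx _) (lexx _).
have u0 x : 0 < u x by exact: lt_le_trans (mu_ x).
have B0 : 0 <= u 0 / m by rewrite divr_ge0 ?ltW.
have uB x : u 0 <= u 0 / m * u x.
  by rewrite mulrAC ler_pdivlMr// ler_pM2l.
have gr := pot_growth beta0 mf fu fM B0 mu_ uB.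
set c := M / _ in gr; have c0 : 0 < c.
  by rewrite divr_gt0// mulr_gt0 ?powR_gt0// ltr_pwDl.
have [r wr] := integ_weightN m0 c0 s0 sbeta.
have mus : mnn (fun x => u x `^ (- s)) by exact: mnn_powR (mnn_pot mf fu).
have [] := integ_fin mus (mnn_powR (- s) (mnn_weight (ltW m0) (ltW c0))) _ wr.
  by move=> x; apply: powRN_le (gr x); [exact: ltW|exact: weight_gt0].
move=> F [uF _ _]; exists F; split => //.
by apply: integ_gt0 uF => // x; exact: powR_gt0.
Qed.

Lemma profile_shift f M P u F v : profile f M P u F ->
  profile (fun x => f (x + v)) M P (fun x => u (x + v)) F.
Proof.
case=> mf fM M0 fP P0 fu u0 uF F0; have pv := preserving_shift v.
have mu' := mnn_pot mf fu; apply: Profile.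
- exact: mnn_comp (measurable_rVD v) mf.
- by rewrite -fM; exact: (integ_preserving pv mf).
- exact: M0.
- by rewrite -fP -[RHS](integ_preserving pv)//; exact: mnn_powR.
- exact: P0.
- exact: (pot_shift mf fu).
- by move=> x; exact: u0.
- by rewrite -uF -[RHS](integ_preserving pv)//; exact: mnn_powR.
- exact: F0.
Qed.

Lemma profile_dilate f M P u F c L : profile f M P u F -> 0 < c -> 0 < L ->
  profile (fun x => c * f (L^-1 *: x)) (c * L ^+ n * M) (c `^ q * L ^+ n * P)
   (fun x => c * L ^+ n * L `^ beta * u (L^-1 *: x))
   ((c * L ^+ n * L `^ beta) `^ (- s) * L ^+ n * F).
Proof.
case=> mf fM M0 fP P0 fu u0 uF F0 c0 L0; have Ln : 0 < L ^+ n by rewrite exprn_gt0.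
have Lb : 0 < L `^ beta by rewrite powR_gt0.
have c0' := ltW c0; have k0 : 0 < c * L ^+ n * L `^ beta by rewrite !mulr_gt0.
have k0' := ltW k0.
have md g : mnn g -> mnn (fun x => g (L^-1 *: x)).
  by move=> mg; apply: (mnn_comp (T := *:%R L^-1)) => //; exact: measurable_rV_scale.
have mu' := mnn_pot mf fu; apply: Profile.
- by apply: mnnZ => //; exact: md.
- by rewrite integZ ?integ_dilate ?fM ?muleA//; exact: md.
- by rewrite !mulr_gt0.
- rewrite (integ_eq (g := fun x => c `^ q * (fun x => f x `^ q) (L^-1 *: x))); last first.
    by move=> x; rewrite powRM// mf.2.
  rewrite integZ ?powR_ge0//; last by apply: (md (fun x => f x `^ q)); exact: mnn_powR.
  by rewrite (integ_dilate L0 (mnn_powR q mf)) fP muleA.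
- by rewrite !mulr_gt0 ?powR_gt0.
- exact: (pot_dilate mf fu).
- by move=> x; rewrite mulr_gt0.
- set k := c * _ * _ in k0 k0' *.
  rewrite (integ_eq (g := fun x => k `^ (- s) * (fun x => u x `^ (- s)) (L^-1 *: x))); last first.
    by move=> x; rewrite powRM// ltW.
  rewrite integZ ?powR_ge0//; last by apply: (md (fun x => u x `^ (- s))); exact: mnn_powR.
  by rewrite (integ_dilate L0 (mnn_powR (- s) mu')) uF muleA.
- by rewrite !mulr_gt0 ?powR_gt0.
Qed.

Variables (b gamma : R).
Hypotheses (bE : b = (beta - n%:R / s) / (n%:R * (q - 1))) (gammaE : gamma = 1 + q * b).

(** The values of [b] and [gamma] are exactly those for which the right-hand product is unchanged by
    [f -> c f(x / L)]; the two parameters suffice to bring both integrals to 1. *)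
Lemma profile_normalize f M P u F : profile f M P u F ->
  exists f' u' F', profile f' 1 1 u' F' /\
    F' `^ (- s^-1) = F `^ (- s^-1) * P `^ b * M `^ (- gamma).
Proof.
move=> pf; have [mf fM M0 fP P0 fu u0 uF F0] := pf.
have q0 : 0 < q - 1 by rewrite subr_gt0.
have nR : 0 < n%:R :> R by rewrite ltr0n.
(* The two conditions [c L ^ n M = 1] and [c ^ q L ^ n P = 1] give [c ^ (q - 1) = M / P], and then
   [L ^ n = (c M)^-1]. *)
pose c := (M / P) `^ (q - 1)^-1.
have c0 : 0 < c by rewrite powR_gt0// divr_gt0.
pose L := (c * M) `^ (- n%:R^-1).
have cM0 : 0 < c * M by rewrite mulr_gt0.
have L0 : 0 < L by rewrite powR_gt0.
have Ln : L ^+ n = (c * M)^-1.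
  rewrite -powR_mulrn ?ltW// -powRrM mulNr mulVf ?gt_eqF// powRN powRr1//.
  exact: ltW.
have M1 : c * L ^+ n * M = 1.
  by rewrite Ln; field; rewrite !gt_eqF.
have cq : c `^ q = c * (M / P).
  rewrite -(mulr_powRB1 (ltW c0)); last exact: lt_trans q1.
  by rewrite -powRrM mulVf ?gt_eqF// powRr1// ltW// divr_gt0.
have P1 : c `^ q * L ^+ n * P = 1.
  by rewrite cq Ln; field; rewrite !gt_eqF.
have := profile_dilate pf c0 L0; rewrite M1 P1 => pf'.
do 3 eexists; split; first exact: pf'.
have Lb : 0 < L `^ beta by rewrite powR_gt0.
have Lng : 0 < L ^+ n by rewrite exprn_gt0.
have cLn : c * L ^+ n = M^-1 by rewrite Ln; field; rewrite !gt_eqF.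
have lnL : ln L = - n%:R^-1 * (ln c + ln M) by rewrite ln_powR lnM.
have lnc : ln c = (q - 1)^-1 * (ln M - ln P) by rewrite ln_powR ln_div.
have lnLn : ln (L ^+ n) = n%:R * ln L.
  by rewrite -powR_mulrn ?ln_powR// ltW.
rewrite cLn; clearbody c L.
have pp (x y : R) : 0 < x -> 0 < y -> 0 < x * y by exact: mulr_gt0.
have pw (x y : R) : 0 < x -> 0 < x `^ y by exact: powR_gt0.
have Mi : 0 < M^-1 by rewrite invr_gt0.
have X0 : 0 < (M^-1 * L `^ beta) `^ (- s) by rewrite pw// pp// pw.
apply: ln_inj; rewrite ?posrE.
- by rewrite pw// pp// pp.
- by rewrite !pp ?pw.
have lnX : ln ((M^-1 * L `^ beta) `^ (- s)) = - s * (- ln M + beta * ln L).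
  by rewrite ln_powR lnM ?posrE ?pw// lnV ?posrE// ln_powR.
have lnLHS : ln ((M^-1 * L `^ beta) `^ (- s) * L ^+ n * F) =
    - s * (- ln M + beta * ln L) + n%:R * ln L + ln F.
  rewrite lnM ?posrE//; last exact: pp.
  by rewrite lnM ?posrE// lnX lnLn.
have lnRHS : ln (F `^ (- s^-1) * P `^ b * M `^ (- gamma)) =
    - s^-1 * ln F + b * ln P + - gamma * ln M.
  rewrite lnM ?posrE ?pw//; last by rewrite pp ?pw.
  by rewrite lnM ?posrE ?pw// !ln_powR.
rewrite lnRHS ln_powR lnLHS lnL lnc gammaE bE; field.
by rewrite !gt_eqF.
Qed.

End profiles.

Section sharp_constant.
Context {R : realType} {n : nat} (beta s q b gamma : R).
Hypotheses (n0 : (0 < n)%N) (beta0 : 0 < beta) (s0 : 0 < s) (sbeta : n%:R < s * beta)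
  (q1 : 1 < q).
Hypotheses (bE : b = (beta - n%:R / s) / (n%:R * (q - 1))) (gammaE : gamma = 1 + q * b).
Local Notation V := 'rV[R]_n.
Local Notation kern := (@kern R n beta).
Local Notation weight := (@weight R n beta).
Local Notation profile := (@profile R n beta s q).
Implicit Types (f g u : V -> R) (x y z : V).

Lemma b_gt0 : 0 < b.
Proof.
have nR : 0 < n%:R :> R by rewrite ltr0n.
by rewrite bE divr_gt0 ?subr_gt0 ?mulr_gt0 ?subr_gt0// ltr_pdivrMr// mulrC.
Qed.

(** The gap [gamma - 1 - b] is the source of the lower bound on the mass in [minimizer_exists]. *)
Lemma b_lt_gamma : 1 + b < gamma.
Proof. by rewrite gammaE ltrD2l ltr_pMl// b_gt0. Qed.

(** Translate to a point where [u] is below twice its infimum, which is positive by [pot_lower]. *)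
Lemma centering f M P u F : profile f M P u F ->
  exists f' u', profile f' M P u' F /\ forall x, u' 0 <= 2 * u' x.
Proof.
move=> pf; have u0 := pf_pot_gt0 pf.
have lb : has_lbound (range u) by exists 0 => _ [x _ <-]; exact: ltW.
have [m m0 mu_] := pot_lower beta0 n0 q1 (pf_mass_gt0 pf) (pf_pow_gt0 pf).
have {}mu_ := mu_ _ _ _ _ (pf_mnn pf) (pf_pot pf) (pf_mass pf) (pf_pow pf) (lexx _) (lexx _).
have hi : has_inf (range u) by split; [exists (u 0), 0|].
have i0 : 0 < inf (range u).
  apply: (lt_le_trans m0); apply: lb_le_inf; first by exists (u 0), 0.
  by move=> _ [x _ <-].
have [_ [v _ <-] uv] := inf_adherent i0 hi.
exists (fun x => f (x + v)), (fun x => u (x + v)); split; first exact: profile_shift.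
move=> x; rewrite add0r.
have : inf (range u) <= u (x + v) by apply: ge_inf => //; exists (x + v).
by move: uv; move: (inf _) (u v) (u (x + v)) => i a c; lra.
Qed.

(** Mass and power are fixed and centring gives [B = 2] in [pot_growth], so one weight serves all
    centred normalised profiles. *)
Lemma centered_weight : exists m c, [/\ 0 < m, 0 < c & forall f u F,
  profile f 1 1 u F -> (forall x, u 0 <= 2 * u x) -> forall x, weight m c x <= u x].
Proof.
have [m m0 mu_] := @pot_lower R n _ beta0 q 1 1 n0 q1 ltr01 ltr01.
have c0 : 0 < 1 / (2 `^ beta * (1 + 2)) :> R.
  by rewrite divr_gt0// mulr_gt0 ?powR_gt0.
exists m, (1 / (2 `^ beta * (1 + 2))); split => // f u F [mf fM M0 fP P0 fu u0 uF F0] u2.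
apply: (pot_growth beta0 mf fu fM) => //.
exact: (mu_ _ _ _ _ mf fu fM fP).
Qed.

Definition quotients : set R := [set Q | exists f u F, profile f 1 1 u F /\ Q = F `^ (- s^-1)].
Definition sharp : R := inf quotients.

Lemma quotients_nonempty : quotients !=set0.
Proof.
pose B : set V := box 0 2^-1.
have mB : measurable B by exact: measurable_box.
have mf : mnn (\1_B : V -> R) by exact: mnn_indic.
have fM : integ (\1_B : V -> R) = 1%:E.
  by rewrite integ_indic// lebesgue_box ?invr_ge0// divff// expr1n.
have fP : integ (fun x => (\1_B x : R) `^ q) = 1%:E.
  rewrite -fM; apply: integ_eq => x; rewrite indicE.
  by case: (_ \in _); rewrite ?powR1// powR0// gt_eqF// (lt_trans ltr01).
pose A : R := (n%:R * 2^-1) `^ beta.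
have [] := @integ_fin _ _ (fun y => kern (0 - y) * \1_B y) (fun y => A * \1_B y) A.
- exact: mnn_kernf.
- by apply: mnnZ => //; exact: powR_ge0.
- move=> y; rewrite indicE; case: (boolP (y \in B)) => [yB|_]; last by rewrite !mulr0.
  rewrite !mulr1 kernBC subr0 kernE; apply: ge0_ler_powR; rewrite ?nnegrE ?enorm_ge0//.
  + exact: ltW.
  + by rewrite -[y]subr0; apply: box_sub_ball; exact: set_mem.
- by rewrite integZ ?powR_ge0// fM mule1.
move=> r [fr _ _]; have [u fu] := is_pot_exists beta0 mf fM fr.
have [F pF] := profile_intro n0 beta0 s0 sbeta q1 mf fM ltr01 fP fu.
by exists (F `^ (- s^-1)), \1_B, u, F.
Qed.

Lemma quotients_ge0 : lbound quotients 0.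
Proof. by move=> _ [f [u [F [_ ->]]]]; exact: powR_ge0. Qed.

(** The common weight of centred profiles bounds all the [F] by the integral of one fixed
    function. *)
Lemma sharp_gt0 : 0 < sharp.
Proof.
have [m [c [m0 c0 wu]]] := centered_weight.
have [r wr] := integ_weightN beta0 m0 c0 s0 sbeta.
have mw : mnn (fun x => weight m c x `^ (- s)).
  by apply: mnn_powR; apply: mnn_weight; exact: ltW.
have r0 : 0 < r.
  by apply: integ_gt0 wr => // x; rewrite powR_gt0// weight_gt0.
apply: (@lt_le_trans _ _ (r `^ (- s^-1))); first exact: powR_gt0.
apply: lb_le_inf; first exact: quotients_nonempty.
move=> _ [f0 [u1 [F [/centering[f [u [pf u2]]] ->]]]].
apply: powRN_le; rewrite ?invr_ge0 ?(ltW s0)//; first exact: pf_neg_gt0 pf.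
rewrite -lee_fin -(pf_neg pf) -wr; apply: integ_le => //.
  exact: mnn_powR (mnn_pot (pf_mnn pf) (pf_pot pf)).
move=> x; apply: powRN_le (wu _ _ _ pf u2 x); [exact: ltW|exact: weight_gt0].
Qed.

Lemma sharp_le f M P u F : profile f M P u F ->
  sharp * (M `^ gamma * P `^ (- b)) <= F `^ (- s^-1).
Proof.
move=> pf; have [f' [u' [F' [pf' E]]]] := profile_normalize n0 s0 q1 bE gammaE pf.
have : sharp <= F' `^ (- s^-1).
  apply: ge_inf; [by exists 0; exact: quotients_ge0|by exists f', u', F'].
have Mg : 0 < M `^ gamma by rewrite powR_gt0// (pf_mass_gt0 pf).
have Pb : 0 < P `^ b by rewrite powR_gt0// (pf_pow_gt0 pf).
rewrite E (powRN P) (powRN M) -mulrA => h.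
rewrite -ler_pdivlMr ?divr_gt0//; apply: (le_trans h).
by rewrite invf_div.
Qed.

(* [penalized] comes from the tangent plane at [(1, 1)] of the convex function
   [M ^ gamma P ^ (- b)]; it attains its minimum [1 + b - gamma] exactly at the
   optimisers with [M = P = 1]. *)
Definition penalized (M P F : R) : R := b * P + F `^ (- s^-1) / sharp - gamma * M.

Lemma penalized_ge f M P u F : profile f M P u F -> 1 + b - gamma <= penalized M P F.
Proof.
move=> pf; have := product_tangent b_gt0 (ltW b_lt_gamma) (pf_mass_gt0 pf) (pf_pow_gt0 pf).
have : M `^ gamma * P `^ (- b) <= F `^ (- s^-1) / sharp.
  by rewrite ler_pdivlMr ?sharp_gt0// mulrC; exact: sharp_le pf.
rewrite /penalized; lra.
Qed.

Lemma penalized_eq f M P u F : profile f M P u F -> penalized M P F <= 1 + b - gamma ->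
  F `^ (- s^-1) = sharp * (M `^ gamma * P `^ (- b)).
Proof.
move=> pf pe; apply: le_anti; rewrite (sharp_le pf) andbT.
have := product_tangent b_gt0 (ltW b_lt_gamma) (pf_mass_gt0 pf) (pf_pow_gt0 pf).
move=> h; rewrite mulrC -ler_pdivrMr ?sharp_gt0//; move: pe; rewrite /penalized.
lra.
Qed.

End sharp_constant.

(** * Best replies and existence of a minimiser *)

Section improvement.
Context {R : realType} {n : nat} (beta s q b gamma : R).
Hypotheses (n0 : (0 < n)%N) (beta0 : 0 < beta) (s0 : 0 < s) (sbeta : n%:R < s * beta)
  (q1 : 1 < q).
Hypotheses (bE : b = (beta - n%:R / s) / (n%:R * (q - 1))) (gammaE : gamma = 1 + q * b).
Local Notation V := 'rV[R]_n.
Local Notation mu := (lebesgue_rV R n).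
Local Notation is_pot := (@is_pot R n beta).
Local Notation profile := (@profile R n beta s q).
Local Notation C := (@sharp R n beta s q).
Local Notation penalized := (@penalized R n beta s q b gamma).
Implicit Types (f g u : V -> R) (x y z : V).

Let b0 : 0 < b. Proof. exact: (b_gt0 n0 s0 sbeta q1 bE). Qed.
Let bq0 : 0 < b * q. Proof. by rewrite mulr_gt0// (lt_trans ltr01). Qed.
Let q10 : 0 < (q - 1)^-1. Proof. by rewrite invr_gt0 subr_gt0. Qed.
Let gamma0 : 0 < gamma.
Proof.
by rewrite gammaE ltr_pwDl// mulr_ge0// ltW// (lt_trans ltr01).
Qed.

(* The minimiser of [b v ^ q + (h - gamma) v] over [v >= 0]. *)
Definition best_reply (h : R) : R := (Num.max (gamma - h) 0 / (b * q)) `^ (q - 1)^-1.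

Lemma best_reply_ge0 h : 0 <= best_reply h. Proof. exact: powR_ge0. Qed.

Lemma best_reply_eq0 h : gamma <= h -> best_reply h = 0.
Proof.
move=> gh; rewrite /best_reply max_r ?mul0r ?powR0 ?gt_eqF//.
by rewrite subr_le0.
Qed.

Lemma best_reply_nonincreasing h h' : h <= h' -> best_reply h' <= best_reply h.
Proof.
move=> hh; have P k : 0 <= Num.max k 0 / (b * q) by rewrite divr_ge0 ?le_max ?lexx ?orbT// ltW.
apply: ge0_ler_powR; rewrite ?nnegrE ?P//; first exact: ltW.
rewrite ler_pM2r ?invr_gt0// ge_max !le_max lexx orbT andbT lerB//.
Qed.

Lemma best_reply_le0 h : 0 <= h -> best_reply h <= best_reply 0.
Proof. exact: best_reply_nonincreasing. Qed.

Lemma best_reply_pow h : b * q * best_reply h `^ (q - 1) = Num.max (gamma - h) 0.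
Proof.
rewrite /best_reply -powRrM mulVf ?gt_eqF ?subr_gt0// powRr1.
  by rewrite mulrC mulfVK// gt_eqF.
by rewrite divr_ge0 ?le_max ?lexx ?orbT// ltW.
Qed.

(** The tangent at the best reply has slope [(gamma - h)_+] by [best_reply_pow]; the positive part
    may be dropped against [best_reply h], which vanishes with it. Keeping the [gamma] terms on
    opposite sides makes both sides nonnegative for [h >= 0], ready to be integrated. *)
Lemma best_reply_min h v : 0 <= v ->
  b * best_reply h `^ q + h * best_reply h + gamma * v <= b * v `^ q + h * v + gamma * best_reply h
    ?= iff (v == best_reply h).
Proof.
move=> v0; have [tg te] := powR_tangent q1 v0 (best_reply_ge0 h).
have {}tg := ler_wpM2l (ltW b0) tg.
have K1 : Num.max (gamma - h) 0 * best_reply h = (gamma - h) * best_reply h.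
  have [gh|gh] := leP (gamma - h) 0; last by [].
  by rewrite best_reply_eq0 ?mulr0// -subr_le0.
have K2 : (gamma - h) * v <= Num.max (gamma - h) 0 * v.
  by rewrite ler_wpM2r// le_max lexx.
have E : b * (best_reply h `^ q + q * best_reply h `^ (q - 1) * (v - best_reply h)) =
    b * best_reply h `^ q + (Num.max (gamma - h) 0 * v - (gamma - h) * best_reply h).
  by rewrite -K1 -best_reply_pow; ring.
rewrite E in tg; split; first lra.
apply/eqP/eqP => [e|->//]; apply/eqP; rewrite -te; apply/eqP.
by apply: (mulfI (lt0r_neq0 b0)); rewrite E; lra.
Qed.

Lemma cvg_best_reply (h : nat -> R) (l : R) : h @ \oo --> l -> (fun k => best_reply (h k)) @ \oo --> best_reply l.
Proof.
move=> hl; apply: cvg_powR; rewrite ?q10//.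
- by move=> k; rewrite divr_ge0 ?le_max ?lexx ?orbT// ltW.
- by rewrite divr_ge0 ?le_max ?lexx ?orbT// ltW.
apply: cvgM; last exact: cvg_cst.
have mx (k : R) : Num.max k 0 = (k + `|k|) / 2.
  by have [k0|k0] := leP k 0; rewrite ?(ler0_norm k0) ?(gtr0_norm k0); field.
rewrite mx; under eq_fun do rewrite mx.
apply: cvgM; last exact: cvg_cst.
have hg : (fun k => gamma - h k) @ \oo --> gamma - l by apply: cvgB => //; exact: cvg_cst.
by apply: cvgD => //; exact: cvg_norm.
Qed.

Lemma mnn_best_reply (h : V -> R) : mnn h -> mnn (fun x => best_reply (h x)).
Proof.
move=> mh; apply: mnn_powR; split; last first.
  by move=> x; rewrite divr_ge0 ?le_max ?lexx ?orbT// ltW.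
apply: measurable_funM => //; apply: measurable_maxr => //.
by apply: measurable_funB => //; exact: mh.1.
Qed.

(* From the tangent line of [v |-> v ^ (- s)] at multiples of [v x]. *)
Lemma reverse_hoelder (v w : V -> R) (Fv Fw W : R) : mnn v -> mnn w ->
  (forall x, 0 < v x) -> (forall x, 0 < w x) ->
  integ (fun x => v x `^ (- s)) = Fv%:E -> integ (fun x => w x `^ (- s)) = Fw%:E ->
  integ (fun x => v x `^ (- s - 1) * w x) = W%:E ->
  Fw `^ (- s^-1) <= W * Fv `^ (- s^-1 - 1).
Proof.
move=> mv mw v0 w0 vF wF vW.
have mvs := mnn_powR (- s) mv; have mws := mnn_powR (- s) mw.
have mvw : mnn (fun x => v x `^ (- s - 1) * w x) by apply: mnnM => //; exact: mnn_powR.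
have Fv0 : 0 < Fv by apply: integ_gt0 vF => // x; exact: powR_gt0.
have Fw0 : 0 < Fw by apply: integ_gt0 wF => // x; exact: powR_gt0.
have W0 : 0 < W by apply: integ_gt0 vW => // x; rewrite mulr_gt0// powR_gt0.
(* The multiple for which the integrated tangent inequality is strongest. *)
pose th := W / Fv; have th0 : 0 < th by rewrite divr_gt0.
have ths : 0 < th `^ (- s) by exact: powR_gt0.
have WE : W = th * Fv by rewrite /th mulfVK// gt_eqF.
have thE : th `^ (- s - 1) * W = th `^ (- s) * Fv.
  rewrite WE mulrA; congr (_ * _); rewrite -[X in _ * X]powRr1 ?ltW// -powRD.
    by congr (_ `^ _); ring.
  by rewrite (gt_eqF th0) implybT.
have : (integ (fun x => ((1 + s) * th `^ (- s) * v x `^ (- s))%R) <=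
    integ (fun x => (w x `^ (- s) + s * th `^ (- s - 1) * (v x `^ (- s - 1) * w x))%R))%E.
  apply: integ_le.
  - by apply: mnnZ => //; rewrite mulr_ge0 ?powR_ge0// addr_ge0// ltW.
  - by apply: mnnD => //; apply: mnnZ => //; rewrite mulr_ge0 ?powR_ge0// ltW.
  by move=> x; rewrite -!mulrA; exact: powRN_tangent.
rewrite integD//; last by apply: mnnZ => //; rewrite mulr_ge0 ?powR_ge0// ltW.
rewrite !integZ//; last 2 first.
- by rewrite mulr_ge0 ?powR_ge0// ltW.
- by rewrite mulr_ge0 ?powR_ge0// addr_ge0// ltW.
rewrite vF wF vW -!EFinM -EFinD lee_fin -!mulrA thE => h.
have : th `^ (- s) * Fv <= Fw by lra.
have tF : 0 < th `^ (- s) * Fv by rewrite mulr_gt0.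
have si0 : 0 <= s^-1 by rewrite invr_ge0 ltW.
move=> /(powRN_le si0 tF)/le_trans; apply.
rewrite powRM ?powR_ge0 ?(ltW Fv0)// -powRrM mulrNN divff ?gt_eqF// powRr1 ?(ltW th0)//.
rewrite /th powRB ?(gt_eqF Fv0) ?implybT// powRr1 ?(ltW Fv0)//.
by rewrite mulrAC mulrA.
Qed.

Section step.
Variables (f : V -> R) (M P : R) (u : V -> R) (F : R) (h0 : V -> R).
Hypotheses (pf : profile f M P u F) (gh : is_pot (fun x => u x `^ (- s - 1)) h0).
(** With this factor [reverse_hoelder] reads [F' ^ (- s^-1) / C <= kappa * W], with equality for [f]
    itself by [kappaF]. *)
Let kappa := F `^ (- s^-1 - 1) / C.
Let w x := best_reply (kappa * h0 x).
Variables (M' P' : R) (u' : V -> R).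
Hypotheses (wM : integ w = M'%:E) (wP : integ (fun x => w x `^ q) = P'%:E) (wu : is_pot w u').

Let C0 : 0 < C. Proof. exact: sharp_gt0. Qed.

Lemma kappa_gt0 : 0 < kappa.
Proof. by rewrite divr_gt0// powR_gt0// (pf_neg_gt0 pf). Qed.

Lemma kappaF : kappa * F = F `^ (- s^-1) / C.
Proof.
have F0 := pf_neg_gt0 pf.
rewrite /kappa powRB ?(gt_eqF F0) ?implybT// powRr1 ?(ltW F0)//.
by field; rewrite !gt_eqF.
Qed.

Lemma mnn_dual : mnn (fun x => u x `^ (- s - 1)).
Proof. exact: mnn_powR (mnn_pot (pf_mnn pf) (pf_pot pf)). Qed.

Lemma mnn_best : mnn w.
Proof.
apply: mnn_best_reply; apply: mnnZ; first exact: ltW kappa_gt0.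
exact: mnn_pot mnn_dual gh.
Qed.

(** Integrate [best_reply_min] at [h = kappa * h0 x]; duality turns the integrals of [f h0] and
    [w h0] into [F] and [W]. Equality of the integrals forces pointwise equality almost
    everywhere. *)
Lemma best_reply_improves : exists W, [/\ integ (fun x => u x `^ (- s - 1) * u' x) = W%:E,
  b * P' + kappa * W + gamma * M <= b * P + kappa * F + gamma * M' &
  (b * P' + kappa * W + gamma * M = b * P + kappa * F + gamma * M' ->
   {ae mu, forall x, f x = w x})].
Proof.
have [mf fM M0 fP P0 fu u0 uF F0] := pf; have k0 := kappa_gt0.
have mw := mnn_best; have mh := mnn_pot mnn_dual gh.
have mkh : mnn (fun x => kappa * h0 x) by apply: mnnZ => //; exact: ltW.
pose L x := b * w x `^ q + kappa * h0 x * w x + gamma * f x.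
pose U x := b * f x `^ q + kappa * h0 x * f x + gamma * w x.
have LU x : L x <= U x ?= iff (f x == w x) by apply: best_reply_min; exact: mf.2.
have b0' := ltW b0; have g0' := ltW gamma0.
have mA g : mnn g -> mnn (fun x => b * g x `^ q).
  by move=> mg; apply: mnnZ => //; exact: mnn_powR.
have mL : mnn L.
  by apply: mnnD; [apply: mnnD; [exact: mA|exact: mnnM]|exact: mnnZ].
have mU : mnn U.
  by apply: mnnD; [apply: mnnD; [exact: mA|exact: mnnM]|exact: mnnZ].
have IA (v v' : V -> R) (I : \bar R) p m : mnn v -> mnn v' ->
    integ (fun x => v x `^ q) = p%:E -> integ v' = m%:E -> integ (fun x => v x * h0 x) = I ->
    integ (fun x => b * v x `^ q + kappa * h0 x * v x + gamma * v' x) =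
    ((b * p)%:E + kappa%:E * I + (gamma * m)%:E)%E.
  move=> mv mv' vp vm vI.
  rewrite integD; [|by apply: mnnD; [exact: mA|exact: mnnM]|exact: mnnZ].
  rewrite integD; [|exact: mA|exact: mnnM].
  rewrite !integZ//; last exact: mnn_powR.
  rewrite vp vm (integ_eq (g := fun x => kappa * (v x * h0 x))); last by move=> x; ring.
  by rewrite integZ ?vI//; [exact: ltW|exact: mnnM].
have hf : integ (fun x => f x * h0 x) = F%:E.
  rewrite -(pot_duality mf mnn_dual fu gh) -uF; apply: integ_eq => x.
  rewrite -[X in _ * X]powRr1 ?(ltW (u0 x))// -powRD; first by congr (_ `^ _); ring.
  by rewrite (gt_eqF (u0 x)) implybT.
have hw := pot_duality mw mnn_dual wu gh.
have IU : integ U = (b * P + kappa * F + gamma * M')%:E.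
  by rewrite (IA _ _ _ _ _ mf mw fP wM hf).
have [r [IL _ _]] := integ_fin mL mU (fun x => (LU x).1) IU.
have := IL; rewrite (IA _ _ _ _ _ mw mf wP fM erefl) -hw.
set W := integ (fun x => _ * u' x).
have : (0 <= W)%E.
  by apply: integ_ge0; apply: mnnM; [exact: mnn_dual|exact: mnn_pot mw wu].
(* [W = +oo] is impossible, the integral of [L] being the finite [r]. *)
case: W => [W|_|//]; last first.
  by rewrite gt0_muley ?lte_fin// addeC /=.
move=> _; rewrite -!EFinM -!EFinD => -[rE]; exists W; split => //.
  by rewrite -lee_fin rE -IL -IU; apply: integ_le => // x; exact: (LU x).1.
move=> E; rewrite rE in E; rewrite -E in IU.
have := integ_eq_ae mL mU (fun x => (LU x).1) IL IU.
by apply: filterS => x /eqP; rewrite (LU x).2 => /eqP.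
Qed.

Lemma penalized_best F' W : profile w M' P' u' F' ->
  integ (fun x => u x `^ (- s - 1) * u' x) = W%:E ->
  penalized M' P' F' <= b * P' + kappa * W - gamma * M'.
Proof.
move=> pw uW.
have := reverse_hoelder (mnn_pot (pf_mnn pf) (pf_pot pf)) (mnn_pot (pf_mnn pw) wu)
  (pf_pot_gt0 pf) (pf_pot_gt0 pw) (pf_neg pf) (pf_neg pw) uW.
move=> h; have : F' `^ (- s^-1) / C <= kappa * W.
  by rewrite /kappa ler_pdivrMr// mulrAC mulfVK ?gt_eqF// mulrC.
rewrite /penalized; lra.
Qed.

Lemma best_reply_penalized F' : profile w M' P' u' F' -> penalized M' P' F' <= penalized M P F.
Proof.
move=> pw; have [W [uW le _]] := best_reply_improves; apply: (le_trans (penalized_best pw uW)).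
by move: le; rewrite kappaF /penalized; lra.
Qed.

End step.

End improvement.

Section existence.
Context {R : realType} {n : nat} (beta s q b gamma : R).
Hypotheses (n0 : (0 < n)%N) (beta0 : 0 < beta) (s0 : 0 < s) (sbeta : n%:R < s * beta)
  (q1 : 1 < q).
Hypotheses (bE : b = (beta - n%:R / s) / (n%:R * (q - 1))) (gammaE : gamma = 1 + q * b).
Local Notation V := 'rV[R]_n.
Local Notation mu := (lebesgue_rV R n).
Local Notation kern := (@kern R n beta).
Local Notation weight := (@weight R n beta).
Local Notation is_pot := (@is_pot R n beta).
Local Notation profile := (@profile R n beta s q).
Local Notation C := (@sharp R n beta s q).
Local Notation penalized := (@penalized R n beta s q b gamma).
Local Notation best_reply := (@best_reply R q b gamma).
Implicit Types (f g u : V -> R) (x y z : V).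

Let b0 : 0 < b. Proof. exact: (b_gt0 n0 s0 sbeta q1 bE). Qed.
Let b1 : 1 + b < gamma. Proof. exact: (b_lt_gamma n0 s0 sbeta q1 bE gammaE). Qed.
Let gamma0 : 0 < gamma. Proof. have := b0; have := b1; lra. Qed.
Let C0 : 0 < C. Proof. exact: sharp_gt0. Qed.
Let q0 : 0 < q. Proof. exact: lt_trans q1. Qed.

Lemma box_dominated A r : 0 <= A -> 0 <= r ->
  exists Mb Pb Ub, forall f, mnn f -> (forall x, f x <= A * \1_(box 0 r) x) ->
    exists M P u, [/\ integ f = M%:E, M <= Mb, integ (fun x => f x `^ q) = P%:E, P <= Pb &
      is_pot f u /\ u 0 <= Ub].
Proof.
move=> A0 r0; have mB : measurable (box (0 : V) r) by exact: measurable_box.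
have mi : mnn (\1_(box 0 r) : V -> R) by exact: mnn_indic.
have iB : integ (\1_(box 0 r) : V -> R) = ((2 * r) ^+ n)%:E.
  by rewrite integ_indic// lebesgue_box.
pose K := (n%:R * r) `^ beta.
exists (A * (2 * r) ^+ n), (A `^ q * (2 * r) ^+ n), (K * A * (2 * r) ^+ n) => f mf fA.
have I k : 0 <= k -> integ (fun x => k * (\1_(box 0 r) : V -> R) x) = (k * (2 * r) ^+ n)%:E.
  by move=> k0; rewrite integZ// iB.
have [M [fM _ MM]] := integ_fin mf (mnnZ A0 mi) fA (I _ A0).
have [] := integ_fin (mnn_powR q mf) (mnnZ (powR_ge0 A q) mi) _ (I _ (powR_ge0 A q)).
  move=> x; have := fA x; rewrite indicE; case: (x \in _) => /=.
    rewrite !mulr1 => fx; apply: ge0_ler_powR; rewrite ?nnegrE ?mf.2//; exact: ltW.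
  rewrite !mulr0 => fx; have -> : f x = 0 by apply: le_anti; rewrite fx mf.2.
  by rewrite powR0// gt_eqF.
move=> P [fP _ PP].
have KA : 0 <= K * A by rewrite mulr_ge0 ?powR_ge0.
have [] := integ_fin (mnn_kernf beta 0 mf) (mnnZ KA mi) _ (I _ KA).
  move=> y; have := fA y; rewrite indicE; case: (boolP (y \in _)) => [yB|_] /=.
    rewrite !mulr1 => fy; apply: ler_pM; rewrite ?kern_ge0 ?mf.2//.
    rewrite kernBC subr0 kernE; apply: ge0_ler_powR; rewrite ?nnegrE ?enorm_ge0//.
    + exact: ltW.
    + by rewrite mulr_ge0.
    + by rewrite -[y]subr0; apply: box_sub_ball; exact: set_mem.
  rewrite !mulr0 => fy; have -> : f y = 0 by apply: le_anti; rewrite fy mf.2.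
  by rewrite mulr0.
move=> U [fU _ UU]; have [u fu] := is_pot_exists beta0 mf fM fU.
exists M, P, u; split => //; split => //.
by rewrite -lee_fin -fu fU lee_fin.
Qed.

(** The majorant [w] is chosen before [u], so that it dominates the duals of a whole family. *)
Lemma dual_pot m c : 0 < m -> 0 < c -> exists w H r, [/\ mnn w, integ w = r%:E, is_pot w H &
  forall u, mnn u -> (forall x, weight m c x <= u x) -> exists h0 G,
   [/\ forall x, u x `^ (- s - 1) <= w x,
       integ (fun x => u x `^ (- s - 1)) = G%:E, is_pot (fun x => u x `^ (- s - 1)) h0
       & h0 0 <= H 0]].
Proof.
move=> m0 c0; have [H [r [wr wH]]] := @pot_weightN R n _ _ beta0 s0 sbeta _ _ m0 c0.
have mw : mnn (fun x => weight m c x `^ (- s - 1)).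
  by apply: mnn_powR; apply: mnn_weight; exact: ltW.
exists (fun x => weight m c x `^ (- s - 1)), H, r; split => // u mu_ wu.
have uw x : u x `^ (- s - 1) <= weight m c x `^ (- s - 1).
  rewrite -opprD; apply: powRN_le (wu x); last exact: weight_gt0.
  by rewrite addr_ge0// ltW.
have mg := mnn_powR (- s - 1) mu_.
have [G [uG _ _]] := integ_fin mg mw uw wr.
have [|h [uh h1 h2]] := integ_fin (mnn_kernf beta 0 mg) (mnn_kernf beta 0 mw) _ (wH 0).
  by move=> y; rewrite ler_wpM2l ?kern_ge0.
have [h0 hh] := is_pot_exists beta0 mg uG uh.
by exists h0, G; split => //; rewrite -lee_fin -hh uh lee_fin.
Qed.

(** If [u 0] were large, centring would make [u] large everywhere and [F] smaller than [Fs]. So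
    [u 0] is bounded, hence [u] is bounded on a cube by [pot_le_kern], and the cube alone
    contributes [d]. *)
Lemma dual_mass_lower m c Fs : 0 < m -> 0 < c -> 0 < Fs ->
  exists2 d, 0 < d & forall f u F G, profile f 1 1 u F -> (forall x, u 0 <= 2 * u x) ->
    (forall x, weight m c x <= u x) -> Fs <= F ->
    integ (fun x => u x `^ (- s - 1)) = G%:E -> d <= G.
Proof.
move=> m0 c0 Fs0.
(* An exponent strictly between [n / beta] and [s]: the weight remains integrable at the power
   [- s'], and the spare [s - s'] produces a negative power of [u 0 / 2]. *)
pose s' := (s + n%:R / beta) / 2.
have ns : n%:R / beta < s by rewrite ltr_pdivrMr.
have nb0 : 0 <= n%:R / beta by rewrite divr_ge0// ltW.
have ss' : 0 < s - s' by rewrite /s'; lra.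
have s'0 : 0 < s' by rewrite /s'; lra.
have s'b : n%:R < s' * beta by rewrite -ltr_pdivrMr// /s'; lra.
have [r wr] := integ_weightN beta0 m0 c0 s'0 s'b.
have mw' : mnn (fun x => weight m c x `^ (- s')).
  by apply: mnn_powR; apply: mnn_weight; exact: ltW.
have r0 : 0 < r by apply: integ_gt0 wr => // x; rewrite powR_gt0// weight_gt0.
pose N := 2 * (r / Fs) `^ (s - s')^-1.
have N0 : 0 < N by rewrite mulr_gt0// powR_gt0// divr_gt0.
pose U := 2 `^ beta * ((n%:R : R) `^ beta + N).
have U0 : 0 < U by rewrite mulr_gt0 ?powR_gt0// ltr_wpDl// powR_ge0.
have s1 : 0 <= s + 1 by rewrite addr_ge0// ltW.
exists (U `^ (- (s + 1)) * (2 * 1) ^+ n); first by rewrite mulr_gt0 ?powR_gt0// exprn_gt0// mulr_gt0.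
move=> f u F G pf u2 wu FF uG; have u0 := pf_pot_gt0 pf.
have mu_ := mnn_pot (pf_mnn pf) (pf_pot pf).
have u0N : u 0 <= N.
  have h0 : 0 < u 0 / 2 by rewrite divr_gt0.
  have : (F%:E <= ((u 0 / 2) `^ (- (s - s')) * r)%:E)%E.
    rewrite EFinM -wr -(pf_neg pf) -integZ ?powR_ge0//; apply: integ_le.
    - exact: mnn_powR.
    - by apply: mnnZ => //; exact: powR_ge0.
    move=> x; have -> : - s = - (s - s') + - s' by ring.
    rewrite powRD; last by rewrite (gt_eqF (u0 x)) implybT.
    apply: ler_pM; rewrite ?powR_ge0//.
      apply: powRN_le => //; first exact: ltW.
      by rewrite ler_pdivrMr// mulrC.
    apply: powRN_le (wu x); [exact: ltW|exact: weight_gt0].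
  rewrite lee_fin => /(le_trans FF); rewrite powRN mulrC ler_pdivlMr ?powR_gt0// => h.
  have {}h : (u 0 / 2) `^ (s - s') <= r / Fs by rewrite ler_pdivlMr// mulrC.
  have : ((u 0 / 2) `^ (s - s')) `^ (s - s')^-1 <= (r / Fs) `^ (s - s')^-1.
    apply: ge0_ler_powR; rewrite ?nnegrE ?powR_ge0 ?invr_ge0 ?(ltW ss')//.
    by rewrite ltW// divr_gt0.
  rewrite -powRrM divff ?gt_eqF// powRr1 ?(ltW h0)// /N; lra.
have mB : measurable (box (0 : V) 1) by exact: measurable_box.
rewrite -lee_fin EFinM -uG -(lebesgue_box 0 ler01) -integ_indic// -integZ ?powR_ge0//.
apply: integ_le; first by apply: mnnZ; [exact: powR_ge0|exact: mnn_indic].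
  exact: mnn_powR.
move=> x; rewrite indicE; case: (boolP (x \in _)) => [xB|_]; last by rewrite mulr0 powR_ge0.
rewrite mulr1 -opprD; apply: powRN_le => //.
apply: (le_trans (pot_le_kern beta0 (pf_mnn pf) (pf_pot pf) (pf_mass pf) x 0)).
rewrite subr0 mulr1 ler_pM2l ?powR_gt0//; apply: lerD => //.
rewrite kernE; apply: ge0_ler_powR; rewrite ?nnegrE ?enorm_ge0//; first exact: ltW.
by have := box_sub_ball (set_mem xB); rewrite subr0 mulr1.
Qed.

(** A dual of mass at least [d] has a potential growing like [d * kern]; beyond [r] it exceeds
    [gamma / ks], where the best reply vanishes. The radius depends only on the three bounds. *)
Lemma best_reply_support (ks d H0 : R) : 0 < ks -> 0 < d -> 0 <= H0 ->
  exists2 r, 0 <= r & forall g (h0 : V -> R) G k, mnn g -> is_pot g h0 -> integ g = G%:E ->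
    d <= G -> h0 0 <= H0 -> ks <= k -> forall x, best_reply (k * h0 x) <= best_reply 0 * \1_(box 0 r) x.
Proof.
move=> ks0 d0 H00; pose rho := 2 `^ beta * (gamma / ks + H0) / d.
exists (rho `^ beta^-1); first exact: powR_ge0.
move=> g h0 G k mg gh gG dG hH kk x; have k0 := lt_le_trans ks0 kk.
have h00 := (mnn_pot mg gh).2 x.
rewrite indicE; case: (boolP (x \in _)) => [_|xB].
  by rewrite mulr1 (best_reply_le0 gamma n0 s0 sbeta q1 bE)// mulr_ge0// ltW.
rewrite mulr0 best_reply_eq0//.
have : rho < kern x.
  rewrite ltNge; apply: contra xB => kx; apply/mem_set/ball_sub_box; rewrite subr0.
  have : kern x `^ beta^-1 <= rho `^ beta^-1.
    have ? := kern_ge0 beta x.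
    by apply: ge0_ler_powR; rewrite ?nnegrE ?invr_ge0 ?(ltW beta0)// (le_trans _ kx).
  by rewrite kernE -powRrM divff ?gt_eqF// powRr1 ?enorm_ge0.
rewrite /rho ltr_pdivrMr// => h1.
have := kern_le_pot beta0 mg gh gG x 0; rewrite subr0 => h2.
have h3 : kern x * d <= kern x * G by rewrite ler_wpM2l ?kern_ge0.
have : 2 `^ beta * (gamma / ks + H0) < 2 `^ beta * (h0 x + h0 0).
  by apply: (lt_le_trans h1); apply: (le_trans h3).
rewrite ltr_pM2l ?powR_gt0// => h4.
have : gamma / ks <= h0 x by lra.
rewrite ler_pdivrMr// => /le_trans; apply.
by rewrite mulrC ler_wpM2r.
Qed.

Lemma minimizing_sequence e : 0 < e -> exists (f u : nat -> V -> R) (F : nat -> R),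
  [/\ forall k, profile (f k) 1 1 (u k) (F k), forall k x, u k 0 <= 2 * u k x,
   forall k, C <= F k `^ (- s^-1) < C + e & (fun k => F k `^ (- s^-1)) @ \oo --> C].
Proof.
move=> e0.
have H (k : nat) : exists p : (V -> R) * (V -> R) * R, [/\ profile p.1.1 1 1 p.1.2 p.2,
    forall x, p.1.2 0 <= 2 * p.1.2 x & p.2 `^ (- s^-1) < C + Num.min e k.+1%:R^-1].
  have hi : has_inf (@quotients R n beta s q).
    by split; [exact: quotients_nonempty|exists 0; exact: quotients_ge0].
  have ek : 0 < Num.min e k.+1%:R^-1 by rewrite lt_min e0 invr_gt0/=.
  have [_ [f [u [F [pf ->]]]] lt] := inf_adherent ek hi.
  have [f' [u' [pf' u2]]] := centering n0 beta0 q1 pf.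
  by exists (f', u', F).
have [p Hp] := choice H.
have lb k : C <= (p k).2 `^ (- s^-1).
  apply: ge_inf; first by exists 0; exact: quotients_ge0.
  by have [pf _ _] := Hp k; exists (p k).1.1, (p k).1.2, (p k).2.
exists (fun k => (p k).1.1), (fun k => (p k).1.2), (fun k => (p k).2); split.
- by move=> k; case: (Hp k).
- by move=> k; case: (Hp k).
- move=> k; rewrite lb/=; have [_ _ /lt_le_trans] := Hp k; apply.
  by rewrite lerD2l ge_min lexx.
apply: (@squeeze_cvgr _ _ _ _ (fun=> C) (fun k => C + k.+1%:R^-1)).
- apply: nearW => k; rewrite lb/=; have [_ _ /ltW/le_trans] := Hp k; apply.
  by rewrite lerD2l ge_min lexx orbT.
- exact: cvg_cst.
- rewrite -[X in _ --> X]addr0; apply: cvgD; [exact: cvg_cst|exact: cvg_harmonic].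
Qed.

Lemma minimizer_exists : exists f M P u F, profile f M P u F /\
  penalized M P F <= 1 + b - gamma.
Proof.
(* Along the sequence the norm divided by [C] exceeds 1 by at most half the gap [gamma - 1 - b]; the
   other half is left for the mass. *)
pose e := C * (gamma - 1 - b) / 2.
have gb : 0 < gamma - 1 - b by have := b1; lra.
have e0 : 0 < e by rewrite /e divr_gt0// mulr_gt0.
have [f [u [F [pf u2 QC cQ]]]] := minimizing_sequence e0.
have [m [c [m0 c0 wu]]] := @centered_weight R n beta s q n0 beta0 q1.
have {}wu k x : weight m c x <= u k x by apply: (wu _ _ _ (pf k)); exact: u2.
have mu_ k : mnn (u k) := mnn_pot (pf_mnn (pf k)) (pf_pot (pf k)).
have [w [H [r [mw wr wH dual]]]] := dual_pot m0 c0.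
have [p Hp] := choice (fun k => let: ex_intro h0 (ex_intro G HH) := dual (u k) (mu_ k) (wu k) in
  ex_intro (fun p : (V -> R) * R => [/\ forall x, u k x `^ (- s - 1) <= w x,
       integ (fun x => u k x `^ (- s - 1)) = p.2%:E,
       is_pot (fun x => u k x `^ (- s - 1)) p.1
       & p.1 0 <= H 0]) (h0, G) HH).
pose h k := (p k).1.
have gw k x : u k x `^ (- s - 1) <= w x by case: (Hp k).
have gh k : is_pot (fun x => u k x `^ (- s - 1)) (h k) by case: (Hp k).
have mg k : mnn (fun x => u k x `^ (- s - 1)) by exact: mnn_powR.
have F0 k : 0 < F k := pf_neg_gt0 (pf k).
have FQ k : F k = (F k `^ (- s^-1)) `^ (- s).
  by rewrite -powRrM mulrNN mulVf ?gt_eqF// powRr1// ltW.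
have Flow k : (C + e) `^ (- s) <= F k.
  rewrite FQ; have /andP[_ Q1] := QC k; apply: powRN_le; [exact: ltW|exact: powR_gt0|exact: ltW].
have Fs0 : 0 < (C + e) `^ (- s) by rewrite powR_gt0// addr_gt0.
have [d d0 dG] := dual_mass_lower m0 c0 Fs0.
pose kappa k := F k `^ (- s^-1 - 1) / C.
have kappaE k : kappa k = F k `^ (- s^-1) * (F k)^-1 / C.
  by rewrite /kappa powRB ?(gt_eqF (F0 k)) ?implybT// powRr1// ltW.
have Ci k : C `^ s <= (F k)^-1.
  rewrite FQ powRN invrK; have /andP[Q1 _] := QC k.
  by apply: ge0_ler_powR; rewrite ?nnegrE ?powR_ge0 ?(ltW s0)// ltW.
have kk k : C `^ s <= kappa k.
  rewrite kappaE ler_pdivlMr// mulrC; apply: ler_pM; rewrite ?powR_ge0 ?(ltW C0)//.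
  by have /andP[] := QC k.
have Cs0 : 0 < C `^ s by rewrite powR_gt0.
have H00 : 0 <= H 0 := (mnn_pot mw wH).2 0.
have [rho rho0 supp] := best_reply_support Cs0 d0 H00.
have A0 : 0 <= best_reply 0 by exact: best_reply_ge0.
have [Mb [Pb [Ub boxed]]] := box_dominated A0 rho0.
pose v k x := best_reply (kappa k * h k x).
have mv k : mnn (v k).
  exact: (mnn_best gamma n0 beta0 s0 sbeta q1 bE (pf k) (gh k)).
have vA k x : v k x <= best_reply 0 * \1_(box 0 rho) x.
  have [_ uG hh hH] := Hp k.
  by apply: (supp _ _ _ _ (mg k) hh uG) => //; apply: dG uG => //.
have vex k : exists a : R * R * (V -> R), [/\ integ (v k) = a.1.1%:E, a.1.1 <= Mb,
    integ (fun x => v k x `^ q) = a.1.2%:E, a.1.2 <= Pb & is_pot (v k) a.2 /\ a.2 0 <= Ub].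
  by have [M [P [U HH]]] := boxed _ (mv k) (vA k); exists (M, P, U).
have [a Ha] := choice vex.
(* Dropping the nonnegative terms [b P'] and [kappa W] from [best_reply_improves] leaves this lower
   bound for the mass of the replies. *)
pose Ms := (gamma - 1 - b) / 2 / gamma.
have Ms0 : 0 < Ms by rewrite !divr_gt0.
have MM k : Ms <= (a k).1.1.
  have [vM _ vP _ [vU _]] := Ha k.
  have [W [uW + _]] := best_reply_improves n0 beta0 s0 sbeta q1 bE gammaE (pf k) (gh k) vM vP vU.
  rewrite (kappaF n0 beta0 s0 sbeta q1 (pf k)) !mulr1.
  have P0 : 0 <= b * (a k).1.2.
    by rewrite mulr_ge0 ?(ltW b0)// -lee_fin -vP integ_ge0//; exact: mnn_powR.
  have W0 : 0 <= kappa k * W.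
    rewrite mulr_ge0//; first exact: le_trans (ltW Cs0) (kk k).
    by rewrite -lee_fin -uW integ_ge0//; apply: mnnM => //; exact: mnn_pot (mv k) vU.
  have : F k `^ (- s^-1) / C <= 1 + (gamma - 1 - b) / 2.
    have /andP[_ /ltW Q1] := QC k.
    by rewrite ler_pdivrMr//; apply: (le_trans Q1); rewrite /e; lra.
  rewrite -/(kappa k) /Ms [_ <= (a k).1.1]ler_pdivrMr//.
  by move: (F k `^ _ / C) (kappa k * W) W0 => X Y; lra.
have Pb0 : 0 < Num.max Pb 1 by rewrite lt_max ltr01 orbT.
have [m' m'0 low] := pot_lower beta0 n0 q1 Ms0 Pb0.
have {}low k x : m' <= (a k).2 x.
  have [vM _ vP PP [vU _]] := Ha k.
  by apply: (low _ _ _ _ (mv k) vU vM vP (MM k)); rewrite le_max PP.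
have U0 : 0 < Ub.
  by have [_ _ _ _ [_ UU]] := Ha 0%N; exact: lt_le_trans (le_trans (low 0%N 0) UU).
have B0 : 0 <= Ub / m' by rewrite divr_ge0// ltW.
(* The replies are not centred, but their potentials lie above [m'] and are at most [Ub] at 0, so
   [B = Ub / m'] gives one weight for all of them. *)
pose c' := Ms / (2 `^ beta * (1 + Ub / m')).
have cc0 : 0 < 2 `^ beta * (1 + Ub / m') by rewrite mulr_gt0 ?powR_gt0// ltr_pwDl.
have c'0 : 0 < c' by rewrite divr_gt0.
have wu' k x : weight m' c' x <= (a k).2 x.
  have [vM _ vP _ [vU UU]] := Ha k.
  have uB y : (a k).2 0 <= Ub / m' * (a k).2 y.
    by rewrite (le_trans UU)// mulrAC ler_pdivlMr// ler_pM2l.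
  apply: le_trans (pot_growth beta0 (mv k) vU vM B0 (low k) uB x).
  rewrite ge_max !le_max lexx/=; apply/orP; right.
  by rewrite ler_wpM2r ?kern_ge0// ler_pM2r ?invr_gt0.
(* The one use of compactness; the limits that follow come from continuity of the reply and
   dominated convergence. *)
have [phi phik [h' hh']] := pot_subseq beta0 mg gw gh mw wr wH.
pose v' x := best_reply (C `^ s * h' x).
have ckappa : kappa @ \oo --> C `^ s.
  have -> : C `^ s = C * C `^ s / C by rewrite mulrAC divff ?gt_eqF// mul1r.
  rewrite (_ : kappa = fun k => F k `^ (- s^-1) * (F k)^-1 / C); last first.
    by apply/funext => k; rewrite kappaE.
  apply: cvgM; last exact: cvg_cst.
  apply: cvgM => //.
  rewrite (_ : (fun k => (F k)^-1) = fun k => (F k `^ (- s^-1)) `^ s); last first.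
    by apply/funext => k; rewrite [in LHS]FQ powRN invrK.
  by apply: cvg_powR => //; rewrite ?s0 ?(ltW C0)// => k; exact: powR_ge0.
have vv' x : (fun k => v (phi k) x) @ \oo --> v' x.
  apply: (cvg_best_reply n0 s0 sbeta q1 bE); apply: cvgM => //.
  exact: cvgn_subseq phik ckappa.
have mi : mnn (fun x => best_reply 0 * (\1_(box 0 rho) : V -> R) x).
  by apply: mnnZ => //; apply: mnn_indic; exact: measurable_box.
have [M1 [P1 [u1 [iM _ iP _ [iu _]]]]] := boxed _ mi (fun x => lexx _).
have [a1 [M [mv' a1E vM cM]]] :=
  integ_dct (fun k => mv (phi k)) vv' mi iM (fun k => vA (phi k)).
have a1a k : a1 k = (a (phi k)).1.1.
  by have [E _ _ _ _] := Ha (phi k); move: E; rewrite a1E => -[].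
have vq x : (fun k => v (phi k) x `^ q) @ \oo --> v' x `^ q.
  by apply: cvg_powR => //; [move=> k; exact: best_reply_ge0|exact: best_reply_ge0|rewrite q0].
have vqA k x : v (phi k) x `^ q <= (best_reply 0 * \1_(box 0 rho) x) `^ q.
  by apply: ge0_ler_powR; rewrite ?nnegrE ?(mv _).2 ?mi.2 ?(ltW q0).
have [a2 [P [_ a2E vP cP]]] :=
  integ_dct (fun k => mnn_powR q (mv (phi k))) vq (mnn_powR q mi) iP vqA.
have a2a k : a2 k = (a (phi k)).1.2.
  by have [_ _ E _ _] := Ha (phi k); move: E; rewrite a2E => -[].
have vu x : exists l, integ (fun y => kern (x - y) * v' y) = l%:E /\
    (fun k => (a (phi k)).2 x) @ \oo --> l.
  have kv y : (fun k => kern (x - y) * v (phi k) y) @ \oo --> kern (x - y) * v' y.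
    by apply: cvgM => //; exact: cvg_cst.
  have kA k y : kern (x - y) * v (phi k) y <= kern (x - y) * (best_reply 0 * \1_(box 0 rho) y).
    by rewrite ler_wpM2l ?kern_ge0.
  have [a3 [l [_ a3E vl cl]]] := integ_dct (fun k => mnn_kernf beta x (mv (phi k))) kv
    (mnn_kernf beta x mi) (iu x) kA.
  exists l; split => //; rewrite (_ : (fun _ => _) = a3)//.
  apply/funext => k; have [_ _ _ _ [E _]] := Ha (phi k).
  by have := E x; rewrite a3E => -[].
have [u' Hu'] := choice vu.
have vu' : is_pot v' u' by move=> x; case: (Hu' x).
have cu' x : (fun k => (a (phi k)).2 x) @ \oo --> u' x by case: (Hu' x).
have MsM : Ms <= M by apply: cvgn_ge cM => k; rewrite a1a.
have M0 : 0 < M by exact: lt_le_trans MsM.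
have [F' pF'] := profile_intro n0 beta0 s0 sbeta q1 mv' vM M0 vP vu'.
have pk k : exists F'', profile (v (phi k)) (a (phi k)).1.1 (a (phi k)).1.2 (a (phi k)).2 F''.
  have [E1 _ E2 _ [E3 _]] := Ha (phi k).
  apply: profile_intro E1 _ E2 E3 => //; exact: lt_le_trans (MM _).
have [F'' pF''] := choice pk.
have [rw wrw] := integ_weightN beta0 m'0 c'0 s0 sbeta.
have mww : mnn (weight m' c') by apply: mnn_weight; exact: ltW.
have us x : (fun k => (a (phi k)).2 x `^ (- s)) @ \oo --> u' x `^ (- s).
  apply: cvg_powR => //.
  - by move=> k; exact: ltW (pf_pot_gt0 (pF'' k) x).
  - exact: ltW (pf_pot_gt0 pF' x).
  - by rewrite (pf_pot_gt0 pF' x) orbT.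
have usw k x : (a (phi k)).2 x `^ (- s) <= weight m' c' x `^ (- s).
  by apply: powRN_le (wu' _ x); [exact: ltW|exact: weight_gt0].
have mua k : mnn (a (phi k)).2 by exact: mnn_pot (mv _) (pf_pot (pF'' k)).
have [a4 [F4 [_ a4E F4E cF]]] := integ_dct (fun k => mnn_powR (- s) (mua k)) us
  (mnn_powR (- s) mww) wrw usw.
have F4' : F4 = F' by have := pf_neg pF'; rewrite F4E => -[].
have a4a k : a4 k = F'' k by have := pf_neg (pF'' k); rewrite a4E => -[].
exists v', M, P, u', F'; split => //.
(* The replies do at least as well as the sequence, whose penalised values tend to the lower
   bound. *)
have cQ' : (fun k => penalized 1 1 (F (phi k))) @ \oo --> 1 + b - gamma.
  have -> : 1 + b - gamma = b * 1 + C / C - gamma * 1 by rewrite divff ?gt_eqF//; ring.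
  apply: cvgB; last exact: cvg_cst.
  apply: cvgD; first exact: cvg_cst.
  by apply: cvgM; [exact: (cvgn_subseq phik cQ)|exact: cvg_cst].
have cP' : (fun k => penalized (a1 k) (a2 k) (a4 k)) @ \oo --> penalized M P F'.
  apply: cvgB; last by apply: cvgM => //; exact: cvg_cst.
  apply: cvgD; first by apply: cvgM => //; exact: cvg_cst.
  apply: cvgM; last exact: cvg_cst.
  rewrite -F4'; apply: cvg_powR => //.
  - by move=> k; rewrite a4a; exact: ltW (pf_neg_gt0 (pF'' k)).
  - by rewrite F4'; exact: ltW (pf_neg_gt0 pF').
  - by rewrite F4' (pf_neg_gt0 pF') orbT.
apply: (ler_cvg_to cP' cQ'); apply: nearW => k.
rewrite a1a a2a a4a.
have [E1 _ E2 _ [E3 _]] := Ha (phi k).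
exact: (best_reply_penalized n0 beta0 s0 sbeta q1 bE gammaE (pf (phi k)) (gh (phi k)) E1 E2 E3 (pF'' k)).
Qed.

(* A minimiser agrees almost everywhere with its best reply, which has the same
   potential and hence is its own best reply everywhere. *)
Lemma fixed_point_exists : exists f M P u F h0 k r, [/\ profile f M P u F,
  penalized M P F <= 1 + b - gamma,
  is_pot (fun x => u x `^ (- s - 1)) h0,
  0 < k /\ (forall x, f x = best_reply (k * h0 x)) &
  forall x, f x <= best_reply 0 * \1_(box 0 r) x].
Proof.
have [f [M [P [u [F [pf min]]]]]] := minimizer_exists.
have mu_ := mnn_pot (pf_mnn pf) (pf_pot pf).
have [m m0 low] := pot_lower beta0 n0 q1 (pf_mass_gt0 pf) (pf_pow_gt0 pf).
have {}low := low _ _ _ _ (pf_mnn pf) (pf_pot pf) (pf_mass pf) (pf_pow pf) (lexx _) (lexx _).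
have B0 : 0 <= u 0 / m by rewrite divr_ge0 ?ltW// (pf_pot_gt0 pf).
have uB x : u 0 <= u 0 / m * u x.
  by rewrite mulrAC ler_pdivlMr// ler_pM2l// (pf_pot_gt0 pf).
have gr := pot_growth beta0 (pf_mnn pf) (pf_pot pf) (pf_mass pf) B0 low uB.
set c := M / _ in gr; have c0 : 0 < c.
  by rewrite divr_gt0 ?(pf_mass_gt0 pf)// mulr_gt0 ?powR_gt0// ltr_pwDl.
have [w [H [r0 [mw wr wH dual]]]] := dual_pot m0 c0.
have [h0 [G [gw uG gh hH]]] := dual u mu_ gr.
have mg := mnn_powR (- s - 1) mu_.
pose k := F `^ (- s^-1 - 1) / C.
have k0 : 0 < k by exact: (kappa_gt0 n0 beta0 s0 sbeta q1 pf).
have G0 : 0 < G.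
  by apply: integ_gt0 uG => // x; rewrite powR_gt0// (pf_pot_gt0 pf).
have [r r_ge0 supp] := best_reply_support k0 G0 ((mnn_pot mw wH).2 0).
have {}supp := supp _ _ _ _ mg gh uG (lexx _) hH (lexx _).
pose v x := best_reply (k * h0 x).
have mv : mnn v by exact: (mnn_best gamma n0 beta0 s0 sbeta q1 bE pf gh).
have [Mb [Pb [Ub boxed]]] := box_dominated (best_reply_ge0 q b gamma 0) r_ge0.
have [M' [P' [u' [vM _ vP _ [vu _]]]]] := boxed _ mv supp.
have [W [uW le eq]] := best_reply_improves n0 beta0 s0 sbeta q1 bE gammaE pf gh vM vP vu.
(* The reply cannot beat a minimiser, so all inequalities between their penalised values are
   equalities. Its mass must first be shown positive: otherwise [best_reply_improves] would put a
   nonnegative quantity below [1 + b - gamma < 0]. *)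
have fv : {ae mu, forall x, f x = v x}.
  have P'0 : 0 <= b * P'.
    by rewrite mulr_ge0 ?(ltW b0)// -lee_fin -vP integ_ge0//; exact: mnn_powR.
  have W0 : 0 <= k * W.
    rewrite mulr_ge0 ?(ltW k0)// -lee_fin -uW integ_ge0//.
    by apply: mnnM => //; exact: mnn_pot mv vu.
  have kF := kappaF n0 beta0 s0 sbeta q1 pf.
  have M'0 : 0 < M'.
    move: le min; rewrite kF /penalized -/k => h1 h2.
    have : 0 < gamma * M' by move: h1 h2 b1 P'0 W0; lra.
    by rewrite pmulr_rgt0.
  have [F' pF'] := profile_intro n0 beta0 s0 sbeta q1 mv vM M'0 vP vu.
  have h1 := penalized_best n0 beta0 s0 sbeta q1 pf vu pF' uW.
  have h2 := penalized_ge n0 beta0 s0 sbeta q1 bE gammaE pF'.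
  apply: eq; apply: le_anti; rewrite le/=.
  move: h1 h2 min; rewrite kF /penalized -/k; lra.
have vM' : integ v = M%:E by rewrite -(integ_ae (pf_mnn pf) mv fv) (pf_mass pf).
have vP' : integ (fun x => v x `^ q) = P%:E.
  rewrite -(pf_pow pf); apply/esym/integ_ae; try apply: mnn_powR => //.
    exact: pf_mnn pf.
  by apply: filterS fv => x ->.
have vu' : is_pot v u by exact: pot_ae (pf_mnn pf) (pf_pot pf) _ mv fv.
exists v, M, P, u, F, h0, k, r; split => //.
by case: pf => *; split.
Qed.

End existence.

(** * Reflections and polarization *)

Section reflections.
Context {R : realType} {n : nat}.
Local Notation V := 'rV[R]_n.
Local Notation enorm := (@euclidean_norm R n).
Implicit Types (f g u : V -> R) (x y z : V).

Section hyperplane.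
Variables (e : V) (r : R).
Hypothesis e0 : e != 0.

(** The normal [e] has arbitrary length, so that the bisector of [x] and [y] can use [y - x]. *)
Definition level x : R := r - dot x e.
Definition refl x : V := x + (2 * level x / dot e e) *: e.

Let ee0 : 0 < dot e e. Proof. exact: dotxx_gt0. Qed.

Lemma level_refl x : level (refl x) = - level x.
Proof. by rewrite /refl {1}/level !dotE /level; field; rewrite gt_eqF. Qed.

Lemma reflK : involutive refl.
Proof.
move=> x; rewrite [LHS]/refl level_refl /refl -addrA -scalerDl.
by rewrite mulrN mulNr subrr scale0r addr0.
Qed.

Lemma refl_level0 x : level x = 0 -> refl x = x.
Proof. by rewrite /refl => ->; rewrite mulr0 mul0r scale0r addr0. Qed.

Lemma enorm_refl x y : enorm (refl x - refl y) = enorm (x - y).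
Proof.
apply: eq_enorm; rewrite /refl opprD addrACA -scalerBl !dotE.
rewrite !(dotC e) /level; field; by rewrite gt_eqF.
Qed.

(** The source of the sign information on the kernel: points on the same side are closer to each
    other than to the mirror images. *)
Lemma dist_refl x y : dot (x - refl y) (x - refl y) =
  dot (x - y) (x - y) + 4 * (level x * level y) / dot e e.
Proof.
rewrite /refl /level !dotE !(dotC e) (dotC y x); field; by rewrite gt_eqF.
Qed.

Lemma measurable_level : measurable_fun setT level.
Proof. by apply: measurable_funB => //; exact: measurable_dot. Qed.

(** [refl] is the linear reflection [T] followed by a translation; linearity and [T (T x) = x] let
    translations pass through [T], as [preserving_isometry] demands. *)
Lemma preserving_refl : preserving refl.
Proof.
pose T x : V := x - (2 * dot x e / dot e e) *: e.
have mT : measurable_fun setT T.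
  apply: measurable_rV_add => //; apply: measurable_rV_opp.
  apply: measurable_rV_scale => //; apply: measurable_funM => //.
  by apply: measurable_funM => //; exact: measurable_dot.
have TD x y : T (x + y) = T x + T y.
  by rewrite /T dotDl mulrDr mulrDl scalerDl opprD addrACA.
have TK x : T (T x) = x.
  rewrite /T !dotE -addrA -opprD -scalerDl.
  rewrite [X in X *: e](_ : _ = 0) ?scale0r ?subr0//.
  by field; rewrite gt_eqF.
have pT : preserving T.
  apply: preserving_isometry => // [v|x].
    by exists (T v) => x; rewrite TD TK.
  apply: eq_enorm; rewrite /T !dotE !(dotC e); field; by rewrite gt_eqF.
have -> : refl = (fun x => x + (2 * r / dot e e) *: e) \o T.
  apply/funext => x; rewrite /refl /T /level /= -addrA -scaleNr -scalerDl.
  by congr (_ + _ *: _); field; rewrite gt_eqF.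
exact: preserving_comp (preserving_shift _) pT.
Qed.

End hyperplane.
End reflections.

Section symmetry.
Context {R : realType} {n : nat} (beta : R).
Hypothesis beta0 : 0 < beta.
Local Notation V := 'rV[R]_n.
Local Notation mu := (lebesgue_rV R n).
Local Notation kern := (@kern R n beta).
Local Notation is_pot := (@is_pot R n beta).
Implicit Types (f g u : V -> R) (x y z : V).

Variables (e : V) (r : R).
Hypothesis e0 : e != 0.
Local Notation level := (level e r).
Local Notation refl := (refl e r).

Lemma kern_refl x y : kern (refl x - y) = kern (x - refl y).
Proof. by rewrite !kernE -(enorm_refl r e0) reflK. Qed.

Lemma kern_refl_sg x y : Num.sg (kern (x - refl y) - kern (x - y)) =
  Num.sg (level x * level y).
Proof.
have ee0 := dotxx_gt0 e0; have D := dist_refl r e0 x y.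
have mono a c : 0 <= a -> a < c -> a `^ beta < c `^ beta.
  by move=> a0 ac; rewrite gt0_ltr_powR ?nnegrE ?(le_trans a0)// ltW.
have [l0|l0|l0] := ltgtP (level x * level y) 0.
- rewrite (ltr0_sg l0) ltr0_sg// subr_lt0 !kernE; apply: mono; first exact: enorm_ge0.
  by apply: ltr_enorm; rewrite D gtrDl pmulr_llt0 ?invr_gt0// pmulr_rlt0.
- rewrite (gtr0_sg l0) gtr0_sg// subr_gt0 !kernE; apply: mono; first exact: enorm_ge0.
  by apply: ltr_enorm; rewrite D ltrDl divr_gt0// mulr_gt0.
- rewrite l0 !kernE; rewrite (@eq_enorm _ _ (x - refl y) (x - y)) ?subrr//.
  by rewrite D l0 mulr0 mul0r addr0.
Qed.

(** As [refl] preserves the measure, an integral depends only on the sums over the pairs [x],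
    [refl x]. *)
Lemma integ_sym f g c : mnn f -> mnn g ->
  (forall x, f x + f (refl x) = g x + g (refl x)) -> integ g = c%:E -> integ f = c%:E.
Proof.
move=> mf mg fg gc; have pr := preserving_refl r e0.
have mc h : mnn h -> mnn (h \o refl) by move=> mh; exact: mnn_comp pr.1 mh.
have D h : mnn h -> integ (fun x => h x + h (refl x)) = (integ h + integ h)%E.
  move=> mh; rewrite -[X in (_ + X)%E](integ_preserving pr mh) -integD//; exact: mc.
have : integ (fun x => f x + f (refl x)) = integ (fun x => g x + g (refl x)).
  exact: integ_eq.
rewrite !D// gc; case: (integ f) => // v; rewrite -!EFinD => -[h]; congr EFin; lra.
Qed.

Lemma integ_pot_refl f u x : mnn f -> is_pot f u ->
  [/\ integ (fun y => kern (x - refl y) * f y) = (u (refl x))%:E,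
      integ (fun y => kern (x - refl y) * f (refl y)) = (u x)%:E
    & integ (fun y => kern (x - y) * f (refl y)) = (u (refl x))%:E].
Proof.
move=> mf fu; have pr := preserving_refl r e0.
have A : integ (fun y => kern (x - refl y) * f y) = (u (refl x))%:E.
  by rewrite -fu; apply: integ_eq => y; rewrite kern_refl.
split => //.
  by rewrite -fu -[RHS](integ_preserving pr)//; exact: mnn_kernf.
rewrite -A -[RHS](integ_preserving pr); first by apply: integ_eq => y /=; rewrite reflK.
apply: mnnM => //; apply: (mnn_comp (f := fun y => kern (x - y)) pr.1).
exact: (mnn2_1 x (mnn2_kernB beta)).
Qed.

(* Reflecting the integration variable symmetrises both integrals, after
   which the integrands compare pointwise. *)
Lemma pot_refl_sign (t : R) f u : mnn f -> is_pot f u ->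
  {ae mu, forall y, 0 <= t * level y * (f y - f (refl y))} ->
  forall x, t * level x * (u x - u (refl x)) <= 0.
Proof.
move=> mf fu fs x; have pr := preserving_refl r e0.
have [I1 I2 I3] := integ_pot_refl x mf fu.
have mk : mnn (fun y => kern (x - y)) by exact: (mnn2_1 x (mnn2_kernB beta)).
have mk' : mnn (fun y => kern (x - refl y)) by exact: (mnn_comp pr.1 mk).
have mf' : mnn (fun y => f (refl y)) by exact: (mnn_comp pr.1 mf).
pose a y := kern (x - y) * f y + kern (x - refl y) * f (refl y).
pose a' y := kern (x - refl y) * f y + kern (x - y) * f (refl y).
have ma : mnn a by apply: mnnD; exact: mnnM.
have ma' : mnn a' by apply: mnnD; exact: mnnM.
have Ia : integ a = (u x + u x)%:E.
  by rewrite integD; [rewrite fu I2|exact: mnnM|exact: mnnM].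
have Ia' : integ a' = (u (refl x) + u (refl x))%:E.
  by rewrite integD; [rewrite I1 I3|exact: mnnM|exact: mnnM].
have aa : {ae mu, forall y, 0 <= t * level x * (a' y - a y)}.
  apply: filterS fs => y fy.
  have -> : a' y - a y = (kern (x - refl y) - kern (x - y)) * (f y - f (refl y)).
    by rewrite /a /a'; ring.
  rewrite [kern (x - refl y) - kern (x - y)]numEsg kern_refl_sg.
  set K := `|kern _ - _|; have K0 : 0 <= K by exact: normr_ge0.
  have -> : t * level x * (Num.sg (level x * level y) * K * (f y - f (refl y))) =
    (level x * Num.sg (level x)) * K * (t * Num.sg (level y) * (f y - f (refl y))).
    by rewrite sgrM; ring.
  apply: mulr_ge0; first by rewrite mulr_ge0// mulrC -normrEsg.
  have [->|ly] := eqVneq (level y) 0; first by rewrite sgr0 mulr0 mul0r.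
  have ly0 : 0 < `|level y| by rewrite normr_gt0.
  rewrite -(pmulr_rge0 _ ly0); move: fy; rewrite {1}[level y]numEsg.
  by congr (is_true (_ <= _)); ring.
have [tx|tx|tx] := ltgtP (t * level x) 0.
- have : (integ a' <= integ a)%E.
    apply: integ_le_ae => //; apply: filterS aa => y.
    by rewrite nmulr_rge0// subr_le0.
  by rewrite Ia Ia' lee_fin => h; rewrite nmulr_rle0// subr_ge0; lra.
- have : (integ a <= integ a')%E.
    apply: integ_le_ae => //; apply: filterS aa => y.
    by rewrite pmulr_rge0// subr_ge0.
  by rewrite Ia Ia' lee_fin => h; rewrite pmulr_rle0// subr_le0; lra.
- by rewrite tx mul0r.
Qed.

End symmetry.

Section polarization.
Context {R : realType} {n : nat} (beta : R).
Hypothesis beta0 : 0 < beta.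
Local Notation V := 'rV[R]_n.
Local Notation mu := (lebesgue_rV R n).
Local Notation kern := (@kern R n beta).
Local Notation is_pot := (@is_pot R n beta).
Implicit Types (f g u : V -> R) (x y z : V).

Variables (e : V) (r : R).
Hypothesis e0 : e != 0.
Local Notation level := (level e r).
Local Notation refl := (refl e r).

(** The two-point rearrangement towards the side where [level] is nonnegative. *)
Definition polarize f x : R :=
  if 0 <= level x then Num.max (f x) (f (refl x)) else Num.min (f x) (f (refl x)).

Lemma mnn_refl f : mnn f -> mnn (fun x => f (refl x)).
Proof. by move=> mf; exact: (mnn_comp (preserving_refl r e0).1 mf). Qed.

Lemma mnn_polarize f : mnn f -> mnn (polarize f).
Proof.
move=> mf; have mf' := mnn_refl mf; split; last first.
  by move=> x; rewrite /polarize; case: ifP; rewrite ?le_max ?le_min ?mf.2 ?mf'.2.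
apply: measurable_fun_ifT.
- by apply: measurable_fun_ler => //; exact: measurable_level.
- by apply: measurable_maxr; [exact: mf.1|exact: mf'.1].
- by apply: measurable_minr; [exact: mf.1|exact: mf'.1].
Qed.

Lemma polarize_swap f x : (polarize f x = f x /\ polarize f (refl x) = f (refl x)) \/
  (polarize f x = f (refl x) /\ polarize f (refl x) = f x).
Proof.
rewrite /polarize (level_refl r e0) (reflK r e0) oppr_ge0.
have [l0|l0|l0] := ltgtP (level x) 0; last first.
  by left; rewrite (refl_level0 l0) maxxx.
- by have [h|/ltW h] := leP (f x) (f (refl x)); [right|left];
    rewrite ?(min_l h) ?(min_r h).
- by have [h|/ltW h] := leP (f x) (f (refl x)); [left|right];
    rewrite ?(max_l h) ?(max_r h).
Qed.

Lemma polarize_diff f x : polarize f x - polarize f (refl x) = Num.sg (level x) * `|f x - f (refl x)|.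
Proof.
rewrite /polarize (level_refl r e0) (reflK r e0) oppr_ge0.
have [l0|l0|l0] := ltgtP (level x) 0; last first.
- by rewrite (refl_level0 l0) l0 sgr0 mul0r subrr.
- rewrite (gtr0_sg l0) mul1r; have [h|/ltW h] := leP (f x) (f (refl x)).
    by rewrite ?(min_r h) (distrC (f x)) ger0_norm// subr_ge0.
  by rewrite ?(min_l h) ger0_norm// subr_ge0.
- rewrite (ltr0_sg l0) mulN1r; have [h|/ltW h] := leP (f x) (f (refl x)).
    by rewrite ?(max_l h) (distrC (f x)) ger0_norm ?opprB// subr_ge0.
  by rewrite ?(max_r h) ger0_norm ?opprB// subr_ge0.
Qed.

(** A decreasing power exchanges maximum and minimum. Hence the polarizations of [u ^ (- s)] and of
    [u ^ (- s - 1)] are powers of one and the same function. *)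
Lemma polarize_powRN u p x : 0 <= p -> (forall x, 0 < u x) ->
  polarize (fun x => u x `^ (- p)) x =
  (if 0 <= level x then Num.min (u x) (u (refl x)) else Num.max (u x) (u (refl x))) `^ (- p).
Proof.
move=> p0 u0; rewrite /polarize.
have [h|/ltW h] := leP (u x) (u (refl x)); have h' := powRN_le p0 (u0 _) h.
  by rewrite (max_l h') (min_r h'); case: ifP.
by rewrite (max_r h') (min_l h'); case: ifP.
Qed.

(** Written with sums and differences over the pairs, only the product of differences changes:
    [(k' - k) * ((a - c) * (b - d))] becomes its absolute value, entering with a minus sign. *)
Lemma rearrangement (k k' lx ly a c b d A C B D : R) :
  Num.sg (k' - k) = Num.sg (lx * ly) ->
  A + C = a + c -> A - C = Num.sg lx * `|a - c| ->
  B + D = b + d -> B - D = Num.sg ly * `|b - d| ->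
  k * (A * B + C * D) + k' * (A * D + C * B) <= k * (a * b + c * d) + k' * (a * d + c * b)
  /\ (k * (A * B + C * D) + k' * (A * D + C * B) = k * (a * b + c * d) + k' * (a * d + c * b)
   -> 0 <= lx * ly * ((a - c) * (b - d))).
Proof.
move=> sk AC AC' BD BD'.
have E v w v' w' : 2 * (k * (v * w + v' * w') + k' * (v * w' + v' * w)) =
    (k + k') * ((v + v') * (w + w')) - (k' - k) * ((v - v') * (w - w')) by ring.
have E1 := E A B C D; have E2 := E a b c d.
rewrite AC BD AC' BD' in E1.
have E3 : (k' - k) * (Num.sg lx * `|a - c| * (Num.sg ly * `|b - d|)) =
    `|(k' - k) * ((a - c) * (b - d))|.
  rewrite !normrM [`|k' - k|]normrEsg sk sgrM; ring.
rewrite E3 in E1.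
have le := ler_norm ((k' - k) * ((a - c) * (b - d))).
split; first by rewrite -(ler_pM2l (ltr0n R 2)) E1 E2 lerD2l lerN2.
move=> eq; have {}le : 0 <= (k' - k) * ((a - c) * (b - d)).
  rewrite -eq E1 in E2; move/addrI/oppr_inj : E2 => <-; exact: normr_ge0.
rewrite [lx * ly]numEsg -sk mulrAC mulr_ge0//.
have [kk|kk] := eqVneq (k' - k) 0; first by rewrite kk sgr0 mul0r.
have k0 : 0 < `|k' - k| by rewrite normr_gt0.
by rewrite -(pmulr_rge0 _ k0) mulrA [`|_| * _]mulrC -numEsg.
Qed.

Section inequality.
Variables (f g u u' : V -> R).
Hypotheses (mf : mnn f) (mg : mnn g) (fu : is_pot f u) (fu' : is_pot (polarize f) u').

(* Up to an isometry of the kernel, the sum of [g' x kern (x - y) f' y] over the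
   four pairs obtained by reflecting [x] and [y]. *)
Let S (f' g' : V -> R) x y : R :=
  kern (x - y) * (g' x * f' y + g' (refl x) * f' (refl y)) +
  kern (x - refl y) * (g' x * f' (refl y) + g' (refl x) * f' y).

Let mnn_S f' g' x : mnn f' -> mnn g' -> mnn (S f' g' x).
Proof.
move=> mf' mg'; have mk : mnn (fun y => kern (x - y)) by exact: (mnn2_1 x (mnn2_kernB beta)).
have mk' := mnn_refl mk; have mf'' := mnn_refl mf'.
apply: mnnD; apply: mnnM => //; apply: mnnD; apply: mnnZ => //; exact: mg'.2.
Qed.

Let integ_S f' g' v x : mnn f' -> mnn g' -> is_pot f' v ->
  integ (S f' g' x) = (2 * (g' x * v x + g' (refl x) * v (refl x)))%:E.
Proof.
move=> mf' mg' fv; have [I1 I2 I3] := integ_pot_refl r e0 x mf' fv.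
have mk : mnn (fun y => kern (x - y)) by exact: (mnn2_1 x (mnn2_kernB beta)).
have mk' := mnn_refl mk; have mf'' := mnn_refl mf'.
pose T1 y := g' x * (kern (x - y) * f' y) + g' (refl x) * (kern (x - y) * f' (refl y)).
pose T2 y := g' x * (kern (x - refl y) * f' (refl y)) + g' (refl x) * (kern (x - refl y) * f' y).
have m11 : mnn (fun y => kern (x - y) * f' y) by exact: mnnM.
have m12 : mnn (fun y => kern (x - y) * f' (refl y)) by exact: mnnM.
have m21 : mnn (fun y => kern (x - refl y) * f' (refl y)) by exact: mnnM.
have m22 : mnn (fun y => kern (x - refl y) * f' y) by exact: mnnM.
have g1 := mg'.2 x; have g2 := mg'.2 (refl x).
rewrite (integ_eq (g := fun y => T1 y + T2 y)); last by move=> y; rewrite /S /T1 /T2; ring.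
rewrite integD; [|by apply: mnnD; exact: mnnZ|by apply: mnnD; exact: mnnZ].
rewrite integD; [|exact: mnnZ|exact: mnnZ].
rewrite integD; [|exact: mnnZ|exact: mnnZ].
rewrite !integZ// fv I1 I2 I3 -!EFinM -!EFinD; congr EFin; ring.
Qed.

Let S_le x y : S (polarize f) (polarize g) x y <= S f g x y /\
  (S (polarize f) (polarize g) x y = S f g x y ->
   0 <= level x * level y * ((g x - g (refl x)) * (f y - f (refl y)))).
Proof.
have sum h z : polarize h z + polarize h (refl z) = h z + h (refl z).
  by have [[-> ->]|[-> ->]] := polarize_swap h z; rewrite 1?addrC.
apply: rearrangement; [exact: kern_refl_sg|exact: sum|exact: polarize_diff|exact: sum|exact: polarize_diff].
Qed.

Lemma polarize_pot_le x : polarize g x * u' x + polarize g (refl x) * u' (refl x) <=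
  g x * u x + g (refl x) * u (refl x).
Proof.
rewrite -(ler_pM2l (ltr0n R 2)) -lee_fin.
rewrite -(integ_S _ (mnn_polarize mf) (mnn_polarize mg) fu') -(integ_S _ mf mg fu).
apply: integ_le => [||y]; [exact: mnn_S (mnn_polarize mf) (mnn_polarize mg)|exact: mnn_S|].
by case: (S_le x y).
Qed.

Lemma polarize_pot_eq x : polarize g x * u' x + polarize g (refl x) * u' (refl x) =
    g x * u x + g (refl x) * u (refl x) ->
  {ae mu, forall y, 0 <= level x * level y * ((g x - g (refl x)) * (f y - f (refl y)))}.
Proof.
move=> E; have := integ_eq_ae (mnn_S x (mnn_polarize mf) (mnn_polarize mg)) (mnn_S x mf mg)
  (fun y => (S_le x y).1) (integ_S x (mnn_polarize mf) (mnn_polarize mg) fu').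
by rewrite E => /(_ (integ_S x mf mg fu)); apply: filterS => y; exact: (S_le x y).2.
Qed.

Lemma polarize_duality F W : integ (fun x => g x * u x) = F%:E ->
  integ (fun x => polarize g x * u' x) = W%:E -> W <= F /\ (F <= W ->
  {ae mu, forall x, {ae mu, forall y,
     0 <= level x * level y * ((g x - g (refl x)) * (f y - f (refl y)))}}).
Proof.
move=> gF gW; have pr := preserving_refl r e0.
have mgu : mnn (fun x => g x * u x) by apply: mnnM => //; exact: mnn_pot mf fu.
have mgu' : mnn (fun x => polarize g x * u' x).
  by apply: mnnM; [exact: mnn_polarize|exact: mnn_pot (mnn_polarize mf) fu'].
have D h c : mnn h -> integ h = c%:E -> integ (fun x => h x + h (refl x)) = (2 * c)%:E.
  move=> mh hc; rewrite integD//; last exact: mnn_refl.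
  rewrite hc (_ : integ (fun x => h (refl x)) = integ h) ?hc; last by rewrite -hc; exact: integ_preserving pr mh.
  by rewrite -EFinD; congr EFin; ring.
have m1 := mnnD mgu (mnn_refl mgu); have m2 := mnnD mgu' (mnn_refl mgu').
have := integ_le m2 m1 polarize_pot_le.
rewrite (D _ _ mgu gF) (D _ _ mgu' gW) lee_fin ler_pM2l// => WF; split => // FW.
have {WF FW}FW : W = F by apply: le_anti; rewrite WF.
have := integ_eq_ae m2 m1 polarize_pot_le (D _ _ mgu' gW); rewrite FW => /(_ (D _ _ mgu gF)).
by apply: filterS => x; exact: polarize_pot_eq.
Qed.

End inequality.
End polarization.

Lemma preserving_integrable {R : realType} {n : nat} (T : 'rV[R]_n -> 'rV[R]_n)
    (f : 'rV[R]_n -> \bar R) :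
  preserving T -> (lebesgue_rV R n).-integrable setT f ->
  (\int[lebesgue_rV R n]_x f (T x) = \int[lebesgue_rV R n]_x f x)%E /\
  (lebesgue_rV R n).-integrable setT (f \o T).
Proof.
move=> pT /integrableP[mf fi]; split; last first.
  apply/integrableP; split; first exact: measurableT_comp mf pT.1.
  rewrite (preserving_ge0_integral pT (f := fun x => `|f x|%E))//.
  exact: measurableT_comp.
rewrite integralE [RHS]integralE; congr (_ - _)%E.
  rewrite -(preserving_ge0_integral pT (measurable_funepos mf) (funepos_ge0 f)).
  by apply: eq_integral => x _; rewrite !funeposE.
rewrite -(preserving_ge0_integral pT (measurable_funeneg mf) (funeneg_ge0 f)).
by apply: eq_integral => x _; rewrite !funenegE.
Qed.

(** * Radial symmetry of the minimiser *)

Section radial_symmetry.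
Context {R : realType} {n : nat} (beta s q b gamma : R).
Hypotheses (n0 : (0 < n)%N) (beta0 : 0 < beta) (s0 : 0 < s) (sbeta : n%:R < s * beta)
  (q1 : 1 < q).
Hypotheses (bE : b = (beta - n%:R / s) / (n%:R * (q - 1))) (gammaE : gamma = 1 + q * b).
Local Notation V := 'rV[R]_n.
Local Notation mu := (lebesgue_rV R n).
Local Notation enorm := (@euclidean_norm R n).
Local Notation kern := (@kern R n beta).
Local Notation is_pot := (@is_pot R n beta).
Local Notation profile := (@profile R n beta s q).
Local Notation C := (@sharp R n beta s q).
Local Notation penalized := (@penalized R n beta s q b gamma).
Local Notation best_reply := (@best_reply R q b gamma).
Implicit Types (x y z e : V).

Variables (f : V -> R) (M P : R) (u : V -> R) (F : R) (h0 : V -> R) (k rho : R).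
Hypotheses (pf : profile f M P u F) (min : penalized M P F <= 1 + b - gamma)
  (gh : is_pot (fun x => u x `^ (- s - 1)) h0) (k0 : 0 < k)
  (fE : forall x, f x = best_reply (k * h0 x))
  (supp : forall x, f x <= best_reply 0 * \1_(box 0 rho) x).

Let g x := u x `^ (- s - 1).
Let mf : mnn f := pf_mnn pf.
Let fu : is_pot f u := pf_pot pf.
Let mu_ : mnn u. Proof. exact: mnn_pot mf fu. Qed.
Let mg : mnn g. Proof. exact: mnn_powR. Qed.
Let u0 x : 0 < u x. Proof. exact: pf_pot_gt0 pf x. Qed.
Let s1 : 0 <= s + 1. Proof. by rewrite addr_ge0// ltW. Qed.
Let F0 : 0 < F. Proof. exact: pf_neg_gt0 pf. Qed.

(** One link of the sign chain: [A] and [B] are the images of [a] and [c], values at a point and its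
    mirror image, under an antitone map. *)
Lemma antitone_sign (T a c A B : R) : T * (a - c) <= 0 -> (a <= c -> B <= A) ->
  (c <= a -> A <= B) -> 0 <= T * (A - B).
Proof.
have [T0|T0|->] := ltgtP T 0; last by rewrite !mul0r.
- by rewrite nmulr_rle0// nmulr_rge0// subr_ge0 subr_le0 => h _; apply.
- by rewrite pmulr_rle0// pmulr_rge0// subr_ge0 subr_le0 => h + _; apply.
Qed.

Section hyperplane.
Variables (e : V) (r : R).
Hypothesis e0 : e != 0.
Local Notation level := (level e r).
Local Notation refl := (refl e r).

(* The sign of [f - f \o refl] passes from [f] to [u], then to [g], to [h0]
   and back to [f], losing the exceptional null set on the way. *)
Lemma sign_everywhere t : {ae mu, forall y, 0 <= t * level y * (f y - f (refl y))} ->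
  forall x, 0 <= t * level x * (f x - f (refl x)).
Proof.
move=> fs; have us := pot_refl_sign beta0 e0 mf fu fs.
have gs x : 0 <= t * level x * (g x - g (refl x)).
  by apply: (antitone_sign (us x)) => h; rewrite /g -opprD; exact: powRN_le.
have hs := pot_refl_sign beta0 e0 mg gh (aeW _ gs).
move=> x; rewrite !fE; apply: (antitone_sign (hs x)) => h;
  by apply: (best_reply_nonincreasing gamma n0 s0 sbeta q1 bE); rewrite ler_pM2l.
Qed.

(** Potentials do not see null sets, so [h0] is symmetric at every point, and [f] is a function of
    [h0]. *)
Lemma symmetric_of_dual : {ae mu, forall x, g x = g (refl x)} -> forall x, f x = f (refl x).
Proof.
move=> gg x; rewrite !fE; congr (best_reply (k * _)).
have [_ _ I3] := integ_pot_refl r e0 x mg gh.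
by have := pot_ae mg gh (mnn_refl r e0 mg) gg x; rewrite I3 => -[].
Qed.

(** Polarization keeps mass and power, so minimality gives [F ^ (- s^-1) <= F' ^ (- s^-1)]. The dual
    is polarised along with [f]: it is [v ^ (- s - 1)] for a rearrangement [v] of [u] with the same
    [F], so [reverse_hoelder] gives [F <= W]. This is the equality case of [polarize_duality]. *)
Lemma polarized_dual : {ae mu, forall x, {ae mu, forall y,
  0 <= level x * level y * ((g x - g (refl x)) * (f y - f (refl y)))}}.
Proof.
have mpf := mnn_polarize r e0 mf; have mpg := mnn_polarize r e0 mg.
have swap (phi : R -> R) (w : V -> R) x : phi (polarize e r w x) + phi (polarize e r w (refl x)) =
    phi (w x) + phi (w (refl x)).
  by have [[-> ->]|[-> ->]] := polarize_swap r e0 w x; rewrite // addrC.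
have pM : integ (polarize e r f) = M%:E.
  by apply: (integ_sym (r := r) e0 mpf mf _ (pf_mass pf)) => x; exact: (swap id).
have pP : integ (fun x => polarize e r f x `^ q) = P%:E.
  apply: (integ_sym (r := r) e0 (mnn_powR q mpf) (mnn_powR q mf) _ (pf_pow pf)) => x.
  exact: (swap (fun t => t `^ q)).
have [I1 _ I3] := integ_pot_refl r e0 0 mf fu.
have mfr := mnn_refl r e0 mf.
have [] := @integ_fin _ _ (fun y => kern (0 - y) * polarize e r f y)
  (fun y => kern (0 - y) * f y + kern (0 - y) * f (refl y)) (u 0 + u (refl 0)).
- exact: mnn_kernf.
- by apply: mnnD; exact: mnn_kernf.
- move=> y; rewrite -mulrDr ler_wpM2l ?kern_ge0//.
  by have [[-> _]|[-> _]] := polarize_swap r e0 f y; rewrite ?lerDl ?lerDr ?mf.2.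
- by rewrite integD; [rewrite fu I3|exact: mnn_kernf|exact: mnn_kernf].
move=> U [pU _ _]; have [u' pu] := is_pot_exists beta0 mpf pM pU.
have [F' pf'] := profile_intro n0 beta0 s0 sbeta q1 mpf pM (pf_mass_gt0 pf) pP pu.
have mu' := mnn_pot mpf pu.
have FF' : F `^ (- s^-1) <= F' `^ (- s^-1).
  have := penalized_ge n0 beta0 s0 sbeta q1 bE gammaE pf'; move: min.
  have Ci : 0 < C^-1 by rewrite invr_gt0; exact: sharp_gt0.
  rewrite /penalized => h1 h2.
  have : F `^ (- s^-1) / C <= F' `^ (- s^-1) / C by lra.
  by rewrite ler_pM2r.
pose v x := if 0 <= level x then Num.min (u x) (u (refl x)) else Num.max (u x) (u (refl x)).
have vE p x : 0 <= p -> v x `^ (- p) = polarize e r (fun x => u x `^ (- p)) x.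
  by move=> p0; rewrite polarize_powRN.
have mur := mnn_refl r e0 mu_.
have v0 x : 0 < v x by rewrite /v; case: ifP; rewrite ?lt_min ?lt_max ?u0.
have mv : mnn v.
  split; last by move=> x; exact: ltW.
  apply: measurable_fun_ifT.
  - by apply: measurable_fun_ler => //; exact: measurable_level.
  - by apply: measurable_minr; [exact: mu_.1|exact: mur.1].
  - by apply: measurable_maxr; [exact: mu_.1|exact: mur.1].
have vF : integ (fun x => v x `^ (- s)) = F%:E.
  apply: (integ_sym (r := r) e0 (mnn_powR (- s) mv) (mnn_powR (- s) mu_) _ (pf_neg pf)) => x.
  by rewrite !vE ?ltW//; exact: (swap id).
have gE x : v x `^ (- s - 1) = polarize e r g x.
  by rewrite -opprD vE// /polarize /g opprD.
have guF : integ (fun x => g x * u x) = F%:E.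
  rewrite -(pf_neg pf); apply: integ_eq => x.
  rewrite -[X in _ * X]powRr1 ?ltW// -powRD; first by congr (_ `^ _); ring.
  by rewrite (gt_eqF (u0 x)) implybT.
have mgu : mnn (fun x => g x * u x) by exact: mnnM.
have mgur := mnn_refl r e0 mgu.
have mgu' : mnn (fun x => polarize e r g x * u' x) by exact: mnnM.
have [] := @integ_fin _ _ (fun x => polarize e r g x * u' x)
  (fun x => g x * u x + g (refl x) * u (refl x)) (F + F) => //.
- exact: mnnD.
- move=> x; apply: le_trans (polarize_pot_le beta0 e0 mf mg fu pu x).
  by rewrite lerDl mulr_ge0 ?mpg.2 ?mu'.2.
- rewrite integD// guF EFinD; congr (_ + _)%E.
  by rewrite -guF; exact: (integ_preserving (preserving_refl r e0) mgu).
move=> W [gW _ _].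
have [_] := polarize_duality beta0 e0 mf mg fu pu guF gW; apply.
have vW : integ (fun x => v x `^ (- s - 1) * u' x) = W%:E.
  by rewrite -gW; apply: integ_eq => x; rewrite gE.
have := reverse_hoelder s0 mv mu' v0 (pf_pot_gt0 pf') vF (pf_neg pf') vW.
move=> /(le_trans FF'); rewrite powRB ?(gt_eqF F0) ?implybT// powRr1 ?(ltW F0)//.
rewrite mulrCA ler_pMr ?powR_gt0// ler_pdivlMr// mul1r.
by [].
Qed.

(** A single [x] off the hyperplane with [g x] different from [g (refl x)], outside a null set,
    already orders [f] one way almost everywhere. Otherwise [g] is symmetric almost everywhere, and
    then [f] is symmetric. *)
Lemma dichotomy : (forall x, 0 <= level x * (f x - f (refl x))) \/
  (forall x, level x * (f x - f (refl x)) <= 0).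
Proof.
have [A|nA] := pselect {ae mu, forall y, 0 <= 1 * level y * (f y - f (refl y))}.
  by left => x; have := sign_everywhere A x; rewrite mul1r.
have [B|nB] := pselect {ae mu, forall y, 0 <= -1 * level y * (f y - f (refl y))}.
  by right => x; have := sign_everywhere B x; rewrite mulN1r mulNr oppr_ge0.
exfalso; apply: (nA); apply: aeW => x; rewrite -symmetric_of_dual ?subrr ?mulr0//.
apply: filterS polarized_dual => {}x gx.
have [l0|l0] := eqVneq (level x) 0; first by rewrite (refl_level0 l0).
have [d0|d0|/eqP] := ltgtP (level x * (g x - g (refl x))) 0; last first.
- by rewrite mulf_eq0 (negbTE l0)/= subr_eq0 => /eqP.
- exfalso; apply: nA; apply: filterS gx => y.
  by rewrite mul1r mulrACA pmulr_rge0.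
- exfalso; apply: nB; apply: filterS gx => y.
  by rewrite mulN1r mulNr oppr_ge0 mulrACA nmulr_rge0.
Qed.

End hyperplane.

Lemma level_opp e r x : level (- e) (- r) x = - level e r x.
Proof. by rewrite /level dotNr opprD. Qed.

Lemma refl_opp e r x : refl (- e) (- r) x = refl e r x.
Proof. by rewrite /refl level_opp !dotE opprK mulrN mulNr scaleNr scalerN opprK. Qed.

Let integrable_mul (a : V -> R) (B : R) : measurable_fun setT a ->
  (forall x, box 0 rho x -> `|a x| <= B) -> mu.-integrable setT (fun x => (a x * f x)%:E).
Proof.
move=> ma aB; have iF : mu.-integrable setT (fun x => (B * f x)%:E).
  apply/integrableP; split.
    by apply/measurable_EFinP; apply: measurable_funM => //; exact: mf.1.
  rewrite (eq_integral (fun x => (`|B| * f x)%:E)); last first.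
    by move=> x _; rewrite /= normrM (ger0_norm (mf.2 x)).
  by rewrite -/(integ _) integZ// (pf_mass pf) ltry.
apply: le_integrable iF => //.
  by apply/measurable_EFinP; apply: measurable_funM => //; exact: mf.1.
move=> x _; rewrite lee_fin !normrM (ger0_norm (mf.2 x)).
have := supp x; rewrite indicE; case: (boolP (x \in _)) => [xB _|_].
  by rewrite ler_wpM2r ?mf.2// (le_trans (aB _ (set_mem xB)))// ler_norm.
rewrite mulr0 => fx; have -> : f x = 0 by apply: le_anti; rewrite fx mf.2.
by rewrite !mulr0.
Qed.

Let coord_bound i x : box 0 rho x -> `|x ord0 i| <= rho.
Proof. by move=> /boxE/(_ i); rewrite mxE subr0. Qed.

Definition barycenter : V :=
  \row_i (fine (\int[mu]_x (x ord0 i * f x)%:E)%E / M).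

Lemma integ_level e r :
  (\int[mu]_x (level e r x * f x)%:E)%E = (M * (r - dot barycenter e))%:E.
Proof.
have ix i : mu.-integrable setT (fun x : V => (x ord0 i * f x)%:E).
  apply: (@integrable_mul (fun x : V => x ord0 i) rho); first exact: measurable_coord.
  by move=> x; exact: coord_bound.
have ir : mu.-integrable setT (fun x => (r * f x)%:E).
  by apply: (@integrable_mul (cst r) `|r|).
pose h (i : 'I_n) (x : V) : \bar R := ((e ord0 i)%:E * (x ord0 i * f x)%:E)%E.
have ih i : mu.-integrable setT (h i) by exact: integrableZl.
have -> : (\int[mu]_x (level e r x * f x)%:E =
    \int[mu]_x ((r * f x)%:E - \sum_(i < n) h i x))%E.
  apply: eq_integral => x _; rewrite /h; under eq_bigr do rewrite -EFinM.
  rewrite sumEFin -EFinB; congr EFin; rewrite /level mulrBl; congr (_ - _).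
  by rewrite mulr_suml; apply: eq_bigr => i _; ring.
rewrite integralB//; last exact: integrable_sum.
rewrite integral_sum//.
have -> : (\int[mu]_x (r * f x)%:E)%E = (r * M)%:E.
  have i1 : mu.-integrable setT (fun x => (f x)%:E).
    have := @integrable_mul (cst 1) 1; under eq_fun do rewrite mul1r.
    by apply => // x _; rewrite normr1.
  under eq_integral do rewrite EFinM.
  by rewrite integralZl// -/(integ f) (pf_mass pf).
have M0 := pf_mass_gt0 pf.
under eq_bigr => i _.
  rewrite /h integralZl// -[X in (_ * X)%E]fineK; last exact: integrable_fin_num.
  over.
under eq_bigr do rewrite -EFinM.
rewrite sumEFin -EFinB; congr EFin; rewrite mulrBr; congr (_ - _); first exact: mulrC.
rewrite mulr_sumr; apply: eq_bigr => i _; rewrite mxE; field.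
by rewrite gt_eqF.
Qed.

(** [level] is odd under the reflection, so the two terms have equal integrals; [integ_level]
    computes each. *)
Lemma integ_reflected e r : e != 0 ->
  (forall x, 0 <= level e r x * (f x - f (refl e r x))) ->
  integ (fun x => level e r x * (f x - f (refl e r x))) =
  (2 * M * (r - dot barycenter e))%:E.
Proof.
move=> e0 D0; pose a x := level e r x * f x.
have pr := preserving_refl r e0.
have ia : mu.-integrable setT (EFin \o a).
  apply: (@integrable_mul (level e r) (`|r| + \sum_(i < n) rho * `|e ord0 i|)).
    exact: measurable_level.
  move=> x xB; apply: (le_trans (ler_normB _ _)); rewrite lerD2l.
  apply: (le_trans (ler_norm_sum _ _ _)); apply: ler_sum => i _.
  by rewrite normrM ler_wpM2r// coord_bound.
have [pE ia'] := preserving_integrable pr ia.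
rewrite /integ.
transitivity (\int[mu]_x ((a x)%:E + (a (refl e r x))%:E))%E.
  apply: eq_integral => x _; rewrite -EFinD; congr EFin.
  by rewrite /a level_refl//; ring.
rewrite integralD// [X in (_ + X)%E]pE integ_level -EFinD; congr EFin; ring.
Qed.

(** The integral of a nonnegative function is nonnegative. If it is zero, the opposite ordering
    holds almost everywhere, hence everywhere by [sign_everywhere], and both orderings together mean
    symmetry. *)
Lemma level_sign_barycenter e r : e != 0 ->
  (forall x, 0 <= level e r x * (f x - f (refl e r x))) ->
  0 <= r - dot barycenter e /\ (r = dot barycenter e -> forall x, f x = f (refl e r x)).
Proof.
move=> e0 D0; have pr := preserving_refl r e0; have M0 := pf_mass_gt0 pf.
have mfr := mnn_refl r e0 mf.
have mD : mnn (fun x => level e r x * (f x - f (refl e r x))).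
  split=> //; apply: measurable_funM; first exact: measurable_level.
  by apply: measurable_funB; [exact: mf.1|exact: mfr.1].
have ID := integ_reflected e0 D0; split.
  have := integ_ge0 mD; rewrite ID lee_fin pmulr_rge0//; exact: mulr_gt0.
move=> rE; have I0 : 2 * M * (r - dot barycenter e) = 0 by rewrite -rE subrr mulr0.
rewrite I0 in ID; have D00 := integ0_ae mD ID.
have A : {ae mu, forall y, 0 <= -1 * level e r y * (f y - f (refl e r y))}.
  by apply: filterS D00 => y; rewrite -mulrA => ->; rewrite mulr0.
move=> x; have := sign_everywhere e0 A x; have := D0 x.
rewrite mulN1r mulNr oppr_ge0 => h1 h2.
have [l0|l0] := eqVneq (level e r x) 0; first by rewrite (refl_level0 l0).
have /eqP : level e r x * (f x - f (refl e r x)) = 0 by apply: le_anti; rewrite h1 h2.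
by rewrite mulf_eq0 (negbTE l0)/= subr_eq0 => /eqP.
Qed.

Lemma level_flip e r : (forall x, level e r x * (f x - f (refl e r x)) <= 0) ->
  forall x, 0 <= level (- e) (- r) x * (f x - f (refl (- e) (- r) x)).
Proof. by move=> H x; rewrite level_opp refl_opp mulNr oppr_ge0. Qed.

(** The last identity turns the side on which the barycentre lies into a comparison of distances to
    it. *)
Lemma bisector x y : x != y -> let e := y - x in
  let r := (dot y y - dot x x) / 2 in
  [/\ e != 0, refl e r x = y, 0 < level e r x &
    2 * (r - dot barycenter e) = dot (y - barycenter) (y - barycenter) -
      dot (x - barycenter) (x - barycenter)].
Proof.
move=> xy e r; have e0 : e != 0 by rewrite subr_eq0 eq_sym.
have ee0 := dotxx_gt0 e0.
have lE : level e r x = dot e e / 2.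
  by rewrite /level /r /e !dotE (dotC y x); field.
split => //.
- rewrite /refl lE [X in X *: e](_ : _ = 1) ?scale1r; first by rewrite /e addrC subrK.
  by field; rewrite gt_eqF.
- by rewrite lE divr_gt0.
- by rewrite /r /e !dotE !(dotC barycenter); field.
Qed.

(** The barycentre lies on the side of [x] of the bisector, or on it. If the dichotomy has the wrong
    sign, the flipped hyperplane forces the barycentre onto it, and then [f x = f y] by symmetry. *)
Lemma radial_monotone x y : enorm (x - barycenter) <= enorm (y - barycenter) -> f y <= f x.
Proof.
have [->//|xy] := eqVneq x y; rewrite ler_enorm => le.
have [e0 rx l0 E] := bisector xy.
set e := y - x in e0 rx l0 E; set r := _ / 2 in rx l0 E.
have rb : 0 <= r - dot barycenter e by move: E le; lra.
have [D|D] := dichotomy r e0.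
  by have := D x; rewrite pmulr_rge0// rx subr_ge0.
have D' := level_flip D; have e0' : - e != 0 by rewrite oppr_eq0.
have [h1 h2] := level_sign_barycenter e0' D'.
rewrite dotNr opprK in h1 h2.
have rE : - r = - dot barycenter e by lra.
by have := h2 rE x; rewrite refl_opp rx => ->.
Qed.

End radial_symmetry.

(** * The functionals of the theorem *)

Section hls_functional.
Context {R : realType} {n : nat}.
Local Notation V := 'rV[R]_n.
Local Notation mu := (lebesgue_rV R n).
Local Notation enorm := (@euclidean_norm R n).
Implicit Types (f g u : V -> R) (x y z : V).

Lemma integ_ae_nonneg f g : (forall x, 0 <= f x) -> mnn g ->
  {ae mu, forall x, f x = g x} -> integ f = integ g.
Proof.
move=> f0 mg fg; apply: ae_eq_integral_nonneg.
- by move=> x; rewrite lee_fin.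
- by move=> x; rewrite lee_fin mg.2.
- exact: mnn_EFin.
- by apply: filterS fg => x ->.
Qed.

Lemma integ_epow f p : (forall x, 0 <= f x) -> 0 < p ->
  (\int[mu]_x epow `|f x|%:E p)%E = integ (fun x => f x `^ p).
Proof.
move=> f0 p0; apply: eq_integral => x _.
by rewrite /epow (lt_gtF p0) ger0_norm// poweR_EFin.
Qed.

Lemma lp_norm_integ f p r : (forall x, 0 <= f x) -> 0 < p ->
  integ (fun x => f x `^ p) = r%:E -> lp_norm p (EFin \o f) = (r `^ p^-1)%:E.
Proof.
move=> f0 p0 fr; rewrite /lp_norm; have -> : (\int[mu]_x epow `|(EFin \o f) x| p)%E = r%:E.
  by rewrite -fr -integ_epow.
by rewrite /epow invr_lt0 (lt_gtF p0) poweR_EFin.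
Qed.

Lemma lp_norm_ae f g p r : (forall x, 0 <= f x) -> mnn g ->
  {ae mu, forall x, f x = g x} -> 0 < p -> integ (fun x => g x `^ p) = r%:E ->
  lp_norm p (EFin \o f) = (r `^ p^-1)%:E.
Proof.
move=> f0 mg fg p0 gr; apply: (lp_norm_integ f0 p0); rewrite -gr.
apply: integ_ae_nonneg (mnn_powR p mg) _; first by move=> x; exact: powR_ge0.
by apply: filterS fg => x ->.
Qed.

Lemma E_alpha_integ alpha f g x : (forall x, 0 <= f x) -> mnn g ->
  {ae mu, forall x, f x = g x} ->
  E_alpha alpha f x = integ (fun y => kern (alpha - n%:R) (x - y) * g y).
Proof.
move=> f0 mg fg; apply: (integ_ae_nonneg (f := fun y => _ * f y)).
- by move=> y; rewrite mulr_ge0 ?powR_ge0.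
- exact: mnn_kernf.
- by apply: filterS fg => y ->; rewrite kernE.
Qed.

Lemma lp_norm_neg u (t' F : R) : t' < 0 -> (forall x, 0 < u x) ->
  integ (fun x => u x `^ t') = F%:E -> 0 < F ->
  lp_norm t' (fun x => (u x)%:E) = (F `^ t'^-1)%:E.
Proof.
move=> t0 u0 uF F0; rewrite /lp_norm (_ : integral _ _ _ = F%:E).
  by rewrite /epow invr_lt0 t0 gt_eqF.
rewrite -uF; apply: eq_integral => x _.
by rewrite /epow t0 /= gtr0_norm// gt_eqF.
Qed.

Lemma lp_norm_infty (t' : R) (U : V -> \bar R) : t' < 0 -> (forall x, U x = +oo%E) ->
  lp_norm t' U = +oo%E.
Proof.
move=> t0 Uoo; rewrite /lp_norm (_ : integral _ _ _ = 0%E).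
  by rewrite /epow invr_lt0 t0 /= eqxx.
rewrite (eq_integral (fun=> 0%E)) ?integral0// => x _.
by rewrite Uoo /epow t0.
Qed.

(** A Borel representative may be negative on a null set; its positive part still agrees with [f]
    almost everywhere. *)
Lemma lebesgue_mnn f : (forall x, 0 <= f x) -> lebesgue_measurable_fun f ->
  exists2 g, mnn g & {ae mu, forall x, f x = g x}.
Proof.
move=> f0 [g mg fg]; exists (fun x => Num.max (g x) 0).
  split; last by move=> x; rewrite le_max lexx orbT.
  exact: measurable_maxr.
by apply: filterS fg => x fgx; rewrite -fgx max_l.
Qed.

Lemma enorm_rV1 : (0 < n)%N -> exists e : V, enorm e = 1.
Proof.
move=> n0; exists (\row_i (i == Ordinal n0)%:R); rewrite enormE /dot.
rewrite (bigD1 (Ordinal n0))//= big1 ?addr0; last first.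
  by move=> i /negbTE i0; rewrite !mxE i0 mul0r.
by rewrite !mxE eqxx mulr1 sqrtr1.
Qed.

Lemma compact_box (a : V) (r : R) : compact (box a r).
Proof.
have := @rV_compact R n (fun i => `[a ord0 i - r, a ord0 i + r]%classic).
by apply=> i; exact: segment_compact.
Qed.

Lemma compactly_supported_box f a r : (forall x, f x != 0 -> box a r x) ->
  compactly_supported f.
Proof.
move=> fB; have cB := @compact_box a r.
have clB : closed (box a r) by apply: compact_closed => //; exact: norm_hausdorff.
apply: subclosed_compact cB _; first exact: closed_closure.
by rewrite ((closure_id _).1 clB); apply: closure_subset => x; exact: fB.
Qed.

End hls_functional.

Theorem theorem1p4 (R : realType) (n : nat) (alpha t q t' gamma : R)
    (n_ge1 : (1 <= n)%N) (n_lt_alpha : n%:R < alpha)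
    (t_gt : n%:R / alpha < t) (t_lt1 : t < 1) (q_gt1 : 1 < q)
    (t'_conjugate : 1 / t + 1 / t' = 1)
    (gammaE : gamma =
      (n%:R - q * alpha - n%:R / t' * q) / (n%:R * (1 - q))) :
  1 < gamma /\
  exists C : R,
    [/\ 0 < C,
        reverse_HLS_holds n alpha q t' gamma C,
        forall C' : R, reverse_HLS_holds n alpha q t' gamma C' -> C' <= C
      & exists f : 'rV[R]_n -> R,
          [/\ admissible q f,
              radially_nonincreasing f,
              bounded_fun f,
              compactly_supported f
            & reverse_HLS_lhs alpha q t' gamma f = reverse_HLS_rhs gamma C f]].
Proof.
have nR : 0 < n%:R :> R by rewrite ltr0n.
have a0 : 0 < alpha by exact: lt_trans n_lt_alpha.
have t0 : 0 < t by apply: lt_trans t_gt; rewrite divr_gt0.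
have t'V : t'^-1 = 1 - t^-1 by move: t'_conjugate; rewrite !div1r; lra.
have tV1 : 1 < t^-1 by rewrite invf_gt1.
have t'0 : t' < 0 by rewrite -invr_lt0 t'V; lra.
pose s := - t'; pose beta := alpha - n%:R.
have s0 : 0 < s by rewrite oppr_gt0.
have beta0 : 0 < beta by rewrite subr_gt0.
have sV : s^-1 = t^-1 - 1 by rewrite /s invrN t'V; ring.
(* As [s^-1 = t^-1 - 1], this is the hypothesis [n / alpha < t]. *)
have sbeta : n%:R < s * beta.
  have : t^-1 < alpha / n%:R.
    by rewrite invf_plt ?posrE ?divr_gt0// invf_div.
  rewrite ltr_pdivlMr// => h.
  have : s^-1 * n%:R < beta by rewrite sV /beta; lra.
  by rewrite mulrC ltr_pdivrMr// mulrC.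
(* Chosen so that [gamma - 1 = q b]: if [P] is the integral of [f ^ q], then [P ^ b] is the norm of
   exponent [q] to the power [gamma - 1]. *)
pose b := (beta - n%:R / s) / (n%:R * (q - 1)).
have q0 : 0 < q by exact: lt_trans q_gt1.
have gE : gamma = 1 + q * b.
  rewrite gammaE /b /beta /s; field.
  by rewrite (lt_eqF t'0) (gt_eqF nR) [1 - q == 0]lt_eqF ?subr_lt0// [q - 1 == 0]gt_eqF ?subr_gt0.
have bE : b = (beta - n%:R / s) / (n%:R * (q - 1)) by [].
have b0 : 0 < b := b_gt0 n_ge1 s0 sbeta q_gt1 bE.
have C0 : 0 < sharp (n := n) beta s q by exact: sharp_gt0.
set C := sharp _ _ _ in C0.
split; first by have := b_lt_gamma n_ge1 s0 sbeta q_gt1 bE gE; lra.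
(* An admissible [f] need not be Borel: both sides are computed on a representative [g]. The
   potential, being an integral, is the same at every point. *)
have eval (f g u : 'rV[R]_n -> R) M P F : (forall x, 0 <= f x) ->
    {ae lebesgue_rV R n, forall x, f x = g x} -> profile beta s q g M P u F ->
    reverse_HLS_lhs alpha q t' gamma f = (F `^ (- s^-1) * P `^ b)%:E /\
    forall C', reverse_HLS_rhs gamma C' f = (C' * M `^ gamma)%:E.
  move=> f0 fg pg; have mg := pf_mnn pg.
  have LM : lp_norm 1 (EFin \o f) = M%:E.
    rewrite (lp_norm_ae (r := M) f0 mg fg ltr01).
      by rewrite invr1 powRr1// ltW// (pf_mass_gt0 pg).
    by rewrite -(pf_mass pg); apply: integ_eq => x; rewrite powRr1// mg.2.
  have LP := lp_norm_ae f0 mg fg q0 (pf_pow pg).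
  have LU : E_alpha alpha f = fun x => (u x)%:E.
    by apply/funext => x; rewrite -(pf_pot pg) (E_alpha_integ _ _ f0 mg fg).
  split; last by move=> C'; rewrite /reverse_HLS_rhs LM poweR_EFin -EFinM.
  rewrite /reverse_HLS_lhs LU LP poweR_EFin -powRrM.
  have tE : t' = - s by rewrite /s opprK.
  rewrite (lp_norm_neg (F := F) t'0 (pf_pot_gt0 pg)) ?(pf_neg_gt0 pg)//; last first.
    by rewrite tE; exact: pf_neg pg.
  rewrite -EFinM; congr (_ `^ _ * P `^ _)%:E; first by rewrite tE invrN.
  by rewrite gE; field; rewrite gt_eqF.
have [f [M [P [u [F [h0 [k [r [pf min gh [k0 fE] supp]]]]]]]]] :=
  fixed_point_exists n_ge1 beta0 s0 sbeta q_gt1 bE gE.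
have Fmin := penalized_eq n_ge1 beta0 s0 sbeta q_gt1 bE gE pf min.
have rad := radial_monotone n_ge1 beta0 s0 sbeta q_gt1 bE gE pf min gh k0 fE supp.
set c := barycenter f M in rad.
have pfc := profile_shift c pf.
pose fc x := f (x + c).
have fc0 x : 0 <= fc x := (pf_mnn pfc).2 x.
have Pb0 : 0 < P `^ b by rewrite powR_gt0// (pf_pow_gt0 pf).
have Mg0 : 0 < M `^ gamma by rewrite powR_gt0// (pf_mass_gt0 pf).
have [lhsE rhsE] := eval fc fc _ M P F fc0 (aeW _ (fun x => erefl)) pfc.
have lhsE' : reverse_HLS_lhs alpha q t' gamma fc = (C * M `^ gamma)%:E.
  by rewrite lhsE Fmin powRN -mulrA -mulrA mulVf ?mulr1// gt_eqF.
have adm : admissible q fc.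
  have leb : lebesgue_measurable_fun fc by exists fc => //; [exact: (pf_mnn pfc).1|exact: aeW].
  split => //.
  - split => //; rewrite integ_epow// (integ_eq (g := fc)); last by move=> x; rewrite powRr1.
    by rewrite (pf_mass pfc) ltry.
  - by split => //; rewrite integ_epow// (pf_pow pfc) ltry.
  - move=> fc00; have := pf_mass pfc; rewrite (integ_ae_nonneg (g := cst 0) fc0 _ fc00); last first.
      exact: mnn_cst.
    by rewrite /integ integral0 => -[M0]; have := pf_mass_gt0 pf; rewrite -M0 ltxx.
exists C; split => //.
- move=> g [g0 [mg gM] [_ gP] gn0].
  have [g' mg' gg'] := lebesgue_mnn g0 mg.
  move: gM gP; rewrite !integ_epow// => gM gP.
  have gq : integ (fun x => g x `^ q) = integ (fun x => g' x `^ q).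
    apply: integ_ae_nonneg (mnn_powR q mg') _; first by move=> x; exact: powR_ge0.
    by apply: filterS gg' => x ->.
  have g1 : integ (fun x => g x `^ 1) = integ g'.
    rewrite (integ_eq (g := g)); last by move=> x; rewrite powRr1.
    exact: integ_ae_nonneg.
  rewrite gq in gP; rewrite g1 in gM.
  have [M' gM'] : exists M', integ g' = M'%:E.
    by move: gM (integ_ge0 mg'); case: (integ g') => [M'||] => [_ _|//|//]; exists M'.
  have [P' gP'] : exists P', integ (fun x => g' x `^ q) = P'%:E.
    by move: gP (integ_ge0 (mnn_powR q mg')); case: (integ _) => [P'||] => [_ _|//|//]; exists P'.
  have M'0 : 0 < M'.
    rewrite lt_neqAle (mass_ge0 mg' gM') andbT; apply/eqP => M'0.
    apply: gn0; rewrite -M'0 in gM'; have := integ0_ae mg' gM'.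
    by apply: filterS2 gg' => x ->.
  have P'0 := integ_powR_gt0 mg' gM' M'0 gP'.
  (* Without a finite potential, [E_alpha g] is infinite everywhere by [is_pot_exists]; its norm of
     negative exponent is then [+oo], and the inequality holds since the other factor is
     positive. *)
  have [[u' gu']|noU] := pselect (exists u', is_pot beta g' u').
    have [F' pg'] := profile_intro n_ge1 beta0 s0 sbeta q_gt1 mg' gM' M'0 gP' gu'.
    have [-> ->] := eval _ _ _ _ _ _ g0 gg' pg'.
    rewrite lee_fin; have := sharp_le n_ge1 s0 q_gt1 bE gE pg'.
    by rewrite powRN mulrA ler_pdivrMr// powR_gt0.
  have Uoo x : E_alpha alpha g x = +oo%E.
    rewrite (E_alpha_integ _ _ g0 mg' gg') -/beta.
    apply: contrapT => fin; apply: noU.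
    have [v E] : exists v, integ (fun y => kern beta (x - y) * g' y) = v%:E.
      move: fin (integ_ge0 (mnn_kernf beta x mg')).
      by case: (integ _) => [v| |] => [_ _|//|//]; exists v.
    exact: (is_pot_exists beta0 mg' gM' E).
  rewrite /reverse_HLS_lhs (lp_norm_infty t'0 Uoo) (lp_norm_ae g0 mg' gg' q0 gP').
  by rewrite poweR_EFin gt0_mulye ?leey// lte_fin !powR_gt0.
- move=> C' /(_ fc adm); rewrite rhsE lhsE' lee_fin ler_pM2r//.
- exists fc; split => //.
  + have [e e1] := @enorm_rV1 R n n_ge1.
    have rad' x y : euclidean_norm x <= euclidean_norm y -> fc y <= fc x.
      by move=> xy; apply: rad; rewrite !addrK.
    have eN v : 0 <= v -> euclidean_norm (v *: e) = v.
      by move=> v0; rewrite enormZ e1 mulr1 ger0_norm.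
    (* The radial profile is read along a ray; two points of equal norm have equal values by
       monotonicity used in both directions. *)
    exists (fun v => fc (v *: e)).
      move=> v w; rewrite !in_itv/= !andbT => v0 w0 vw; apply: rad'.
      by rewrite !eN.
    move=> x; apply: le_anti.
    by rewrite !rad' ?eN ?enorm_ge0.
  + exists (best_reply q b gamma 0); split; first exact: num_real.
    move=> B BB x _ /=; rewrite ger0_norm//; apply: le_trans (ltW BB).
    apply: (le_trans (supp _)); by rewrite ler_piMr ?best_reply_ge0// indicE.
  + apply: (@compactly_supported_box _ _ _ (- c) r) => x fx.
    have : box 0 r (x + c).
      apply: contrapT => nb; move: fx; rewrite /fc; have := supp (x + c).
      rewrite indicE memNset// mulr0 => fx; have -> : f (x + c) = 0.
        by apply: le_anti; rewrite fx (pf_mnn pf).2.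
      by rewrite eqxx.
    by move=> /boxE xb; apply/boxE => i; have := xb i; rewrite !mxE subr0 opprK.
  + by rewrite lhsE' rhsE.
Qed.
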